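(* Let $F$ be a finite subset of the open unit disk $\mathbb{D}$. For any $f\in H^\infty_1$, \[ \operatorname{dist}(f,\mathcal{I}^F)=\sup_{|\alpha|^2+|\beta|^2=1}\big\|M_f^*|_{\mathcal{M}^F_{\alpha,\beta}}\big\|. \]
   Context: $H^\infty_1$ is the algebra of bounded analytic functions $f$ on $\mathbb{D}$ with $f'(0)=0$, with the supremum norm $\|\cdot\|_\infty$; $\mathcal{I}^F$ is the ideal of functions in $H^\infty_1$ which vanish on $F$, and $\operatorname{dist}$ is distance in $\|\cdot\|_\infty$. For $(\alpha,\beta)\in\mathbb{C}^2$ with $|\alpha|^2+|\beta|^2=1$, $H^2_{\alpha,\beta}=\mathbb{C}(\alpha+\beta z)+z^2H^2$, a closed subspace of the Hardy space $H^2$ that is invariant under multiplication by $H^\infty_1$. $M_f$ denotes the operator of multiplication by $f$ on $H^2_{\alpha,\beta}$, and $M_f^*$ its adjoint on $H^2_{\alpha,\beta}$. $\mathcal{N}^F_{\alpha,\beta}$ is the subspace of functions in $H^2_{\alpha,\beta}$ vanishing on $F$, and $\mathcal{M}^F_{\alpha,\beta}=H^2_{\alpha,\beta}\ominus\mathcal{N}^F_{\alpha,\beta}$ is its orthogonal complement in $H^2_{\alpha,\beta}$. *)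

(* Defs.v *)
From HB Require Import structures.
From mathcomp Require Import all_boot all_order all_algebra.
From mathcomp Require Import complex.
From mathcomp Require Import all_classical all_reals all_analysis.
Set Implicit Arguments.
Unset Strict Implicit.
Unset Printing Implicit Defensive.
Import Order.TTheory GRing.Theory Num.Theory.
Import numFieldNormedType.Exports.
Local Open Scope classical_set_scope.
Local Open Scope complex_scope.
Local Open Scope ring_scope.

(* The complex field is [R[i]] and [Normc.normc] is the modulus with values in [R].
   The topology on [R[i]] is the one of the numFieldType [R[i]], which is
   attached to the alias [R[i]^o]; since the base field is [R[i]] itself,
   [derivable f z 1] and [f^`()] are the complex derivative.

   A function on the disk is represented by a total function [R[i] -> R[i]]
   whose values off the disk are irrelevant: none of the predicates, norms and
   inner products below depends on them. *)

Definition disk (R : realType) : set R[i] := [set z | `|z| < 1].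

Definition holomorphic (R : realType) (f : R[i] -> R[i]) : Prop :=
  forall z, disk z -> derivable (f : R[i]^o -> R[i]^o) z 1.

Definition vanishes_on (R : realType) (F : set R[i]) (f : R[i] -> R[i]) : Prop :=
  forall z, F z -> f z = 0.

Definition sup_norm (R : realType) (f : R[i] -> R[i]) : \bar R :=
  ereal_sup [set (Normc.normc (f z))%:E | z in @disk R].

Definition sup_dist (R : realType) (f : R[i] -> R[i])
    (A : set (R[i] -> R[i])) : \bar R :=
  ereal_inf [set sup_norm (fun z => f z - g z) | g in A].

Definition Hinf1 (R : realType) : set (R[i] -> R[i]) :=
  [set f | [/\ holomorphic f,
               exists M : R, forall z, disk z -> Normc.normc (f z) <= M
             & derive1 (f : R[i]^o -> R[i]^o) 0 = 0]].

Definition idealF (R : realType) (F : set R[i]) : set (R[i] -> R[i]) :=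
  [set f | Hinf1 f /\ vanishes_on F f].

Definition taylor (R : realType) (f : R[i] -> R[i]) (n : nat) : R[i] :=
  derive1n n (f : R[i]^o -> R[i]^o) 0 / n`!%:R.

Definition H2 (R : realType) : set (R[i] -> R[i]) :=
  [set h | holomorphic h /\
           cvgn (series (fun n => Normc.normc (taylor h n) ^+ 2))].

(* Linear in the first argument. *)
Definition h2dot (R : realType) (g h : R[i] -> R[i]) : R[i] :=
  limn (series (fun n => taylor g n * (taylor h n)^*%C) : nat -> R[i]^o).

Definition h2norm (R : realType) (h : R[i] -> R[i]) : R :=
  Num.sqrt (limn (series (fun n => Normc.normc (taylor h n) ^+ 2))).

Definition H2ab (R : realType) (alpha beta : R[i]) : set (R[i] -> R[i]) :=
  [set h | exists (c : R[i]) (g : R[i] -> R[i]),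
      H2 g /\
      forall z, disk z -> h z = c * (alpha + beta * z) + z ^+ 2 * g z].

Definition orth_compl (R : realType) (K N : set (R[i] -> R[i])) :
    set (R[i] -> R[i]) :=
  [set h | K h /\ forall g, N g -> h2dot h g = 0].

Definition NF (R : realType) (F : set R[i]) (alpha beta : R[i]) :
    set (R[i] -> R[i]) :=
  [set h | H2ab alpha beta h /\ vanishes_on F h].

Definition MF (R : realType) (F : set R[i]) (alpha beta : R[i]) :
    set (R[i] -> R[i]) :=
  orth_compl (H2ab alpha beta) (NF F alpha beta).

Definition mult_op (R : realType) (f h : R[i] -> R[i]) : R[i] -> R[i] :=
  fun z => f z * h z.

(* [adjoint K T h] is the vector [k] of [K], unique as a function on the disk,
   such that <T g, h> = <g, k> for all [g] in [K]; the Riesz representation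
   theorem provides it when [T] is a bounded operator on the closed subspace
   [K] of H^2. The default value of [xget] is used only if there is no such
   [k]. *)
Definition adjoint (R : realType) (K : set (R[i] -> R[i]))
    (T : (R[i] -> R[i]) -> (R[i] -> R[i])) (h : R[i] -> R[i]) : R[i] -> R[i] :=
  xget (fun=> 0) [set k | K k /\ forall g, K g -> h2dot (T g) h = h2dot g k].

Definition op_norm_on (R : realType) (M : set (R[i] -> R[i]))
    (T : (R[i] -> R[i]) -> (R[i] -> R[i])) : \bar R :=
  ereal_sup [set (h2norm (T h))%:E | h in [set h | M h /\ h2norm h <= 1]].

(* Main.v *)
(* For g in the ideal, M_f^* and M_(f-g)^* agree on M^F, so that the norms
   are at most the distance.

   For the converse, take t larger than the supremum. On the span of 1, z and
   the kernels 1 / (1 - conj(z_i) z) at the points z_i of F, with coordinates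
   v, let T_l multiply the entries of 1 and z by l and the entry of the
   kernel at z_i by conj(f(z_i) / t). If l is critical at v, i.e. (v(0),
   v(1), 0) is orthogonal to T_l v, then for a unit vector u = u_0 + u_1 z
   which is parallel to v(0) + v(1) z and orthogonal to T_l v, the space of
   functions orthogonal to u is a space H^2_{alpha,beta}; it contains T_l v,
   and t T_l v is the image under M_f^* of the projection of v. As t bounds
   these operators strictly, |T_l v| <= |v|.

   A minimax argument then gives one l such that T_l is a contraction:
   minimize over l the largest eigenvalue of T_l^* T_l - 1; if the derivative
   in l vanished at no top eigenvector, its values on them would form a
   convex set which avoids 0 (Toeplitz-Hausdorff), hence lie in a half-plane,
   and moving l against it would decrease the eigenvalue. The contraction
   property is the positivity of the Pick matrix for the data f(z_i) / t at
   z_i and the value l with vanishing derivative at 0, and Nevanlinna-Pick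
   interpolation yields g with |g| <= 1, g'(0) = 0 and t g = f on F, so
   dist(f, I^F) <= t. *)
Require Import Defs.
From mathcomp Require Import all_boot all_order all_algebra.
From mathcomp Require Import complex.
From mathcomp Require Import all_classical all_reals all_analysis.
From mathcomp Require Import ring lra.
Set Implicit Arguments.
Unset Strict Implicit.
Unset Printing Implicit Defensive.
Import Order.TTheory GRing.Theory Num.Theory.
Import numFieldNormedType.Exports.
Local Open Scope classical_set_scope.
Local Open Scope complex_scope.
Local Open Scope ring_scope.
Local Notation nc := Normc.normc.
Local Notation Re := (@complex.Re _).
Local Notation Im := (@complex.Im _).

(** * Modulus, limits and derivatives of complex functions *)

Section Modulus.
Variable R : realType.
Local Notation C := R[i].
Implicit Types (x y z w : C).

(** The operator [T_l] is the only possible adjoint of multiplication by an interpolant. If g is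
    bounded and holomorphic with g'(0) = 0, then M_g^* on H^2 multiplies both 1 and z by conj(g(0))
    and the kernel at z_i by conj(g(z_i)). Interpolation prescribes g on F and leaves g(0) free; l
    stands for its conjugate. The obstacle is that the pair (alpha, beta) for which the hypothesis
    says something about l and v depends on l and v, whereas interpolation needs a single l that
    serves every v. If 0 lies in F, the functions 1, z and the kernels are linearly dependent.
    Vectors are therefore given by coordinates, and the arguments use semidefinite forms without
    inverting a Gram matrix. The analytic preparation is due to the definitions: holomorphic means
    complex differentiable, while H^2 and its norm are read off Taylor coefficients. Passing from
    one to the other takes the Taylor expansion, proved from Goursat's theorem, and the bound of a
    multiplication operator by a supremum takes means over circles of radius r < 1. *)

Lemma normE z : `|z| = (nc z)%:C. Proof. by []. Qed.

Lemma nc_ge0 z : 0 <= nc z.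
Proof. by case: z => a b; exact: sqrtr_ge0. Qed.

Lemma nc0 : nc (0 : C) = 0. Proof. exact: Normc.normc0. Qed.
Lemma nc1 : nc (1 : C) = 1. Proof. exact: Normc.normc1. Qed.
Lemma ncM z w : nc (z * w) = nc z * nc w. Proof. exact: Normc.normcM. Qed.
Lemma ncV z : nc z^-1 = (nc z)^-1. Proof. exact: Normc.normcV. Qed.
Lemma ncN z : nc (- z) = nc z. Proof. exact: normcN. Qed.
Lemma ncD z w : nc (z + w) <= nc z + nc w. Proof. exact: le_normcD. Qed.
Lemma ncB z w : nc (z - w) <= nc z + nc w.
Proof. by rewrite -(ncN w) ncD. Qed.
Lemma ncBC z w : nc (z - w) = nc (w - z).
Proof. by rewrite -ncN opprB. Qed.
Lemma nc_eq0 z : (nc z == 0) = (z == 0).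
Proof. by apply/eqP/eqP => [/Normc.eq0_normc//|->]; rewrite nc0. Qed.
Lemma nc_gt0 z : (0 < nc z) = (z != 0).
Proof. by rewrite lt0r nc_eq0 nc_ge0 andbT. Qed.
Lemma ncX z n : nc (z ^+ n) = nc z ^+ n.
Proof. by elim: n => [|n IH]; rewrite ?expr0 ?nc1// !exprS ncM IH. Qed.
Lemma nc_real (r : R) : nc r%:C = `|r|.
Proof. by rewrite /= expr0n /= addr0 sqrtr_sqr. Qed.
Lemma nc_i : nc ('i%C : C) = 1.
Proof. by rewrite /= expr0n add0r expr1n sqrtr1. Qed.
Lemma nc_conj z : nc z^* = nc z.
Proof. by case: z => a b /=; rewrite sqrrN. Qed.
Lemma sqr_nc z : nc z ^+ 2 = Re z ^+ 2 + Im z ^+ 2.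
Proof. by case: z => a b /=; rewrite sqr_sqrtr// addr_ge0 ?sqr_ge0. Qed.
Lemma mulcJ z : z * z^* = (nc z ^+ 2)%:C.
Proof. by rewrite -sqr_normc normE rmorphXn. Qed.
Lemma nc_Re z : `|Re z| <= nc z.
Proof. by rewrite -lecR; exact: normc_ge_Re. Qed.
Lemma nc_Im z : `|Im z| <= nc z.
Proof. by have := nc_Re (z * 'i); rewrite ReiNIm normrN ncM /= expr0n add0r expr1n sqrtr1 mulr1. Qed.
Lemma Re_le_nc z : Re z <= nc z.
Proof. exact: le_trans (ler_norm _) (nc_Re z). Qed.
Lemma nc_le_ReIm z : nc z <= `|Re z| + `|Im z|.
Proof.
rewrite {1}[z]complexE (le_trans (ncD _ _))// ncM !nc_real /= expr0n add0r expr1n.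
by rewrite sqrtr1 mul1r.
Qed.
Lemma nc_sum I (r : seq I) (P : pred I) (F : I -> C) :
  nc (\sum_(i <- r | P i) F i) <= \sum_(i <- r | P i) nc (F i).
Proof.
elim/big_rec2: _ => [|i x y _ h]; first by rewrite nc0.
by rewrite (le_trans (ncD _ _))// lerD2l.
Qed.
Lemma nc_dist z w : `|nc z - nc w| <= nc (z - w).
Proof.
rewrite ler_norml; apply/andP; split.
  have := ncD (w - z) z; rewrite subrK ncBC; lra.
have := ncD (z - w) w; rewrite subrK; lra.
Qed.
Lemma ReM z w : Re (z * w) = Re z * Re w - Im z * Im w.
Proof. by case: z; case: w. Qed.
Lemma ImM z w : Im (z * w) = Re z * Im w + Im z * Re w.
Proof. by case: z => a b; case: w => c d /=. Qed.
Lemma ReD z w : Re (z + w) = Re z + Re w. Proof. by case: z; case: w. Qed.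
Lemma ImD z w : Im (z + w) = Im z + Im w. Proof. by case: z; case: w. Qed.
Lemma ReN z : Re (- z) = - Re z. Proof. by case: z. Qed.
Lemma ImN z : Im (- z) = - Im z. Proof. by case: z. Qed.
Lemma ReJ z : Re z^* = Re z. Proof. by case: z. Qed.
Lemma ImJ z : Im z^* = - Im z. Proof. by case: z. Qed.
Lemma rcM (r s : R) : (r * s)%:C = r%:C * s%:C. Proof. exact: rmorphM. Qed.
Lemma rcD (r s : R) : (r + s)%:C = r%:C + s%:C. Proof. exact: rmorphD. Qed.
Lemma rcB (r s : R) : (r - s)%:C = r%:C - s%:C. Proof. exact: rmorphB. Qed.
Lemma rcX (r : R) n : (r ^+ n)%:C = r%:C ^+ n. Proof. exact: rmorphXn. Qed.
Lemma rcV (r : R) : (r^-1)%:C = (r%:C)^-1. Proof. exact: fmorphV. Qed.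
Lemma rc1 : 1%:C = 1 :> C. Proof. by []. Qed.
Lemma conj_rc (r : R) : (r%:C)^* = r%:C. Proof. exact: conjc_real. Qed.
Lemma conj1 : (1 : C)^* = 1. Proof. exact: conjc1. Qed.
Lemma conj0 : (0 : C)^* = 0. Proof. exact: conjc0. Qed.
Lemma Re_realM (r : R) z : Re (r%:C * z) = r * Re z.
Proof. by case: z => a b /=; rewrite mul0r subr0. Qed.
Lemma conjK z : z^*^* = z. Proof. exact: conjcK. Qed.
Lemma conjM z w : (z * w)^* = z^* * w^*. Proof. exact: rmorphM. Qed.
Lemma conjD z w : (z + w)^* = z^* + w^*. Proof. exact: rmorphD. Qed.
Lemma conjB z w : (z - w)^* = z^* - w^*. Proof. exact: rmorphB. Qed.
Lemma conjN z : (- z)^* = - z^*. Proof. exact: rmorphN. Qed.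
Lemma conjX z n : (z ^+ n)^* = z^* ^+ n. Proof. exact: rmorphXn. Qed.
Lemma conjV z : (z^-1)^* = (z^*)^-1. Proof. exact: fmorphV. Qed.
Lemma conj_sum I (r : seq I) (P : pred I) (F : I -> C) :
  (\sum_(i <- r | P i) F i)^* = \sum_(i <- r | P i) (F i)^*.
Proof. exact: rmorph_sum. Qed.
Lemma eqC z w : Re z = Re w -> Im z = Im w -> z = w.
Proof. by case: z; case: w => a b c d /= -> ->. Qed.
Lemma Re_sum I (r : seq I) (P : pred I) (F : I -> C) :
  Re (\sum_(i <- r | P i) F i) = \sum_(i <- r | P i) Re (F i).
Proof. by elim/big_rec2: _ => //= i x y _ <-; rewrite ReD. Qed.
Lemma Im_sum I (r : seq I) (P : pred I) (F : I -> C) :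
  Im (\sum_(i <- r | P i) F i) = \sum_(i <- r | P i) Im (F i).
Proof. by elim/big_rec2: _ => //= i x y _ <-; rewrite ImD. Qed.

Lemma diskE z : disk z <-> nc z < 1.
Proof. by rewrite /disk /= normE -(ltcR _ 1). Qed.

(** Stated by real and imaginary parts so that real limit theorems (monotone convergence, Cesaro
    means, compactness of segments) apply directly; [ccvgE] links it to the topology of [C^o]. *)
Definition ccvg {T : Type} (F : set_system T) (u : T -> C) (l : C) :=
  (fun t => Re (u t)) @ F --> Re l /\ (fun t => Im (u t)) @ F --> Im l.

Lemma ccvgP {T : Type} (F : set_system T) {FF : Filter F} (u : T -> C) (l : C) :
  ccvg F u l <-> (forall e : R, 0 < e -> \forall t \near F, nc (u t - l) < e).
Proof.
split=> [[hr hi] e e0|h].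
  have e2 : 0 < e / 2 by rewrite divr_gt0.
  have /cvgrPdist_lt/(_ _ e2) h1 := hr.
  have /cvgrPdist_lt/(_ _ e2) h2 := hi.
  apply: filterS2 h1 h2 => t h1 h2.
  rewrite ncBC (le_lt_trans (nc_le_ReIm _))// ReD ReN ImD ImN.
  by rewrite (splitr e) ltrD.
split; apply/cvgrPdist_lt => e e0; have := h _ e0; apply: filterS => t;
  rewrite ncBC; apply: le_lt_trans.
  by have := nc_Re (l - u t); rewrite ReD ReN.
by have := nc_Im (l - u t); rewrite ImD ImN.
Qed.

Lemma ccvgE {T : Type} (F : set_system T) {FF : Filter F} (u : T -> C) (l : C) :
  ccvg F u l <-> ((u : T -> C^o) @ F --> (l : C^o)).
Proof.
rewrite ccvgP; split=> [h|/cvgrPdist_lt h e e0].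
  apply/cvgrPdist_lt => e; rewrite ltcE /= => /andP[/eqP ie re].
  have := h _ re; apply: filterS => t; rewrite normE ltcE /= => h1.
  by rewrite ie eqxx /= ncBC.
have := h e%:C; rewrite ltcR => /(_ e0); apply: filterS => t.
by rewrite normE ltcR ncBC.
Qed.

Section CcvgOps.
Context {T : Type} {F : set_system T} {FF : ProperFilter F}.
Implicit Types (u v : T -> C).

Lemma ccvg_cst (c : C) : ccvg F (fun=> c) c.
Proof. by split; exact: cvg_cst. Qed.
Lemma ccvgD u v k l : ccvg F u k -> ccvg F v l -> ccvg F (fun t => u t + v t) (k + l).
Proof.
move=> [a b] [c d]; split.
  by under eq_fun do rewrite ReD; rewrite ReD; exact: cvgD.
by under eq_fun do rewrite ImD; rewrite ImD; exact: cvgD.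
Qed.
Lemma ccvgN u k : ccvg F u k -> ccvg F (fun t => - u t) (- k).
Proof.
move=> [a b]; split.
  by under eq_fun do rewrite ReN; rewrite ReN; exact: cvgN.
by under eq_fun do rewrite ImN; rewrite ImN; exact: cvgN.
Qed.
Lemma ccvgB u v k l : ccvg F u k -> ccvg F v l -> ccvg F (fun t => u t - v t) (k - l).
Proof. by move=> ? ?; apply: ccvgD => //; exact: ccvgN. Qed.
Lemma ccvgM u v k l : ccvg F u k -> ccvg F v l -> ccvg F (fun t => u t * v t) (k * l).
Proof.
move=> [a b] [c d]; split.
  by under eq_fun do rewrite ReM; rewrite ReM; apply: cvgB; exact: cvgM.
by under eq_fun do rewrite ImM; rewrite ImM; apply: cvgD; exact: cvgM.
Qed.
Lemma ccvgJ u k : ccvg F u k -> ccvg F (fun t => (u t)^*) k^*.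
Proof.
move=> [a b]; split.
  by under eq_fun do rewrite ReJ; rewrite ReJ.
by under eq_fun do rewrite ImJ; rewrite ImJ; exact: cvgN.
Qed.
Lemma ccvgX u k n : ccvg F u k -> ccvg F (fun t => u t ^+ n) (k ^+ n).
Proof.
move=> h; elim: n => [|n IH]; first exact: ccvg_cst.
by under eq_fun do rewrite exprS; rewrite exprS; exact: ccvgM.
Qed.
Lemma ccvg_sum I (r : seq I) (P : pred I) (u : I -> T -> C) (k : I -> C) :
  (forall i, P i -> ccvg F (u i) (k i)) ->
  ccvg F (fun t => \sum_(i <- r | P i) u i t) (\sum_(i <- r | P i) k i).
Proof.
move=> h; elim: r => [|i r IH].
  by under eq_fun do rewrite big_nil; rewrite big_nil; exact: ccvg_cst.
under eq_fun do rewrite big_cons; rewrite big_cons.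
by case: ifP => // Pi; apply: ccvgD => //; exact: h.
Qed.
Lemma ccvg_unique u k l : ccvg F u k -> ccvg F u l -> k = l.
Proof.
move=> [a b] [c d]; apply: eqC.
  exact: (@cvg_unique _ (@norm_hausdorff _ R) (nbhs (Re \o u @ F)) _ _ _ a c).
exact: (@cvg_unique _ (@norm_hausdorff _ R) (nbhs (Im \o u @ F)) _ _ _ b d).
Qed.
Lemma ccvg_nc u k : ccvg F u k -> (fun t => nc (u t)) @ F --> nc k.
Proof.
move=> /ccvgP h; apply/cvgrPdist_lt => e e0.
have := h _ e0; apply: filterS => t; apply: le_lt_trans.
by rewrite distrC; exact: nc_dist.
Qed.
Lemma ccvg_le_nc u k (M : R) : ccvg F u k -> (forall t, nc (u t) <= M) -> nc k <= M.
Proof.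
by move=> /ccvg_nc h hM; apply: (cvgr_to_le h); exact: nearW.
Qed.
Lemma ccvg_eq u v k : (forall t, u t = v t) -> ccvg F u k -> ccvg F v k.
Proof. by move=> /funext ->. Qed.
End CcvgOps.

(** Complex differentiability without a quotient and with a real radius: the point [w = z] is
    allowed, and such estimates add and compose. *)
Definition cderiv (f : C -> C) z d := forall e : R, 0 < e ->
  exists2 r : R, 0 < r & forall w, nc (w - z) < r ->
    nc (f w - f z - d * (w - z)) <= e * nc (w - z).

Lemma dnbhs0P (P : set C^o) :
  (\forall h \near (0 : C^o)^', P h) <->
  (exists2 r : R, 0 < r & forall h : C, nc h < r -> h != 0 -> P h).
Proof.
split.
  move=> /nbhs_ballP[e /= e0 he]; have /andP[/eqP ie re] : (Im e == 0) && (0 < Re e).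
    by move: e0; rewrite ltcE /= eq_sym.
  exists (Re e) => // h hr h0; apply: he => //=.
  by rewrite -ball_normE /= sub0r normrN normE ltcE /= ie eqxx.
move=> [r r0 hr]; apply/nbhs_ballP; exists r%:C => /=; first by rewrite ltcR.
move=> h /=; rewrite -ball_normE /= sub0r normrN normE ltcR => h1 h2.
exact: hr.
Qed.

Lemma cderiv_cvg (f : C -> C) z d : cderiv f z d <->
  ((fun h : C^o => h^-1 *: ((f (h + z) : C^o) - f z)) @ (0 : C^o)^' --> (d : C^o)).
Proof.
rewrite -ccvgE ccvgP; split=> h e e0.
  have e2 : 0 < e / 2 by rewrite divr_gt0.
  have [r r0 hr] := h _ e2; apply/dnbhs0P; exists r => // k kr k0.
  have := hr (k + z); rewrite addrK => /(_ kr) h1.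
  have -> : k^-1 *: (f (k + z) - f z) - d = k^-1 * (f (k + z) - f z - d * k).
    by rewrite mulrBr [d * k]mulrC mulKf.
  rewrite ncM ncV mulrC ltr_pdivrMr ?nc_gt0//.
  by rewrite (le_lt_trans h1)// ltr_pM2r ?nc_gt0//; lra.
have /dnbhs0P [r r0 hr] := h _ e0; exists r => // w wr.
have [->|wz] := eqVneq w z; first by rewrite !subrr mulr0 subr0 nc0 mulr0.
have := hr (w - z) wr; rewrite subr_eq0 => /(_ wz); rewrite subrK => h1.
have -> : f w - f z - d * (w - z) = (w - z) * ((w - z)^-1 *: (f w - f z) - d).
  by rewrite [RHS]mulrBr [(w - z) * d]mulrC mulVKf// subr_eq0.
by rewrite ncM mulrC ler_wpM2r ?nc_ge0// ltW.
Qed.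

Lemma derivable_cderiv (f : C -> C) z :
  derivable (f : C^o -> C^o) z 1 -> cderiv f z (derive1 (f : C^o -> C^o) z).
Proof.
move=> h; apply/cderiv_cvg; rewrite derive1E /derive.
have := h; rewrite /derivable => {}h.
rewrite (_ : (fun _ : C^o => _) = (fun h0 : C^o => h0^-1 *: (((f : C^o -> C^o) \o shift z) (h0 *: (1 : C^o)) - f z))).
  exact: h.
by apply/funext => k /=; rewrite [k%:A]mulr1.
Qed.

Lemma cderiv_derivable (f : C -> C) z d : cderiv f z d ->
  derivable (f : C^o -> C^o) z 1 /\ derive1 (f : C^o -> C^o) z = d.
Proof.
move=> /cderiv_cvg h; split.
  rewrite /derivable; apply/cvg_ex; exists d.
  rewrite (_ : (fun _ : C^o => _) =
    (fun h : C^o => h^-1 *: ((f (h + z) : C^o) - f z))) //.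
  by apply/funext => k /=; rewrite [k%:A]mulr1.
exact: (cvg_lim (@norm_hausdorff _ C^o) h).
Qed.

End Modulus.

Arguments Normc.normc : simpl never.

(** * Power series on the disk *)

Section PowerSeries.
Variable R : realType.
Local Notation C := R[i].
Implicit Types (a b : nat -> C) (f g : C -> C) (z w : C).

Lemma geom_sum_le (y : R) n : 0 <= y < 1 -> \sum_(i < n) y ^+ i <= (1 - y)^-1.
Proof.
move=> /andP[y0 y1]; have h : 0 < 1 - y by lra.
rewrite -[leRHS]mulr1 -ler_pdivrMl ?invr_gt0// invrK.
have := subrX1 y n; have : 0 <= y ^+ n by apply: exprn_ge0.
set s := \sum_(i < n) _; nra.
Qed.

(** Each of the n terms of the geometric sum is at least [y ^+ n]. *)
Lemma natmul_exp_le (y : R) n : 0 <= y < 1 -> n%:R * y ^+ n <= (1 - y)^-1.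
Proof.
move=> y01; apply: le_trans (geom_sum_le n y01); case/andP: y01 => y0 y1.
rewrite mulr_natl -[X in _ *+ X]card_ord -sumr_const; apply: ler_sum => i _.
by apply: ler_wiXn2l => //; [exact: ltW | exact: ltnW].
Qed.

Lemma abs_ccvg (u : nat -> C) (K : R) : (forall n, \sum_(i < n) nc (u i) <= K) ->
  exists l, ccvg \oo (fun n => \sum_(i < n) u i) l.
Proof.
move=> hK.
have aux (v : nat -> R) : (forall n, `|v n| <= nc (u n)) ->
    cvgn (fun n => \sum_(i < n) v i).
  move=> hv; have : cvgn [normed series v].
    apply: nondecreasing_is_cvgn.
      by apply: nondecreasing_series => n _ _ /=; exact: normr_ge0.
    exists K => _ [n _ <-]; rewrite -[X in X <= _]/(series (fun k => `|v k|) n) seriesEnat /= big_mkord.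
    by apply: le_trans (hK n); exact: ler_sum.
  move=> /normed_cvg.
  by rewrite (_ : series v = fun n => \sum_(i < n) v i)//; apply/funext => n;
    rewrite seriesEnat /= big_mkord.
have /cvg_ex[x hx] := aux (fun n => Re (u n)) (fun n => nc_Re (u n)).
have /cvg_ex[y hy] := aux (fun n => Im (u n)) (fun n => nc_Im (u n)).
exists (x +i* y); split => /=.
  by under eq_fun do rewrite Re_sum.
by under eq_fun do rewrite Im_sum.
Qed.

Lemma ccvg_shift (u : nat -> C) l N :
  ccvg \oo (fun n => u (n + N)%N) l <-> ccvg \oo u l.
Proof.
have h (v : nat -> R) (k : R) :
    (v (n + N)%N @[n --> \oo] --> k) = (v n @[n --> \oo] --> k).
  exact: (@cvg_shiftn N R v (nbhs k)).
by rewrite /ccvg (h (fun n => Re (u n))) (h (fun n => Im (u n))).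
Qed.

Definition psum a z n := \sum_(i < n) a i * z ^+ i.
Definition pser a f := forall z, nc z < 1 -> ccvg \oo (psum a z) (f z).

(** Induction on [k]. The terms of a convergent series are bounded; a further factor n is paid for
    by enlarging the radius to y = (1 + r) / 2, since r <= y^2 and n y^n is bounded. *)
Lemma pser_bound a f (k : nat) (r : R) : pser a f -> 0 <= r < 1 ->
  exists2 M : R, 0 <= M & forall n, nc (a n) * n%:R ^+ k * r ^+ n <= M.
Proof.
move=> af; elim: k r => [|k IH] r /andP[r0 r1].
  have rd : nc (r%:C) < 1 by rewrite nc_real ger0_norm.
  have /ccvgP/(_ 1 ltr01) := af _ rd.
  (* From N on the partial sums lie within 1 of the limit, so a term, being a difference of two of
     them, is at most 2; the finite sum covers the earlier terms. *)
  move=> [N _ hN]; exists (2 + \sum_(i < N) nc (a i) * r ^+ i).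
    by rewrite addr_ge0// sumr_ge0// => i _; rewrite mulr_ge0 ?nc_ge0 ?exprn_ge0.
  move=> n; rewrite expr0 mulr1; have [nN|Nn] := ltnP n N.
    rewrite (bigD1 (Ordinal nN))//=.
    rewrite addrCA lerDl addr_ge0// sumr_ge0// => i _.
    by rewrite mulr_ge0 ?nc_ge0 ?exprn_ge0.
  have h1 := hN n Nn; have h2 := hN n.+1 (leqW Nn).
  rewrite /= /psum big_ord_recr /= in h2.
  set A := \sum_(i < n) _ in h2; rewrite /= -/A in h1 *.
  have : nc (a n * r%:C ^+ n) <= 2.
    rewrite (_ : _ * _ = (A + a n * r%:C ^+ n - f r%:C) - (A - f r%:C)); last by ring.
    by rewrite (le_trans (ncB _ _))//; lra.
  rewrite ncM ncX nc_real ger0_norm// => h; apply: le_trans h _.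
  by rewrite lerDl sumr_ge0// => i _; rewrite mulr_ge0 ?nc_ge0 ?exprn_ge0.
have r2 : 0 <= (1 + r) / 2 < 1 by lra.
set y := (1 + r) / 2 in r2 *; have [M M0 hM] := IH y r2.
have y1 : 0 <= (1 - y)^-1 by rewrite invr_ge0; lra.
exists (M * (1 - y)^-1) => [|n]; first by rewrite mulr_ge0.
have h1 := hM n; have h2 := natmul_exp_le n r2.
have h3 : r ^+ n <= y ^+ n * y ^+ n.
  by rewrite -exprMn lerXn2r ?nnegrE//; rewrite /y; nra.
have an := nc_ge0 (a n); have nk : 0 <= n%:R ^+ k :> R by rewrite exprn_ge0.
apply: (@le_trans _ _ (nc (a n) * n%:R ^+ k.+1 * (y ^+ n * y ^+ n))).
  by rewrite ler_wpM2l// mulr_ge0// exprn_ge0.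
have -> : nc (a n) * n%:R ^+ k.+1 * (y ^+ n * y ^+ n) =
  (nc (a n) * n%:R ^+ k * y ^+ n) * (n%:R * y ^+ n) by rewrite exprSr; ring.
by apply: ler_pM => //; rewrite !mulr_ge0// exprn_ge0//; case/andP: r2.
Qed.

(** As r <= y^2, one factor y^n goes into [pser_bound] and the other is left as geometric decay. *)
Lemma pser_geom a f (k : nat) (r : R) : pser a f -> 0 <= r < 1 ->
  exists2 My : R * R, 0 <= My.1 /\ 0 <= My.2 < 1 &
    forall n, nc (a n) * n%:R ^+ k * r ^+ n <= My.1 * My.2 ^+ n.
Proof.
move=> af /andP[r0 r1]; have r2 : 0 <= (1 + r) / 2 < 1 by lra.
set y := (1 + r) / 2 in r2 *; have [M M0 hM] := pser_bound k af r2.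
exists (M, y) => //= n.
have h3 : r ^+ n <= y ^+ n * y ^+ n.
  by rewrite -exprMn lerXn2r ?nnegrE//; rewrite /y; nra.
apply: (@le_trans _ _ (nc (a n) * n%:R ^+ k * (y ^+ n * y ^+ n))).
  by rewrite ler_wpM2l// mulr_ge0 ?nc_ge0 ?exprn_ge0.
by rewrite mulrA ler_wpM2r ?exprn_ge0//; case/andP: r2.
Qed.

Lemma pser_summable a f (k : nat) (r : R) : pser a f -> 0 <= r < 1 ->
  exists2 K : R, 0 <= K & forall n, \sum_(i < n) nc (a i) * i%:R ^+ k * r ^+ i <= K.
Proof.
move=> af r01; have [[M y]/= [M0 y01] h] := pser_geom k af r01.
exists (M * (1 - y)^-1) => [|n].
  by rewrite mulr_ge0// invr_ge0; lra.
apply: le_trans (ler_wpM2l M0 (geom_sum_le n y01)).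
by rewrite mulr_sumr; apply: ler_sum.
Qed.

(** The bound is uniform on the closed disk of radius [r], which lets a function on a circle be
    replaced by a trigonometric polynomial under a mean. *)
Lemma pser_tail a f (r : R) : pser a f -> 0 <= r < 1 ->
  exists2 My : R * R, 0 <= My.1 /\ 0 <= My.2 < 1 &
    forall z N, nc z <= r -> nc (f z - psum a z N) <= My.1 * My.2 ^+ N.
Proof.
move=> af /andP[r0 r1]; have [|[M y]/= [M0 y01] h] := @pser_geom a f 0 r af; first by lra.
have y1 : 0 <= (1 - y)^-1 by rewrite invr_ge0; lra.
exists (M * (1 - y)^-1, y) => /= [|z N zr]; first by rewrite mulr_ge0.
apply: (@ccvg_le_nc _ _ \oo _ (fun n => psum a z (N + n)%N - psum a z N)).
  apply: ccvgB; last exact: ccvg_cst.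
  under eq_fun do rewrite addnC.
  exact/(ccvg_shift (psum a z))/af/le_lt_trans/r1.
move=> n; rewrite /psum big_split_ord /= addrAC subrr add0r.
apply: le_trans (nc_sum _ _ _) _.
apply: (@le_trans _ _ (\sum_(i < n) M * y ^+ N * y ^+ i)).
  apply: ler_sum => i _; rewrite ncM ncX -mulrA -exprD.
  apply: le_trans (h (N + i)%N); rewrite expr0 mulr1 ler_wpM2l ?nc_ge0//.
  by rewrite lerXn2r ?nnegrE ?nc_ge0.
rewrite -mulr_sumr -mulrAC ler_wpM2r ?exprn_ge0//; first by case/andP: y01.
by rewrite ler_wpM2l// geom_sum_le.
Qed.

Lemma pser0 a f : pser a f -> f 0 = a 0%N.
Proof.
move=> af; have : ccvg \oo (psum a 0) (f 0) by apply: af; rewrite nc0.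
suff h : ccvg \oo (psum a 0) (a 0%N) by move=> h'; exact: ccvg_unique h' h.
apply/(ccvg_shift _ _ 1); apply: (ccvg_eq (u := fun=> a 0%N)); last exact: ccvg_cst.
move=> n; rewrite addn1 /psum big_ord_recl /= expr0 mulr1 big1 ?addr0// => i _.
by rewrite expr0n /= mulr0.
Qed.

(** Second order Taylor remainder of the n-th power. The factor r^2 on the left stands for r^(n - 2)
    on the right, which would be a truncated subtraction for n < 2. *)
Lemma expr_remainder z w (r : R) n : nc z <= r -> nc w <= r ->
  nc (w ^+ n - z ^+ n - n%:R * z ^+ n.-1 * (w - z)) * r ^+ 2 <=
  nc (w - z) ^+ 2 * n%:R ^+ 2 * r ^+ n.
Proof.
move=> zr wr; have r0 : 0 <= r by apply: le_trans zr; exact: nc_ge0.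
elim: n => [|n IH].
  by rewrite !expr0 subrr !mul0r subr0 nc0 mul0r mulr1 mulr_ge0 ?sqr_ge0.
set e := w ^+ n - _ - _ in IH.
have -> : w ^+ n.+1 - z ^+ n.+1 - n.+1%:R * z ^+ n.+1.-1 * (w - z) =
    w * e + n%:R * z ^+ n.-1 * (w - z) ^+ 2.
  rewrite /e; case: n {IH e} => [|n] /=; first by rewrite !expr1 !expr0; ring.
  by rewrite !exprS -[n.+2%:R]/((1 + n.+1)%:R) natrD; ring.
apply: (@le_trans _ _ ((nc w * nc e + n%:R * nc z ^+ n.-1 * nc (w - z) ^+ 2) * r ^+ 2)).
  rewrite ler_wpM2r ?sqr_ge0//; apply: le_trans (ncD _ _) _.
  rewrite !ncM !ncX lerD2l !ler_wpM2r ?sqr_ge0 ?exprn_ge0 ?nc_ge0//.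
  by rewrite -(rmorph_nat (real_complex R)) nc_real normr_nat.
have h1 : nc w * nc e * r ^+ 2 <= r * (nc (w - z) ^+ 2 * n%:R ^+ 2 * r ^+ n).
  by rewrite -mulrA; apply: ler_pM => //; rewrite ?mulr_ge0 ?nc_ge0 ?sqr_ge0.
have h2 : n%:R * nc z ^+ n.-1 * r ^+ 2 <= n%:R * r ^+ n.+1.
  case: n {IH e h1} => [|n] /=; first by rewrite !mul0r.
  rewrite -mulrA ler_wpM2l// -[n.+2]addn2 exprD.
  by rewrite ler_wpM2r ?sqr_ge0// lerXn2r ?nnegrE ?nc_ge0.
have h3 := ler_wpM2l (sqr_ge0 (nc (w - z))) h2.
have h4 : 0 <= nc (w - z) ^+ 2 * r ^+ n.+1 * n.+1%:R.
  by apply: mulr_ge0; [apply: mulr_ge0; [exact: sqr_ge0|exact: exprn_ge0]|exact: ler0n].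
rewrite (exprS r n) -[n.+1%:R]/((1 + n)%:R) natrD in h3 h4 *; lra.
Qed.

(** The difference quotient is compared term by term: the remainders of [expr_remainder] sum to at
    most a constant times |w - z|^2, because the series of |a_n| n^2 r^n converges for the r midway
    between |z| and 1. *)
Lemma pser_cderiv a f z : pser a f -> nc z < 1 -> exists2 d : C,
  cderiv f z d & ccvg \oo (psum (fun n => n.+1%:R * a n.+1) z) d.
Proof.
move=> af z1; set s := (1 - nc z) / 2; set r := nc z + s.
have z0 := nc_ge0 z; have s0 : 0 < s by rewrite /s; lra.
have r01 : 0 <= r < 1 by rewrite /r /s; lra.
have r0 : 0 < r by rewrite /r; lra.
have [K1 K10 hK1] := pser_summable 1 af r01.
have [d hd] : exists d, ccvg \oo (psum (fun n => n.+1%:R * a n.+1) z) d.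
  apply: (@abs_ccvg (fun i => i.+1%:R * a i.+1 * z ^+ i) (K1 / r)) => n; rewrite ler_pdivlMr// mulr_suml.
  apply: le_trans (hK1 n.+1); rewrite big_ord_recl /= expr1 mulr0 mul0r add0r.
  apply: ler_sum => i _; rewrite !ncM ncX /bump /= add1n.
  rewrite -(rmorph_nat (real_complex R)) nc_real normr_nat.
  rewrite expr1 [X in _ <= _ * X]exprSr mulrA ler_wpM2r ?(ltW r0)//.
  rewrite [nc (a _) * _]mulrC ler_wpM2l ?mulr_ge0 ?nc_ge0//.
  by rewrite lerXn2r ?nnegrE ?nc_ge0//; rewrite /r /s; lra.
exists d => // e e0; have [K K0 hK] := pser_summable 2 af r01.
have r2 : 0 < r ^+ 2 by rewrite exprn_gt0.
set q := K / r ^+ 2 + 1; have q0 : 0 < q by rewrite /q ltr_wpDl// divr_ge0// ltW.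
exists (Num.min s (e / q)) => [|w]; first by rewrite lt_min s0 divr_gt0.
rewrite lt_min (ltr_pdivlMr _ _ q0) => /andP[ws we].
have wr : nc w <= r.
  by have := ncD (w - z) z; rewrite subrK /r; lra.
have zr : nc z <= r by rewrite /r; lra.
suff H : nc (f w - f z - d * (w - z)) <= K / r ^+ 2 * nc (w - z) ^+ 2.
  apply: le_trans H _; rewrite expr2 mulrA ler_wpM2r ?nc_ge0//.
  have := nc_ge0 (w - z); rewrite /q in we; nra.
(* Differentiation lowers the degree by one, so [n.+1] terms of f match [n] terms of the derived
   series. *)
apply: (@ccvg_le_nc _ _ \oo _ (fun n => psum a w n.+1 - psum a z n.+1 -
   psum (fun n => n.+1%:R * a n.+1) z n * (w - z))).
  have sh v : nc v < 1 -> ccvg \oo (fun n => psum a v n.+1) (f v).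
    by move=> /af /(ccvg_shift (psum a v) _ 1); under eq_fun do rewrite addn1.
  apply: ccvgB; first by apply: ccvgB; apply: sh => //; apply: le_lt_trans wr _; lra.
  by apply: ccvgM => //; exact: ccvg_cst.
move=> n; rewrite mulrAC ler_pdivlMr//.
have -> : psum a w n.+1 - psum a z n.+1 -
   psum (fun n => n.+1%:R * a n.+1) z n * (w - z) =
   \sum_(i < n.+1) a i * (w ^+ i - z ^+ i - i%:R * z ^+ i.-1 * (w - z)).
  under [RHS]eq_bigr do rewrite mulrBr mulrBr.
  rewrite !sumrB; congr (_ - _).
  rewrite big_ord_recl /= !mul0r mulr0 add0r mulr_suml; apply: eq_bigr => i _.
  by rewrite /bump /= add1n; ring.
apply: (@le_trans _ _ (\sum_(i < n.+1) nc (a i) * (nc (w - z) ^+ 2 * i%:R ^+ 2 * r ^+ i))).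
  apply: (@le_trans _ _ ((\sum_(i < n.+1) nc (a i *
     (w ^+ i - z ^+ i - i%:R * z ^+ i.-1 * (w - z)))) * r ^+ 2)).
    by rewrite ler_wpM2r ?(ltW r2)// nc_sum.
  rewrite mulr_suml; apply: ler_sum => i _; rewrite ncM.
  by apply: le_trans (ler_wpM2l (nc_ge0 (a i)) (expr_remainder i zr wr));
    rewrite le_eqVlt; apply/orP; left; apply/eqP; ring.
apply: le_trans (ler_wpM2r (sqr_ge0 (nc (w - z))) (hK n.+1)).
by rewrite mulr_suml; apply: ler_sum => i _; rewrite le_eqVlt; apply/orP; left; apply/eqP; ring.
Qed.

Lemma pser_holomorphic a f : pser a f -> holomorphic f.
Proof.
by move=> af z /diskE z1; have [d /cderiv_derivable[]] := pser_cderiv af z1.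
Qed.

Lemma pser_derive1 a f : pser a f ->
  pser (fun n => n.+1%:R * a n.+1) (derive1 (f : C^o -> C^o)).
Proof.
move=> af z z1; have [d /cderiv_derivable[_ h]] := pser_cderiv af z1.
by rewrite -h.
Qed.

Lemma pser_derive1n a f n : pser a f ->
  pser (fun k => ((k + n) ^_ n)%:R * a (k + n)%N) (derive1n n (f : C^o -> C^o)).
Proof.
move=> af; elim: n => [|n IH].
  move=> z z1; have := af _ z1; apply: ccvg_eq => m; apply: eq_bigr => i _.
  by rewrite addn0 ffactn0 mul1r.
have := pser_derive1 IH; rewrite -derive1nS => h z z1; have := h z z1.
apply: ccvg_eq => m /=; apply: eq_bigr => i _; congr (_ * _).
rewrite addSnnS mulrA -natrM; congr (_%:R * _).
by rewrite ffactnSr addnS subSn ?leq_addl// addnK mulnC.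
Qed.

(** Most Taylor coefficients below are found by exhibiting a power series rather than by
    differentiating n times. *)
Lemma pser_taylor a f : pser a f -> taylor f = a.
Proof.
move=> af; apply/funext => n; rewrite /taylor.
have /pser0 -> := pser_derive1n n af; rewrite add0n ffactnn mulrAC divff ?mul1r//.
Qed.

Lemma pser_ext a f g : (forall z, disk z -> f z = g z) -> pser a f -> pser a g.
Proof. by move=> fg af z z1; rewrite -fg ?diskE//; exact: af. Qed.

Lemma pser_eq a b f g : a =1 b -> f =1 g -> pser a f -> pser b g.
Proof. by move=> /funext -> /funext ->. Qed.

Lemma pserD a b f g : pser a f -> pser b g ->
  pser (fun n => a n + b n) (fun z => f z + g z).
Proof.
move=> af bg z z1 /=; have := @ccvgD _ _ \oo eventually_filter _ _ _ _ (af z z1) (bg z z1).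
by apply: (ccvg_eq (R := R)) => n; rewrite /psum -big_split; apply: eq_bigr => i _; rewrite mulrDl.
Qed.

Lemma pserZ a f c : pser a f -> pser (fun n => c * a n) (fun z => c * f z).
Proof.
move=> af z z1 /=; have := @ccvgM _ _ \oo eventually_filter _ _ _ _ (@ccvg_cst _ _ \oo eventually_filter c) (af z z1).
by apply: (ccvg_eq (R := R)) => n; rewrite /psum mulr_sumr; apply: eq_bigr => i _; rewrite mulrA.
Qed.

Lemma pser_sum I (r : seq I) (a : I -> nat -> C) (f : I -> C -> C) :
  (forall i, pser (a i) (f i)) ->
  pser (fun n => \sum_(i <- r) a i n) (fun z => \sum_(i <- r) f i z).
Proof.
move=> af; elim: r => [|i r IH].
  move=> z _; rewrite big_nil; apply: (ccvg_eq (u := fun=> 0)); last exact: ccvg_cst.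
  by move=> n; rewrite /psum big1// => i _; rewrite big_nil mul0r.
by apply: pser_eq (pserD (af i) IH) => x; rewrite big_cons.
Qed.

Lemma pserXn k : pser (fun n => (n == k)%:R) (fun z => z ^+ k).
Proof.
move=> z _; apply/(ccvg_shift _ _ k.+1).
have E n : psum (fun n => (n == k)%:R) z (n + k.+1)%N = z ^+ k.
  have kn : (k < n + k.+1)%N by rewrite ltn_addl.
  rewrite /psum (bigD1 (Ordinal kn))//= eqxx mul1r big1 ?addr0// => i.
  by rewrite -val_eqE /= => /negbTE ->; rewrite mul0r.
by under eq_fun do rewrite E; exact: ccvg_cst.
Qed.

Lemma pser_szego w : nc w < 1 -> pser (fun n => (w^*) ^+ n) (fun z => (1 - w^* * z)^-1).
Proof.
move=> w1 z z1; have h : nc (w^* * z) < 1.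
  by rewrite ncM nc_conj; have := nc_ge0 w; have := nc_ge0 z; nra.
set x := w^* * z in h *; have x1 : 1 - x != 0.
  by apply/eqP => /eqP; rewrite subr_eq0 => /eqP x1; rewrite -x1 nc1 ltxx in h.
have [_ h0] : True /\ ccvg \oo (fun n => x ^+ n) 0.
  split=> //; apply/ccvgP => e e0.
  have := @cvg_expr R (nc x); rewrite ger0_norm ?nc_ge0// => /(_ h).
  move=> /cvgrPdist_lt/(_ _ e0); apply: filterS => n.
  by rewrite sub0r normrN subr0 ncX ger0_norm// exprn_ge0 ?nc_ge0.
have := @ccvgM _ _ \oo eventually_filter _ _ _ _ (@ccvgB _ _ \oo eventually_filter _ _ _ _ (@ccvg_cst _ _ \oo eventually_filter 1) h0) (@ccvg_cst _ _ \oo eventually_filter (1 - x)^-1).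
rewrite subr0 mul1r; apply: (ccvg_eq (R := R)) => n /=.
apply: (canLR (mulfK x1)); rewrite /psum -opprB subrX1 -mulNr opprB mulrC.
by congr (_ * _); apply: eq_bigr => i _; rewrite exprMn.
Qed.

End PowerSeries.

(** * Integrals of continuous complex functions *)

Section Integral.
Variable R : realType.
Local Notation C := R[i].

(** The mean value theorem for [Q - P]. This gives the estimates of integrals with antiderivatives
    alone. *)
Lemma prim_le (P Q p q : R -> R) (a b : R) : a <= b ->
  (forall x, a <= x <= b -> is_derive x 1 P (p x)) ->
  (forall x, a <= x <= b -> is_derive x 1 Q (q x)) ->
  (forall x, a <= x <= b -> p x <= q x) -> P b - P a <= Q b - Q a.
Proof.
move=> ab dP dQ pq.
have dQP x : a <= x <= b -> is_derive x 1 (Q - P) (q x - p x).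
  by move=> xab; have := dP x xab; have := dQ x xab => ? ?; exact: is_deriveB.
have [||c] := @MVT_segment R (Q - P) (fun x => q x - p x) a b ab.
- move=> x; rewrite in_itv /= => /andP[ax xb]; apply: dQP.
  by rewrite (ltW ax) (ltW xb).
- apply: derivable_within_continuous => x; rewrite in_itv /= => xab.
  by have [] := dQP x xab.
rewrite in_itv /= => cab e.
have : 0 <= (q c - p c) * (b - a).
  by apply: mulr_ge0; rewrite subr_ge0//; exact: pq.
rewrite -e /GRing.sub_fun /= -[(Q - P) b]/(Q b - P b) -[(Q - P) a]/(Q a - P a); lra.
Qed.

Lemma prim_eq (P Q p : R -> R) (a b : R) :
  (forall x, Num.min a b <= x <= Num.max a b -> is_derive x 1 P (p x)) ->
  (forall x, Num.min a b <= x <= Num.max a b -> is_derive x 1 Q (p x)) ->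
  P b - P a = Q b - Q a.
Proof.
wlog ab : a b / a <= b.
  move=> H; have [ab|ba] := orP (le_total a b); first exact: H.
  rewrite minC maxC => h1 h2; have := H b a ba h1 h2; lra.
rewrite min_l// max_r// => h1 h2; apply/eqP; rewrite eq_le.
by rewrite (prim_le ab h1 h2)// (prim_le ab h2 h1).
Qed.

(** The fundamental theorem yields an antiderivative only to the right of a base point -n.
    Normalized to vanish at 0, those for different n agree where both are defined ([prim_eq]), so P
    may choose n depending on x. *)
Lemma prim_ex (p : R -> R) : continuous p -> exists P : R -> R, forall x : R, is_derive x 1 P (p x).
Proof.
move=> cp; pose I (n : nat) (x : R) := (\int[lebesgue_measure]_(t in `[(- n%:R : R), x]) p t)%R.
have dI (n : nat) (x : R) : - n%:R < x -> is_derive x 1 (I n) (p x).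
  move=> nx; have [||d e] := @continuous_FTC1_closed R p (- n%:R) x (x + 1) _ _ nx (cp x).
  - by rewrite ltrDl.
  - apply: continuous_compact_integrable; first exact: segment_compact.
    by apply: continuous_subspaceT => y; exact: cp.
  - by rewrite -e derive1E; apply/derivableP.
pose N (x : R) := Num.bound `|x|.
have hN (x : R) : `|x| < (N x)%:R by apply: archi_boundP; exact: normr_ge0.
pose P x := I (N x) x - I (N x) 0.
have eP (n : nat) (x : R) : `|x| < n%:R -> P x = I n x - I n 0.
  have nb (m : nat) (y : R) : `|x| < m%:R -> Num.min 0 x <= y -> - m%:R < y.
    move=> xm; have := ler_norm (- x); rewrite normrN => h.
    have [x0|x0] := leP 0 x; first by have := ler_norm x; lra.
    lra.
  by move=> xn; apply: (@prim_eq _ _ p) => y /andP[h _]; apply: dI; apply: nb h.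
exists P => x.
have [n xn] : exists n : nat, `|x| + 1 < n%:R.
  by exists (Num.bound (`|x| + 1)); apply: archi_boundP; exact: addr_ge0.
apply: (@near_eq_is_derive _ _ _ (fun y => I n y - I n 0)).
- near=> y.
  apply/esym/eP; suff : `|x - y| < 1.
    have := ler_normD x (y - x); rewrite addrC subrK distrC; lra.
  near: y; apply: (@cvgr_dist_lt _ _ _ _ _ id x) => //; exact: cvg_id.
- have nx : - n%:R < x by have := ler_norm (- x); rewrite normrN; lra.
  have := dI n x nx => ?.
  have -> : p x = p x - 0 by rewrite subr0.
  exact: is_deriveB.
Unshelve. all: end_near. Qed.
End Integral.

Section ComplexIntegral.
Variable R : realType.
Local Notation C := R[i].
Implicit Types (p q : R -> R) (G H : R -> C) (a b : R).

(* Integrals are differences of antiderivatives, so that they need no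
   integrability side condition and are defined for [b < a]. *)
Definition primitive p : R -> R := xget (fun=> 0) [set P | forall x : R, is_derive x 1 P (p x)].
Definition intg p a b := primitive p b - primitive p a.

Lemma primitiveP p : continuous p -> forall x : R, is_derive x 1 (primitive p) (p x).
Proof.
move=> /prim_ex[P hP]; rewrite /primitive.
by case: xgetP => [y _ //|/(_ P)]; move/(_ hP).
Qed.

Lemma intg_FTC p (P : R -> R) a b : (forall x : R, is_derive x 1 P (p x)) ->
  intg p a b = P b - P a.
Proof.
move=> hP; rewrite /intg /primitive; case: xgetP => [y _ hy|/(_ P)]; last by move/(_ hP).
exact: (@prim_eq _ _ _ p).
Qed.

Lemma intgD p q a b : continuous p -> continuous q ->
  intg (fun x => p x + q x) a b = intg p a b + intg q a b.
Proof.
move=> /primitiveP hp /primitiveP hq.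
rewrite (@intg_FTC _ (fun x => primitive p x + primitive q x)).
  by rewrite /intg; ring.
Qed.

Lemma intgZ p (k : R) a b : continuous p ->
  intg (fun x => k * p x) a b = k * intg p a b.
Proof.
move=> /primitiveP hp.
rewrite (@intg_FTC _ (fun x => k * primitive p x)).
  by rewrite -mulrBr.
Qed.

Lemma intg_le p q a b : a <= b -> continuous p -> continuous q ->
  (forall x, a <= x <= b -> p x <= q x) -> intg p a b <= intg q a b.
Proof.
by move=> ab /primitiveP hp /primitiveP hq; apply: prim_le => // x _.
Qed.

Lemma intg_cst (k : R) a b : intg (fun=> k) a b = k * (b - a).
Proof.
have h (x : R) : is_derive x 1 (fun x : R => k * x) k.
  by rewrite -[X in is_derive _ _ _ X](mulr1 k); exact: (@is_deriveZ _ _ _ id k).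
by rewrite (intg_FTC _ _ h) mulrBr.
Qed.

Definition ccont G := forall t, ccvg (nbhs t) G (G t).

Lemma ccontP G : ccont G <->
  (forall t (e : R), 0 < e -> exists2 d : R, 0 < d & forall u, `|u - t| < d -> nc (G u - G t) < e).
Proof.
split=> h t; last first.
  apply/ccvgP => e e0; have [d d0 hd] := h t e e0.
  by apply/nbhs_ballP; exists d => // u; rewrite -ball_normE /= distrC; exact: hd.
move=> e e0; have /ccvgP/(_ e e0)/nbhs_ballP[d /= d0 hd] := h t.
by exists d => // u ut; apply: hd; rewrite -ball_normE /= distrC.
Qed.

Lemma ccont_Re G : ccont G -> continuous (fun t => Re (G t)).
Proof. by move=> h t; have [] := h t. Qed.
Lemma ccont_Im G : ccont G -> continuous (fun t => Im (G t)).
Proof. by move=> h t; have [] := h t. Qed.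
Lemma ccont_cst (c : C) : ccont (fun=> c).
Proof. by move=> t; exact: ccvg_cst. Qed.
Lemma ccontD G H : ccont G -> ccont H -> ccont (fun t => G t + H t).
Proof. by move=> g h t; exact: ccvgD. Qed.
Lemma ccontB G H : ccont G -> ccont H -> ccont (fun t => G t - H t).
Proof. by move=> g h t; exact: ccvgB. Qed.
Lemma ccontM G H : ccont G -> ccont H -> ccont (fun t => G t * H t).
Proof. by move=> g h t; exact: ccvgM. Qed.
Lemma ccontJ G : ccont G -> ccont (fun t => (G t)^*).
Proof. by move=> g t; exact: ccvgJ. Qed.
Lemma ccontX G n : ccont G -> ccont (fun t => G t ^+ n).
Proof. by move=> g t; exact: ccvgX. Qed.
Lemma ccont_sum I (r : seq I) (P : pred I) (G : I -> R -> C) :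
  (forall i, P i -> ccont (G i)) -> ccont (fun t => \sum_(i <- r | P i) G i t).
Proof. by move=> h t; apply: ccvg_sum => i Pi; exact: h. Qed.
Lemma ccont_real p : continuous p -> ccont (fun t => (p t)%:C).
Proof. by move=> h t; split => /=; [exact: h|exact: cvg_cst]. Qed.

Definition cintg G a b : C := intg (fun t => Re (G t)) a b +i* intg (fun t => Im (G t)) a b.

Lemma cintgD G H a b : ccont G -> ccont H ->
  cintg (fun t => G t + H t) a b = cintg G a b + cintg H a b.
Proof.
move=> cG cH; rewrite /cintg.
under eq_fun do rewrite ReD; under [in X in _ +i* intg X _ _]eq_fun do rewrite ImD.
by rewrite !intgD//; (exact: ccont_Re || exact: ccont_Im).
Qed.

Lemma cintgM G (c : C) a b : ccont G ->
  cintg (fun t => c * G t) a b = c * cintg G a b.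
Proof.
move=> cG; rewrite /cintg; have cr := ccont_Re cG; have ci := ccont_Im cG.
have scal (k : R) p : continuous p -> continuous (fun t => k * p t).
  by move=> cp t; apply: cvgM; [exact: cvg_cst|exact: cp].
apply: eqC; rewrite ?ReM ?ImM /=.
  under eq_fun do rewrite ReM -mulNr.
  by rewrite intgD ?intgZ ?mulNr//; exact: scal.
under eq_fun do rewrite ImM.
by rewrite intgD ?intgZ//; exact: scal.
Qed.

Lemma cintgN G a b : ccont G -> cintg (fun t => - G t) a b = - cintg G a b.
Proof.
by move=> cG; rewrite -mulN1r -cintgM//; under [in RHS]eq_fun do rewrite mulN1r.
Qed.

Lemma cintgB G H a b : ccont G -> ccont H ->
  cintg (fun t => G t - H t) a b = cintg G a b - cintg H a b.
Proof.
move=> cG cH; rewrite -cintgN// -cintgD// => t; exact: ccvgN.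
Qed.

Lemma cintg_sum I (r : seq I) (G : I -> R -> C) a b :
  (forall i, ccont (G i)) ->
  cintg (fun t => \sum_(i <- r) G i t) a b = \sum_(i <- r) cintg (G i) a b.
Proof.
move=> h; elim: r => [|i r IH].
  under eq_fun do rewrite big_nil; rewrite big_nil /cintg /= !intg_cst.
  by rewrite !mul0r.
under eq_fun do rewrite big_cons; rewrite big_cons cintgD ?IH//.
exact: ccont_sum.
Qed.

Lemma cintg_cst (c : C) a b : cintg (fun=> c) a b = c * (b - a)%:C.
Proof.
rewrite /cintg !intg_cst; apply: eqC; rewrite ?ReM ?ImM /=; ring.
Qed.

(** Multiplying by the unimodular [k] turns the integral into its modulus, and then only real parts
    have to be compared. *)
Lemma cintg_le_intg G p a b : a <= b -> ccont G -> continuous p ->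
  (forall t, a <= t <= b -> nc (G t) <= p t) -> nc (cintg G a b) <= intg p a b.
Proof.
move=> ab cG cp hp; set w := cintg G a b.
have [w0|w0] := eqVneq w 0.
  have -> : nc w = intg (fun=> 0) a b by rewrite w0 nc0 intg_cst mul0r.
  apply: intg_le => // [t|t tab]; first exact: cvg_cst.
  exact: le_trans (nc_ge0 _) (hp t tab).
pose k := w^* / (nc w)%:C.
have nk : nc k = 1.
  by rewrite /k ncM ncV nc_conj nc_real ger0_norm ?nc_ge0// divff// nc_eq0.
have -> : nc w = Re (k * w).
  have n0 : (nc w)%:C != 0 by rewrite -[0]/(0%:C) (inj_eq (@complexI R)) nc_eq0.
  by rewrite /k mulrAC [w^* * w]mulrC mulcJ rmorphXn expr2 mulfK.
rewrite /w -cintgM// /cintg /=; apply: intg_le => //.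
- by apply: ccont_Re; apply: ccontM => //; exact: ccont_cst.
- by move=> t tab; rewrite (le_trans (Re_le_nc _))// ncM nk mul1r hp.
Qed.

Lemma cintg_le G a b (K : R) : a <= b -> ccont G ->
  (forall t, a <= t <= b -> nc (G t) <= K) -> nc (cintg G a b) <= K * (b - a).
Proof.
move=> ab cG hK; rewrite -intg_cst; apply: cintg_le_intg => // t; exact: cvg_cst.
Qed.

Lemma is_derive_approx p (x d e : R) : is_derive x 1 p d -> 0 < e ->
  exists2 r : R, 0 < r & forall y, `|y - x| < r -> `|p y - p x - d * (y - x)| <= e * `|y - x|.
Proof.
move=> [dp <-] e0.
have := dp; rewrite /derivable => /cvgrPdist_lt/(_ e e0)/nbhs_ballP[r /= r0 hr].
exists r => // y yr; have [->|yx] := eqVneq y x.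
  by rewrite !subrr mulr0 subr0 normr0 mulr0.
have yx0 : y - x != 0 by rewrite subr_eq0.
have := hr (y - x); rewrite -ball_normE /= sub0r normrN => /(_ yr yx0).
rewrite [_%:A]mulr1 subrK -[X in `|X - _|]/('D_1 p x) => h.
have -> : p y - p x - 'D_1 p x * (y - x) = - ('D_1 p x - (y - x)^-1 * (p y - p x)) * (y - x).
  by rewrite opprB mulrBl mulrAC mulVf// mul1r.
by rewrite normrM normrN ler_wpM2r// ltW.
Qed.

End ComplexIntegral.

(** * Goursat's theorem and Taylor expansion *)

Section Goursat.
Variable R : realType.
Local Notation C := R[i].
Implicit Types (G H : R -> R -> C) (g : R -> C).
Local Notation I := ('i%C : C).

Lemma cintg_split g (a b c : R) : cintg g a b + cintg g b c = cintg g a c.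
Proof. by apply: eqC; rewrite /cintg /intg /=; ring. Qed.

Lemma ccont_id : ccont (fun x : R => x%:C).
Proof. by apply: ccont_real => x. Qed.

Lemma ccont_affine (A B : C) : ccont (fun x : R => A + B * x%:C).
Proof.
apply: ccontD; first exact: ccont_cst.
by apply: ccontM; [exact: ccont_cst|exact: ccont_id].
Qed.

Lemma cintg_affine (A B : C) (s s' : R) :
  cintg (fun x => A + B * x%:C) s s' =
  A * (s' - s)%:C + B * ((s' ^+ 2 - s ^+ 2) / 2)%:C.
Proof.
have hid : cintg (fun x : R => x%:C) s s' = ((s' ^+ 2 - s ^+ 2) / 2)%:C.
  rewrite /cintg /= intg_cst mul0r; apply: eqC => //=.
  have dx (x : R) : is_derive x 1 (fun y : R => 2^-1 * y ^+ 2) x.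
    have h : is_derive x 1 (fun y : R => y ^+ 2) (2 * x).
      have := @is_deriveM _ _ id id x 1 1 1 (is_derive_id _ _) (is_derive_id _ _).
      rewrite (_ : id * id = (fun y : R => y ^+ 2)).
        by move=> /is_derive_eq; apply; rewrite [_ *: _]mulr1 mulr_natl.
      by apply/funext => y; rewrite expr2.
    rewrite -[X in is_derive _ _ _ X](mulKf (x := 2 : R)) ?pnatr_eq0//.
    exact: (@is_deriveZ _ _ _ (fun y : R => y ^+ 2) 2^-1).
  by rewrite (intg_FTC _ _ dx); field.
rewrite cintgD ?cintgM ?cintg_cst ?hid//; first exact: ccont_id.
- exact: ccont_cst.
- by apply: ccontM; [exact: ccont_cst|exact: ccont_id].
Qed.

(** Continuity in each variable separately is what integrals along the sides of rectangles
    require. *)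
Definition sep_ccont G := (forall t, ccont (G^~ t)) /\ (forall s, ccont (G s)).

(** The integral of G(x + iy) d(x + iy) along the boundary, counterclockwise; the vertical sides
    carry the factor i of d(iy). *)
Definition rect G (s s' t t' : R) : C :=
  cintg (G^~ t) s s' + I * cintg (G s') t t' - cintg (G^~ t') s s' - I * cintg (G s) t t'.

Lemma rect_quarter G (s0 s1 s2 t0 t1 t2 : R) :
  rect G s0 s2 t0 t2 = rect G s0 s1 t0 t1 + rect G s1 s2 t0 t1 +
                       rect G s0 s1 t1 t2 + rect G s1 s2 t1 t2.
Proof.
rewrite /rect -(cintg_split (G^~ t0) s0 s1) -(cintg_split (G^~ t2) s0 s1).
rewrite -(cintg_split (G s0) t0 t1) -(cintg_split (G s2) t0 t1); ring.
Qed.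

(** An affine function of x + iy has boundary integral 0, so it can be subtracted at no cost; the
    four sides are then estimated separately. *)
Lemma rect_bound G (al be : C) (s s' t t' e : R) : sep_ccont G -> s <= s' -> t <= t' ->
  (forall x y, s <= x <= s' -> t <= y <= t' ->
     nc (G x y - (al + be * (x%:C + I * y%:C))) <= e) ->
  nc (rect G s s' t t') <= 2 * e * ((s' - s) + (t' - t)).
Proof.
move=> [cs ct] ss tt he.
have iD (x y : R) : al + be * (x%:C + I * y%:C) = (al + be * (I * y%:C)) + be * x%:C by ring.
have iE (x y : R) : al + be * (x%:C + I * y%:C) = (al + be * x%:C) + (be * I) * y%:C by ring.
pose A (x y : R) := al + be * (x%:C + I * y%:C).
have ch y : ccont (A^~ y) by rewrite /A; under eq_fun do rewrite iD; exact: ccont_affine.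
have cv x : ccont (A x) by rewrite /A; under eq_fun do rewrite iE; exact: ccont_affine.
have hA y : cintg (A^~ y) s s' =
    (al + be * (I * y%:C)) * (s' - s)%:C + be * ((s' ^+ 2 - s ^+ 2) / 2)%:C.
  by rewrite /A; under eq_fun do rewrite iD; rewrite cintg_affine.
have vA x : cintg (A x) t t' =
    (al + be * x%:C) * (t' - t)%:C + (be * I) * ((t' ^+ 2 - t ^+ 2) / 2)%:C.
  by rewrite /A; under eq_fun do rewrite iE; rewrite cintg_affine.
have A0 : rect A s s' t t' = 0.
  have II : I * I = -1 by rewrite -expr2 sqr_i.
  rewrite /rect !hA !vA.
  have -> : (s' - s)%:C = s'%:C - s%:C by rewrite rmorphB.
  have -> : (t' - t)%:C = t'%:C - t%:C by rewrite rmorphB.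
  rewrite !rmorphM /= !rmorphB !rmorphXn /=; set h := (2^-1)%:C.
  ring.
have -> : rect G s s' t t' =
   cintg (fun x => G x t - A x t) s s' + I * cintg (fun y => G s' y - A s' y) t t'
   - cintg (fun x => G x t' - A x t') s s' - I * cintg (fun y => G s y - A s y) t t'.
  rewrite -[LHS]subr0 -A0 /rect !cintgB//; ring.
have nI (z : C) : nc (I * z) = nc z.
  by rewrite ncM nc_i mul1r.
have h1 y : t <= y <= t' -> nc (cintg (fun x => G x y - A x y) s s') <= e * (s' - s).
  move=> ty; apply: cintg_le => //; first exact: ccontB.
  by move=> x sx; exact: he.
have h2 x : s <= x <= s' -> nc (cintg (fun y => G x y - A x y) t t') <= e * (t' - t).
  move=> sx; apply: cintg_le => //; first exact: ccontB.
  by move=> y ty; exact: he.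
have := h1 t; have := h1 t'; have := h2 s; have := h2 s'.
rewrite !lexx ss tt => /(_ isT) e1 /(_ isT) e2 /(_ isT) e3 /(_ isT) e4.
apply: le_trans (ncB _ _) _; apply: le_trans (lerD (ncB _ _) (lexx _)) _.
apply: le_trans (lerD (lerD (ncD _ _) (lexx _)) (lexx _)) _.
rewrite !nI; lra.
Qed.

(** Differentiability relative to the closed rectangle: the function used later is truncated at its
    right side and is differentiable there from one side only. *)
Definition cdiff_on G (a b c d : R) := forall s t : R, a <= s <= b -> c <= t <= d ->
  exists D : C, forall e : R, 0 < e -> exists2 r : R, 0 < r &
  forall s' t' : R, a <= s' <= b -> c <= t' <= d -> `|s' - s| + `|t' - t| < r ->
    nc (G s' t' - G s t - D * ((s' - s)%:C + I * (t' - t)%:C)) <=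
      e * (`|s' - s| + `|t' - t|).

Section Bisection.
Variables (G : R -> R -> C) (a b c d : R).
Hypotheses (ab : a <= b) (cd : c <= d) (cG : sep_ccont G) (dG : cdiff_on G a b c d).

Let h n := (b - a) / 2 ^+ n.
Let k n := (d - c) / 2 ^+ n.
Let Psi n (p : R * R) := rect G p.1 (p.1 + h n) p.2 (p.2 + k n).

Let hS n : h n = h n.+1 + h n.+1.
Proof. by rewrite /h exprS; field; rewrite expf_neq0. Qed.
Let kS n : k n = k n.+1 + k n.+1.
Proof. by rewrite /k exprS; field; rewrite expf_neq0. Qed.
Let h_ge0 n : 0 <= h n.
Proof. by rewrite divr_ge0 ?subr_ge0 ?exprn_ge0. Qed.
Let k_ge0 n : 0 <= k n.
Proof. by rewrite divr_ge0 ?subr_ge0 ?exprn_ge0. Qed.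

Let step n (p : R * R) : exists q : R * R,
  [/\ p.1 <= q.1 <= p.1 + h n.+1, p.2 <= q.2 <= p.2 + k n.+1 &
      nc (Psi n p) <= 4 * nc (Psi n.+1 q)].
Proof.
(* If each of the four quarters had less than a quarter of the modulus, [rect_quarter] and the
   triangle inequality would be contradictory. *)
apply: contrapT => /forallNP hn.
have H i j : nc (Psi n p) > 4 * nc (Psi n.+1 (p.1 + (i : bool)%:R * h n.+1, p.2 + (j : bool)%:R * k n.+1)).
  rewrite ltNge; apply/negP => hle; apply: (hn (p.1 + i%:R * h n.+1, p.2 + j%:R * k n.+1)).
  have := h_ge0 n.+1; have := k_ge0 n.+1.
  by split => //=; [case: i {hle}|case: j {hle}]; rewrite ?mul1r ?mul0r ?addr0; lra.
have := H true true; have := H true false; have := H false true; have := H false false.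
rewrite /Psi /= !mul0r !mul1r !addr0 -!addrA -hS -kS => e1 e2 e3 e4.
move: e1 e2 e3 e4.
rewrite (rect_quarter G p.1 (p.1 + h n.+1) (p.1 + h n) p.2 (p.2 + k n.+1) (p.2 + k n)).
set x1 := rect _ _ _ _ _; set x2 := rect _ _ _ _ _; set x3 := rect _ _ _ _ _; set x4 := rect _ _ _ _ _.
have := ncD (x1 + x2 + x3) x4; have := ncD (x1 + x2) x3; have := ncD x1 x2; lra.
Qed.

Lemma goursat : rect G a b c d = 0.
Proof.
pose nx n p := sval (cid (step n p)).
pose fix q n : R * R := if n is m.+1 then nx m (q m) else (a, c).
have q_step n : [/\ (q n).1 <= (q n.+1).1 <= (q n).1 + h n.+1,
    (q n).2 <= (q n.+1).2 <= (q n).2 + k n.+1 &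
    nc (Psi n (q n)) <= 4 * nc (Psi n.+1 (q n.+1))].
  exact: (svalP (cid (step n (q n)))).
have hb : rect G a b c d = Psi 0%N (q 0%N).
  by rewrite /Psi /= /h /k !expr0 !divr1 !subrKC.
have q1 n m : (q n).1 <= (q (n + m)%N).1 <= (q n).1 + h n - h (n + m)%N.
  elim: m => [|m /andP[IH1 IH2]]; first by rewrite addn0; lra.
  have [/andP[e1 e2] _ _] := q_step (n + m)%N; have := hS (n + m); rewrite addnS; lra.
have q2 n m : (q n).2 <= (q (n + m)%N).2 <= (q n).2 + k n - k (n + m)%N.
  elim: m => [|m /andP[IH1 IH2]]; first by rewrite addn0; lra.
  have [_ /andP[e1 e2] _] := q_step (n + m)%N; have := kS (n + m); rewrite addnS; lra.
have lim_ex (u l : nat -> R) : (forall n, 0 <= l n) ->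
    (forall n m, u n <= u (n + m)%N <= u n + l n - l (n + m)%N) ->
    exists x, forall n, u n <= x <= u n + l n.
  move=> l0 ul; exists (sup (range u)) => n.
  have ub m : ubound (range u) (u m + l m).
    move=> _ [i _ <-]; have [mi|im] := leqP m i.
      have /andP[_] := ul m (i - m)%N; rewrite subnKC//; have := l0 i; lra.
    have /andP[h1 _] := ul i (m - i)%N; rewrite subnKC ?(ltnW im)// in h1.
    by have := l0 m; lra.
  apply/andP; split.
    by apply: ub_le_sup; [exists (u 0%N + l 0%N); exact: ub|exists n].
  by apply: ge_sup; [exists (u 0%N), 0%N|exact: ub].
have [x hx] := lim_ex (fun n => (q n).1) h h_ge0 q1.
have [y hy] := lim_ex (fun n => (q n).2) k k_ge0 q2.
have a0 n : a <= (q n).1 /\ (q n).1 + h n <= b.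
  have := q1 0%N n; rewrite add0n /= /h expr0 divr1 -/(h n); lra.
have c0 n : c <= (q n).2 /\ (q n).2 + k n <= d.
  have := q2 0%N n; rewrite add0n /= /k expr0 divr1 -/(k n); lra.
have xab : a <= x <= b by have := hx 0%N; have := a0 0%N; lra.
have ycd : c <= y <= d by have := hy 0%N; have := c0 0%N; lra.
have [D hD] := dG xab ycd.
have P4 n : nc (rect G a b c d) <= 4 ^+ n * nc (Psi n (q n)).
  elim: n => [|n IH]; first by rewrite expr0 mul1r hb.
  have [_ _ e1] := q_step n; apply: le_trans IH _.
  by rewrite exprSr -mulrA ler_wpM2l// exprn_ge0.
set L := (b - a) + (d - c); have L0 : 0 <= L by rewrite addr_ge0 ?subr_ge0.
(* The factor 4^n lost in n bisections is regained by the square of the half perimeter L / 2^n, one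
   power from the length of the boundary and one from the differentiability estimate. *)
have key (e : R) : 0 < e -> nc (rect G a b c d) <= 2 * e * L ^+ 2.
  move=> e0; have [r r0 hr] := hD e e0.
  have [n hn] : exists n, L / 2 ^+ n < r.
    exists (Num.bound (L / r)); rewrite ltr_pdivrMr ?exprn_gt0//.
    have h1 := archi_boundP (divr_ge0 L0 (ltW r0)).
    set N := Num.bound _ in h1 *.
    have : (N%:R : R) <= 2 ^+ N by rewrite -natrX ler_nat ltnW// ltn_expl.
    rewrite ltr_pdivrMr// in h1; nra.
  have hk : h n + k n = L / 2 ^+ n by rewrite /h /k -mulrDl.
  apply: le_trans (P4 n) _.
  have -> : 2 * e * L ^+ 2 = 4 ^+ n * (2 * (e * (h n + k n)) * (h n + k n)).
    rewrite hk (_ : 4 = 2 * 2 :> R); last by ring.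
    by rewrite exprMn; field; rewrite expf_neq0.
  rewrite ler_wpM2l ?exprn_ge0//.
  have := @rect_bound G (G x y - D * (x%:C + I * y%:C)) D (q n).1 ((q n).1 + h n) (q n).2
     ((q n).2 + k n) (e * (h n + k n)) cG.
  rewrite [(q n).1 + h n - _]addrAC subrr add0r [(q n).2 + k n - _]addrAC subrr add0r; apply.
  - by rewrite lerDl.
  - by rewrite lerDl.
  move=> x' y' hx' hy'; have hx1 := hx n; have hy1 := hy n.
  have ax := a0 n; have cy := c0 n.
  have hs : `|x' - x| + `|y' - y| <= h n + k n.
    by apply: lerD; rewrite ler_norml; lra.
  have -> : G x' y' - (G x y - D * (x%:C + I * y%:C) + D * (x'%:C + I * y'%:C)) =
     G x' y' - G x y - D * ((x' - x)%:C + I * (y' - y)%:C).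
    by rewrite !rmorphB /=; ring.
  apply: (@le_trans _ _ (e * (`|x' - x| + `|y' - y|))).
    apply: hr; [lra|lra|].
    by rewrite (le_lt_trans hs)// hk.
  by rewrite ler_wpM2l// ltW.
apply/eqP; rewrite -nc_eq0 eq_le nc_ge0 andbT leNgt; apply/negP => gt0.
(* The summand 1 makes the contradiction strict and covers degenerate rectangles. *)
have L1 : 0 < 2 * L ^+ 2 + 1 by rewrite ltr_wpDl// mulr_ge0 ?sqr_ge0.
have q0 := divr_gt0 gt0 L1; have := key _ q0; set u := _ / _ in q0 *.
have -> : nc (rect G a b c d) = u * (2 * L ^+ 2 + 1) by rewrite divfK// gt_eqF.
lra.
Qed.

End Bisection.
End Goursat.

(** * Means over circles and their independence of the radius *)

Section Circle.
Variable R : realType.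
Local Notation C := R[i].
Local Notation I := ('i%C : C).
Local Notation T := (pi *+ 2 : R).

Definition cis (t : R) : C := cos t +i* sin t.

Lemma cisD x y : cis (x + y) = cis x * cis y.
Proof. by apply: eqC; rewrite ?ReM ?ImM /= ?cosD ?sinD//; ring. Qed.
Lemma cis0 : cis 0 = 1.
Proof. by rewrite /cis cos0 sin0. Qed.
Lemma cis2pi : cis T = 1.
Proof. by rewrite /cis cos2pi sin2pi. Qed.
Lemma nc_cis t : nc (cis t) = 1.
Proof. by apply/eqP; rewrite -(eqrXn2 (n := 2)) ?nc_ge0// sqr_nc /= cos2Dsin2 expr1n. Qed.
Lemma cisJ t : cis t * (cis t)^* = 1.
Proof. by rewrite mulcJ nc_cis expr1n. Qed.
Lemma ccont_cis : ccont cis.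
Proof. by move=> t; split => /=; [exact: continuous_cos|exact: continuous_sin]. Qed.
Lemma twopi_gt0 : 0 < T.
Proof. by rewrite pmulrn_lgt0// pi_gt0. Qed.

Definition mean (g : R -> C) : C := (T^-1)%:C * cintg g 0 T.

Lemma meanD g h : ccont g -> ccont h -> mean (fun t => g t + h t) = mean g + mean h.
Proof. by move=> ? ?; rewrite /mean cintgD// mulrDr. Qed.
Lemma meanB g h : ccont g -> ccont h -> mean (fun t => g t - h t) = mean g - mean h.
Proof. by move=> ? ?; rewrite /mean cintgB// mulrBr. Qed.
Lemma meanM c g : ccont g -> mean (fun t => c * g t) = c * mean g.
Proof. by move=> ?; rewrite /mean cintgM// mulrCA. Qed.
Lemma mean_sum J (r : seq J) (g : J -> R -> C) :
  (forall i, ccont (g i)) ->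
  mean (fun t => \sum_(i <- r) g i t) = \sum_(i <- r) mean (g i).
Proof. by move=> h; rewrite /mean cintg_sum// mulr_sumr. Qed.
Lemma mean_cst c : mean (fun=> c) = c.
Proof.
rewrite /mean cintg_cst subr0 mulrCA -rmorphM /= mulVf ?mulr1//.
by rewrite gt_eqF// twopi_gt0.
Qed.

Lemma mean_le (g h : R -> C) : ccont g -> ccont h ->
  (forall t, 0 <= t <= T -> nc (g t) <= Re (h t)) ->
  nc (mean g) <= Re (mean h).
Proof.
move=> cg ch gh; rewrite /mean ncM nc_real ReM /= mul0r subr0.
have T0 : 0 <= T^-1 by rewrite invr_ge0 ltW// twopi_gt0.
rewrite ger0_norm// ler_wpM2l//; apply: cintg_le_intg => //; first exact: ltW twopi_gt0.
exact: ccont_Re.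
Qed.

Lemma mean_bound (g : R -> C) (K : R) : ccont g ->
  (forall t, 0 <= t <= T -> nc (g t) <= K) -> nc (mean g) <= K.
Proof.
move=> cg gK; rewrite -[K]/(Re K%:C) -(mean_cst K%:C).
by apply: mean_le => //; exact: ccont_cst.
Qed.

(** Complex differentiability of exp(s + i t), built from real functions. The addition formulas move
    the base point to 0, where the derivatives of exp, cos and sin are combined. *)
Lemma cexp_approx (s0 t0 e : R) : 0 < e ->
  let z0 := (expR s0)%:C * cis t0 in
  exists2 r : R, 0 < r & forall s t : R, `|s - s0| + `|t - t0| < r ->
    nc ((expR s)%:C * cis t - z0 - z0 * ((s - s0)%:C + I * (t - t0)%:C)) <=
      e * (`|s - s0| + `|t - t0|).
Proof.
move=> e0 z0; pose n0 := nc z0; have n00 : 0 <= n0 by exact: nc_ge0.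
(* The errors below add up to 5 f (|h| + |k|), multiplied by |z0|; adding 1 to |z0| keeps the
   denominator positive. *)
pose f := e / (5 * (n0 + 1)).
have f0 : 0 < f by rewrite divr_gt0// mulr_gt0// ltr_wpDl.
have hf : n0 * (5 * f) <= e.
  have : f * (5 * (n0 + 1)) = e by rewrite divfK// gt_eqF// mulr_gt0// ltr_wpDl.
  nra.
have [r1 r10 h1] := is_derive_approx (is_derive_expR (0 : R)) f0.
have [r2 r20 h2] := is_derive_approx (is_derive_cos (0 : R)) f0.
have [r3 r30 h3] := is_derive_approx (is_derive_sin (0 : R)) f0.
exists (Num.min (Num.min r1 r2) (Num.min r3 (Num.min 1 f))).
  by rewrite !lt_min r10 r20 r30 f0 ltr01.
move=> s t; set h := s - s0; set k := t - t0.
rewrite !lt_min => /andP[/andP[hr1 hr2] /andP[hr3 /andP[hr4 hr5]]].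
have ah := normr_ge0 h; have ak := normr_ge0 k.
have := h1 h; have := h2 k; have := h3 k; rewrite !subr0 expR0 cos0 sin0 oppr0.
rewrite mul0r !mul1r !subr0 !addr0 => {}h3 {}h2 {}h1.
have {}h1 : `|expR h - 1 - h| <= f * `|h| by apply: h1; lra.
have {}h2 : `|cos k - 1| <= f * `|k| by apply: h2; lra.
have {}h3 : `|sin k - k| <= f * `|k|. by apply: h3; lra.
have -> : (expR s)%:C * cis t = z0 * ((expR h)%:C * cis k).
  have {1}-> : s = s0 + h by rewrite subrKC.
  have {1}-> : t = t0 + k by rewrite subrKC.
  have -> : (expR (s0 + h))%:C = (expR s0)%:C * (expR h)%:C by rewrite expRD rmorphM.
  by rewrite cisD mulrACA.
have -> : z0 * ((expR h)%:C * cis k) - z0 - z0 * (h%:C + I * k%:C) =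
   z0 * ((expR h - 1 - h)%:C * cis k + (1 + h)%:C * (cis k - 1 - I * k%:C) + I * h%:C * k%:C).
  have -> : (expR h - 1 - h)%:C = (expR h)%:C - 1 - h%:C.
    by apply: eqC; rewrite ?ReD ?ImD ?ReN ?ImN /=; ring.
  have -> : (1 + h)%:C = 1 + h%:C by apply: eqC; rewrite ?ReD ?ImD /=; ring.
  move: (expR h)%:C (cis k) (h%:C) (k%:C) => x1 x2 x3 x4; ring.
rewrite ncM -/n0.
have e1 : nc ((expR h - 1 - h)%:C * cis k) <= f * `|h|.
  by rewrite ncM nc_cis mulr1 nc_real.
have e2 : nc (cis k - 1 - I * k%:C) <= 2 * f * `|k|.
  apply: le_trans (nc_le_ReIm _) _.
  have -> : Re (cis k - 1 - I * k%:C) = cos k - 1 by rewrite !ReD !ReN ReM /=; ring.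
  have -> : Im (cis k - 1 - I * k%:C) = sin k - k by rewrite !ImD !ImN ImM /=; ring.
  lra.
have e3 : nc ((1 + h)%:C * (cis k - 1 - I * k%:C)) <= 4 * f * `|k|.
  rewrite ncM nc_real; have := ler_normD 1 h; rewrite normr1 => hh.
  have : `|1 + h| * nc (cis k - 1 - I * k%:C) <= 2 * (2 * f * `|k|).
    by apply: ler_pM; rewrite ?nc_ge0//; lra.
  lra.
have e4 : nc (I * h%:C * k%:C) <= f * `|k|.
  by rewrite !ncM nc_i mul1r !nc_real ler_wpM2r//; lra.
have e5 : nc ((expR h - 1 - h)%:C * cis k + (1 + h)%:C * (cis k - 1 - I * k%:C) + I * h%:C * k%:C)
    <= 5 * f * (`|h| + `|k|).
  apply: le_trans (ncD _ _) _; apply: le_trans (lerD (ncD _ _) (lexx _)) _.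
  have : 0 <= f * `|h| by rewrite mulr_ge0// ltW.
  lra.
apply: le_trans (ler_wpM2l n00 e5) _.
have : 0 <= `|h| + `|k| by rewrite addr_ge0.
move: (`|h| + `|k|) => x x0; nra.
Qed.

Lemma cderiv_cont (f : C -> C) z d (e : R) : cderiv f z d -> 0 < e ->
  exists2 r : R, 0 < r & forall w, nc (w - z) < r -> nc (f w - f z) < e.
Proof.
move=> hd e0; have [r r0 hr] := hd _ ltr01.
have d1 : 0 < nc d + 1 by rewrite ltr_wpDl// nc_ge0.
exists (Num.min r (e / (nc d + 1))); first by rewrite lt_min r0 divr_gt0.
move=> w; rewrite lt_min (ltr_pdivlMr _ _ d1) => /andP[h1 h2].
have h3 := hr w h1; have := ncD (f w - f z - d * (w - z)) (d * (w - z)).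
rewrite subrK ncM => h4; lra.
Qed.

Lemma ccont_comp (f : C -> C) (u : R -> C) : ccont u ->
  (forall t, derivable (f : C^o -> C^o) (u t) 1) -> ccont (fun t => f (u t)).
Proof.
move=> /ccontP cu df; apply/ccontP => t e e0.
have [r r0 hr] := cderiv_cont (derivable_cderiv (df t)) e0.
have [d d0 hd] := cu t r r0; exists d => // v vt; exact/hr/hd.
Qed.

Lemma cexp_comp (q : C -> C) (s0 t0 : R) d : cderiv q ((expR s0)%:C * cis t0) d ->
  exists D : C, forall e : R, 0 < e -> exists2 r : R, 0 < r &
  forall s t : R, `|s - s0| + `|t - t0| < r ->
    nc (q ((expR s)%:C * cis t) - q ((expR s0)%:C * cis t0)
        - D * ((s - s0)%:C + I * (t - t0)%:C)) <= e * (`|s - s0| + `|t - t0|).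
Proof.
set z0 := _ * cis t0 => hd; exists (d * z0) => e e0.
have n0 := nc_ge0 z0; have nd := nc_ge0 d.
pose e1 := e / (2 * (nc z0 + 1)).
have e10 : 0 < e1 by rewrite divr_gt0// mulr_gt0// ltr_wpDl.
have he1 : e1 * (2 * (nc z0 + 1)) = e by rewrite divfK// gt_eqF// mulr_gt0// ltr_wpDl.
pose e2 := Num.min 1 (e / (2 * (nc d + 1))).
have e20 : 0 < e2 by rewrite lt_min ltr01 divr_gt0// mulr_gt0// ltr_wpDl.
have e21 : e2 <= 1 by rewrite ge_min lexx.
have he2 : e2 * (2 * (nc d + 1)) <= e.
  by rewrite -ler_pdivlMr ?mulr_gt0// ?ltr_wpDl// ge_min lexx orbT.
have [r1 r10 h1] := hd _ e10.
have [r2 r20 h2] := cexp_approx s0 t0 e20.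
have n1 : 0 < nc z0 + 1 by rewrite ltr_wpDl.
exists (Num.min r2 (r1 / (nc z0 + 1))); first by rewrite lt_min r20 divr_gt0.
move=> s t; rewrite lt_min (ltr_pdivlMr _ _ n1).
set h := s - s0; set k := t - t0; set z := _ * cis t; set rho := `|h| + `|k|.
move=> /andP[hr2 hr1]; set w := h%:C + I * k%:C.
have rho0 : 0 <= rho by rewrite addr_ge0.
have nw : nc w <= rho by rewrite (le_trans (ncD _ _))// ncM nc_i mul1r !nc_real.
have h3 : nc (z - z0 - z0 * w) <= e2 * rho := h2 s t hr2.
have h4 : nc (z - z0) <= (nc z0 + 1) * rho.
  have := ncD (z - z0 - z0 * w) (z0 * w); rewrite subrK ncM; nra.
have h5 : nc (q z - q z0 - d * (z - z0)) <= e1 * nc (z - z0).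
  by apply: h1; rewrite (le_lt_trans h4)// mulrC.
have -> : q z - q z0 - d * z0 * w = (q z - q z0 - d * (z - z0)) + d * (z - z0 - z0 * w) by ring.
apply: le_trans (ncD _ _) _; rewrite ncM.
have h6 : e1 * nc (z - z0) <= e1 * ((nc z0 + 1) * rho) by rewrite ler_wpM2l// ltW.
have h7 : nc d * nc (z - z0 - z0 * w) <= nc d * (e2 * rho) by rewrite ler_wpM2l.
have h8 : e2 * (2 * (nc d + 1)) * rho <= e * rho by rewrite ler_wpM2r.
have h9 : 0 <= e2 * rho by rewrite mulr_ge0// ltW.
have -> : e * rho = e1 * (2 * (nc z0 + 1)) * rho / 2 + e * rho / 2 by rewrite he1; field.
lra.
Qed.

(* Goursat's theorem on a rectangle in the logarithmic coordinates
   [exp (s + i t)], truncated at [s = ln r2] to stay in the disk. *)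
Lemma mean_radius (q : C -> C) (r1 r2 : R) : 0 < r1 -> r1 <= r2 -> r2 < 1 ->
  (forall z, 0 < nc z < 1 -> derivable (q : C^o -> C^o) z 1) ->
  mean (fun t => q (r1%:C * cis t)) = mean (fun t => q (r2%:C * cis t)).
Proof.
move=> r10 r12 r21 dq; have r20 : 0 < r2 by apply: lt_le_trans r12.
pose a := ln r1; pose b := ln r2.
have ab : a <= b by rewrite ler_ln ?posrE.
have b0 : b < 0 by rewrite ln_lt0// r20.
pose G (s t : R) := q ((expR (Num.min s b))%:C * cis t).
have nexp (s t : R) : 0 < nc ((expR (Num.min s b))%:C * cis t) < 1.
  rewrite ncM nc_cis mulr1 nc_real ger0_norm ?expR_ge0// expR_gt0 /= expR_lt1.
  by rewrite (le_lt_trans _ b0)// ge_min lexx orbT.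
have cG : sep_ccont G.
  split=> [t|s].
    apply: (@ccont_comp q (fun s => (expR (Num.min s b))%:C * cis t)).
      apply: ccontM; last exact: ccont_cst.
      apply: ccont_real => s; apply: continuous_comp; last exact: continuous_expR.
      apply: (@continuous_min _ _ id (fun=> b) s); first exact: cvg_id.
      exact: cvg_cst.
    by move=> s; exact/dq/nexp.
  apply: (@ccont_comp q (fun t => (expR (Num.min s b))%:C * cis t)).
    by apply: ccontM; [exact: ccont_cst|exact: ccont_cis].
  by move=> t; exact/dq/nexp.
have dG : cdiff_on G a b 0 T.
  move=> s t /andP[sa sb] _.
  have Gs (s' t' : R) : s' <= b -> G s' t' = q ((expR s')%:C * cis t').
    by move=> h; rewrite /G min_l.
  have := nexp s t; rewrite min_l// => /dq/derivable_cderiv/cexp_comp[D hD].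
  exists D => e /hD[r r0 hr]; exists r => // s' t' /andP[_ s'b] _ h.
  by rewrite !Gs//; exact: hr.
have T0 := ltW twopi_gt0.
have := goursat ab T0 cG dG; rewrite /rect.
(* By periodicity the two horizontal sides carry the same integral and cancel, which leaves the
   means over the two circles. *)
have -> : G^~ T = G^~ 0 by apply/funext => s; rewrite /G cis2pi cis0.
move: (cintg (G^~ 0) a b) => X hX.
have /eqP : I * (cintg (G b) 0 T - cintg (G a) 0 T) = 0 by rewrite -hX; ring.
rewrite mulf_eq0 => /orP[|].
  by rewrite eq_complex /= oner_eq0 andbF.
rewrite subr_eq0 => /eqP h; rewrite /mean; congr (_ * _).
have -> : (fun t => q (r1%:C * cis t)) = G a.
  by apply/funext => t; rewrite /G min_l// lnK.
have -> : (fun t => q (r2%:C * cis t)) = G b.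
  by apply/funext => t; rewrite /G min_l// lnK.
by [].
Qed.

End Circle.

Arguments mean : simpl never.

(** * Orthogonality of exponentials and Cauchy coefficients *)

Section TaylorExpansion.
Variable R : realType.
Local Notation C := R[i].
Local Notation cis := (@cis R).
Implicit Types (f : C -> C) (r : R).

Lemma nc_rcis r t : nc (r%:C * cis t) = `|r|.
Proof. by rewrite ncM nc_cis mulr1 nc_real. Qed.

Lemma ccont_rcis r : ccont (fun t => r%:C * cis t).
Proof. by apply: ccontM; [exact: ccont_cst|exact: ccont_cis]. Qed.

Lemma ccont_circle f r : holomorphic f -> 0 <= r < 1 -> ccont (fun t => f (r%:C * cis t)).
Proof.
move=> hf /andP[r0 r1]; apply: (@ccont_comp _ f (fun t => r%:C * cis t)).
  exact: ccont_rcis.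
by move=> t; apply: hf; apply/diskE; rewrite nc_rcis ger0_norm.
Qed.

Lemma ccont_cisX n : ccont (fun t => cis t ^+ n).
Proof. exact/ccontX/ccont_cis. Qed.
Lemma ccont_cisJX n : ccont (fun t => (cis t)^* ^+ n).
Proof. exact/ccontX/ccontJ/ccont_cis. Qed.

Lemma realC_eq0 r : (r%:C == 0) = (r == 0).
Proof. by rewrite -[0]/(0%:C) (inj_eq (@complexI R)). Qed.

Lemma meanJ (g : R -> C) : ccont g -> mean (fun t => (g t)^*) = (mean g)^*.
Proof.
move=> cg; rewrite /mean -[RHS]/((_ * _)^*) [RHS]rmorphM; congr (_ * _); first exact/esym/conjc_real.
rewrite /cintg; apply: eqC => /=; first by under eq_fun do rewrite ReJ.
under eq_fun do rewrite ImJ -mulN1r.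
by rewrite intgZ ?mulN1r//; exact: ccont_Im.
Qed.

Lemma derivable_exprn n (z : C) : derivable ((fun x => x ^+ n) : C^o -> C^o) z 1.
Proof. exact: exprn_derivable. Qed.

(** The mean of z^n over the circle of radius r scales like r^n and yet does not depend on r; the
    radii 1/4 and 1/2 are compared. *)
Lemma mean_cis0 n : (0 < n)%N -> mean (fun t => cis t ^+ n) = 0.
Proof.
move=> n0; have := @mean_radius R (fun z => z ^+ n) 4^-1 2^-1.
have h4 : (4^-1 : R) > 0 by rewrite invr_gt0.
move=> /(_ h4); have : (4^-1 : R) <= 2^-1 by rewrite lef_pV2 ?posrE// ler_nat.
move=> h42 /(_ h42); have : (2^-1 : R) < 1 by rewrite invf_lt1// ltr1n.
move=> h2 /(_ h2) /(_ (fun z _ => @derivable_exprn n z)).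
have hm r : mean (fun t => (r%:C * cis t) ^+ n) = r%:C ^+ n * mean (fun t => cis t ^+ n).
  rewrite -meanM; last exact: ccont_cisX.
  by congr mean; apply/funext => t; rewrite exprMn.
rewrite !hm.
move=> /eqP; rewrite -subr_eq0 -mulrBl mulf_eq0 => /orP[|/eqP//].
rewrite subr_eq0 -!rmorphXn (inj_eq (@complexI R)) eqrXn2 ?invr_ge0//.
by rewrite (inj_eq invr_inj) eqr_nat.
Qed.

Lemma cisXJ t j k : (k <= j)%N -> cis t ^+ j * (cis t)^* ^+ k = cis t ^+ (j - k).
Proof.
by move=> kj; rewrite -{1}(subnK kj) exprD -mulrA -exprMn cisJ expr1n mulr1.
Qed.
Lemma cisJX t j k : (j <= k)%N -> cis t ^+ j * (cis t)^* ^+ k = (cis t)^* ^+ (k - j).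
Proof.
by move=> jk; rewrite -{1}(subnK jk) exprD mulrCA -exprMn cisJ expr1n mulr1.
Qed.

Lemma mean_cisM j k : mean (fun t => cis t ^+ j * (cis t)^* ^+ k) = (j == k)%:R.
Proof.
have [jk|kj|->] := ltngtP j k.
- under eq_fun do rewrite (cisJX _ (ltnW jk)) -rmorphXn.
  by rewrite meanJ ?mean_cis0 ?rmorph0 ?subn_gt0//; exact: ccont_cisX.
- under eq_fun do rewrite (cisXJ _ (ltnW kj)).
  by rewrite mean_cis0 ?subn_gt0.
- under eq_fun do rewrite -exprMn cisJ expr1n.
  exact: mean_cst.
Qed.

(** Independence of the radius for f(z) / z^n, holomorphic off 0. On the circle 1 / cis t is the
    conjugate of cis t, and the powers of the radii are cross-multiplied. *)
Lemma mean_circleJ f n r1 r2 : holomorphic f -> 0 < r1 -> r1 <= r2 -> r2 < 1 ->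
  mean (fun t => f (r1%:C * cis t) * (cis t)^* ^+ n) * (r2%:C) ^+ n =
  mean (fun t => f (r2%:C * cis t) * (cis t)^* ^+ n) * (r1%:C) ^+ n.
Proof.
move=> hf r10 r12 r21; have r20 : 0 < r2 by apply: lt_le_trans r12.
have rn0 r : 0 < r -> (r%:C : C) ^+ n != 0.
  by move=> r0; rewrite expf_neq0// realC_eq0 gt_eqF.
have E r t : 0 < r -> f (r%:C * cis t) / (r%:C * cis t) ^+ n =
    ((r%:C) ^+ n)^-1 * (f (r%:C * cis t) * (cis t)^* ^+ n).
  move=> r0; have c0 : cis t ^+ n != 0 by rewrite expf_neq0// -nc_eq0 nc_cis oner_eq0.
  have -> : (cis t)^* ^+ n = (cis t ^+ n)^-1.
    by apply: (mulfI c0); rewrite -exprMn cisJ expr1n mulfV.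
  by rewrite exprMn invfM mulrCA.
have dq z : 0 < nc z < 1 -> derivable ((fun z => f z / z ^+ n) : C^o -> C^o) z 1.
  move=> /andP[z0 z1]; apply: (@derivableM _ _ (f : C^o -> C^o)).
    by apply: hf; exact/diskE.
  apply: (@derivableV _ _ (fun z : C^o => z ^+ n)); last exact: derivable_exprn.
  by rewrite expf_neq0// -nc_gt0.
have cf r : 0 <= r < 1 -> ccont (fun t => f (r%:C * cis t) * (cis t)^* ^+ n).
  by move=> ?; apply: ccontM; [exact: ccont_circle|exact: ccont_cisJX].
have hm r : 0 < r -> r < 1 -> mean (fun t => f (r%:C * cis t) / (r%:C * cis t) ^+ n) =
    ((r%:C) ^+ n)^-1 * mean (fun t => f (r%:C * cis t) * (cis t)^* ^+ n).
  move=> r0 rlt1; rewrite -meanM; last by apply: cf; lra.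
  by congr mean; apply/funext => t; exact: E.
have r11 : r1 < 1 by apply: le_lt_trans r21.
have := @mean_radius R (fun z => f z / z ^+ n) r1 r2 r10 r12 r21 dq.
move=> e; have {e} := etrans (esym (hm r1 r10 r11)) (etrans e (hm r2 r20 r21)).
set M1 := mean _; set M2 := mean _ => h.
rewrite -[M1](mulVKf (rn0 _ r10)) h.
move: (rn0 _ r20); move: (r2%:C ^+ n) (r1%:C ^+ n) => x2 x1 x20; field; exact: x20.
Qed.

(** The function f(z) z^n has a mean independent of the radius and tends to 0 at the origin, so the
    mean is 0. *)
Lemma mean_circle_neg f n r : holomorphic f -> (0 < n)%N -> 0 < r < 1 ->
  mean (fun t => f (r%:C * cis t) * cis t ^+ n) = 0.
Proof.
move=> hf n0 /andP[r0 r1].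
pose q := fun z => f z * z ^+ n.
have dq z : nc z < 1 -> derivable (q : C^o -> C^o) z 1.
  move=> z1; apply: (@derivableM _ _ (f : C^o -> C^o)); last exact: derivable_exprn.
  by apply: hf; exact/diskE.
have cq s : 0 <= s < 1 -> ccont (fun t => q (s%:C * cis t)).
  by apply: ccont_circle => z /diskE; exact: dq.
suff h : mean (fun t => q (r%:C * cis t)) = 0.
  have : mean (fun t => r%:C ^+ n * (f (r%:C * cis t) * cis t ^+ n)) = 0.
    by rewrite -h; congr mean; apply/funext => t; rewrite /q exprMn; ring.
  rewrite meanM; last first.
    by apply: ccontM; [apply: ccont_circle => //; lra|exact: ccont_cisX].
  have rn : (r%:C : C) ^+ n != 0 by rewrite expf_neq0// realC_eq0 gt_eqF.
  by move=> /eqP; rewrite mulf_eq0 (negbTE rn) orFb => /eqP.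
have dom : disk (0 : C) by apply/diskE; rewrite nc0.
have [d d0 hd] := cderiv_cont (derivable_cderiv (hf 0 dom)) ltr01.
set c := mean _; apply/eqP; rewrite -nc_eq0 eq_le nc_ge0 andbT leNgt; apply/negP => c0.
set K := nc (f 0) + 1; have K0 : 0 < K by rewrite ltr_wpDl// nc_ge0.
(* The three entries keep the radius below r, keep |f| at most K on the circle, and make the bound s
   K on the mean at most |c| / 2. *)
pose s := Num.min (r / 2) (Num.min (d / 2) (nc c / (2 * K))).
have s0 : 0 < s by rewrite !lt_min !divr_gt0// mulr_gt0.
have sr : s <= r by apply: (@le_trans _ _ (r / 2)); [rewrite ge_min lexx|lra].
have sd : s < d by apply: (@le_lt_trans _ _ (d / 2)); [rewrite !ge_min lexx orbT|lra].
have sc : s * (2 * K) <= nc c.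
  by rewrite -ler_pdivlMr ?mulr_gt0// !ge_min lexx !orbT.
have : nc c <= s * K.
  rewrite /c -(@mean_radius R q s r)//; last by move=> z /andP[_ z1]; exact: dq.
  apply: mean_bound; first by apply: cq; lra.
  move=> t _; rewrite /q ncM ncX !nc_rcis (ger0_norm (ltW s0)).
  have h1 : nc (f (s%:C * cis t)) <= K.
    have := hd (s%:C * cis t); rewrite subr0 nc_rcis (ger0_norm (ltW s0)) => /(_ sd).
    have := ncD (f (s%:C * cis t) - f 0) (f 0); rewrite subrK /K; lra.
  have h2 : s ^+ n <= s.
    by rewrite -[leRHS]expr1 ler_wiXn2l//; lra.
  rewrite mulrC; apply: ler_pM => //; rewrite ?exprn_ge0 ?nc_ge0//; exact: ltW.
nra.
Qed.

End TaylorExpansion.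

(** * Fejer means and the Taylor expansion *)

Section Fejer.
Variable R : realType.
Local Notation C := R[i].
Local Notation cis := (@cis R).
Implicit Types (f : C -> C) (r : R).

Lemma ccont_bounded (g : R -> C) : ccont g ->
  exists2 K : R, 0 <= K & forall t, 0 <= t <= pi *+ 2 -> nc (g t) <= K.
Proof.
move=> cg; have [|c _ hc] := @EVT_max R (fun t => nc (g t)) 0 (pi *+ 2) (ltW (@twopi_gt0 R)).
  by apply: continuous_subspaceT => t; exact: ccvg_nc (cg t).
exists (nc (g c)) => [|t tT]; first exact: nc_ge0.
by apply: hc; rewrite in_itv.
Qed.

(** Cauchy's coefficients: one sequence has to serve all radii at once. *)
Definition circle_coef f (a : nat -> C) := forall r, 0 < r < 1 -> forall n,
  mean (fun t => f (r%:C * cis t) * (cis t)^* ^+ n) = a n * r%:C ^+ n.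

Lemma circle_coef_ex f : holomorphic f -> exists a, circle_coef f a.
Proof.
move=> hf; pose M r n := mean (fun t => f (r%:C * cis t) * (cis t)^* ^+ n).
exists (fun n => M 2^-1 n * 2 ^+ n) => r /andP[r0 r1] n; rewrite -/(M r n).
have h20 : (0 : R) < 2^-1 by rewrite invr_gt0.
have h21 : (2^-1 : R) < 1 by rewrite invf_lt1// ltr1n.
have h2 : (2^-1)%:C ^+ n * 2 ^+ n = 1 :> C.
  by rewrite -exprMn fmorphV rmorph_nat mulVf ?expr1n// pnatr_eq0.
have : M r n * (2^-1)%:C ^+ n = M 2^-1 n * r%:C ^+ n.
  have [rh|hr] := leP r 2^-1; first exact: mean_circleJ.
  by apply/esym/mean_circleJ => //; exact: ltW.
by move=> h; rewrite mulrAC -h -mulrA h2 mulr1.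
Qed.

Lemma circle_coef_bound f a r : holomorphic f -> circle_coef f a -> 0 < r < 1 ->
  exists2 K : R, 0 <= K & forall n, nc (a n) * r ^+ n <= K.
Proof.
move=> hf fa r01; have r0 : 0 <= r < 1 by lra.
have [K K0 hK] := ccont_bounded (ccont_circle hf r0).
exists K => // n; have -> : nc (a n) * r ^+ n = nc (a n * r%:C ^+ n).
  by rewrite ncM ncX nc_real ger0_norm//; lra.
rewrite -(fa r r01); apply: mean_bound.
  by apply: ccontM; [exact: ccont_circle|exact: ccont_cisJX].
by move=> t tT; rewrite ncM ncX nc_conj nc_cis expr1n mulr1 hK.
Qed.

Lemma mean_circle_cisM f a r j k : holomorphic f -> circle_coef f a -> 0 < r < 1 ->
  mean (fun t => f (r%:C * cis t) * (cis t ^+ j * (cis t)^* ^+ k)) =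
  if (j <= k)%N then a (k - j)%N * r%:C ^+ (k - j) else 0.
Proof.
move=> hf fa r01; case: leqP => jk.
  rewrite -fa//; congr mean; apply/funext => t; by rewrite (cisJX _ jk).
transitivity (mean (fun t => f (r%:C * cis t) * cis t ^+ (j - k))).
  by congr mean; apply/funext => t; rewrite (cisXJ _ (ltnW jk)).
by apply: mean_circle_neg => //; rewrite subn_gt0.
Qed.

(** The Fejer kernel centred at the unimodular e, expanded so that its mean against f is a
    combination of Cauchy coefficients; [fejerE] is the nonnegative closed form. *)
Definition fejer (e : C) N t : C :=
  N%:R^-1 * \sum_(k < N) \sum_(l < N)
    (e ^+ l * e^* ^+ k) * (cis t ^+ k * (cis t)^* ^+ l).

Lemma fejerE e N t : nc e = 1 -> fejer e N t =
  (N%:R^-1 * nc (\sum_(k < N) (cis t * e^*) ^+ k) ^+ 2)%:C.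
Proof.
move=> e1; set S := \sum_(k < N) _.
have -> : (N%:R^-1 * nc S ^+ 2)%:C = N%:R^-1 * (nc S ^+ 2)%:C.
  by rewrite rmorphM fmorphV rmorph_nat.
rewrite -mulcJ /S rmorph_sum mulr_suml.
congr (_ * _); apply: eq_bigr => k _; rewrite mulr_sumr; apply: eq_bigr => l _.
rewrite -[X in _ = _ * X]/(((cis t * e^*) ^+ l)^*).
have -> : ((cis t * e^*) ^+ l)^* = (cis t)^* ^+ l * e ^+ l.
  rewrite rmorphXn -exprMn; congr (_ ^+ _).
  by apply: eqC; rewrite ?ReJ ?ImJ ?ReM ?ImM ?ReJ ?ImJ; ring.
rewrite exprMn; ring.
Qed.

Lemma ccont_cisM (j k : nat) : ccont (fun t => cis t ^+ j * (cis t)^* ^+ k).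
Proof. by apply: ccontM; [exact: ccont_cisX|exact: ccont_cisJX]. Qed.

Lemma ccont_fejer e N : ccont (fejer e N).
Proof.
apply: ccontM; first exact: ccont_cst.
apply: ccont_sum => k _; apply: ccont_sum => l _.
by apply: ccontM; [exact: ccont_cst|exact: ccont_cisM].
Qed.

Lemma mean_fejerM (g : R -> C) e N : ccont g ->
  mean (fun t => g t * fejer e N t) =
  N%:R^-1 * \sum_(k < N) \sum_(l < N)
    (e ^+ l * e^* ^+ k) * mean (fun t => g t * (cis t ^+ k * (cis t)^* ^+ l)).
Proof.
move=> cg.
have c1 k l : ccont (fun t => g t * (cis t ^+ k * (cis t)^* ^+ l)).
  by apply: ccontM => //; exact: ccont_cisM.
have c2 k l : ccont (fun t => (e ^+ l * e^* ^+ k) * (g t * (cis t ^+ k * (cis t)^* ^+ l))).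
  by apply: ccontM => //; exact: ccont_cst.
have c3 (k : nat) : ccont (fun t => \sum_(l < N) (e ^+ l * e^* ^+ k) * (g t * (cis t ^+ k * (cis t)^* ^+ l))).
  by apply: ccont_sum => l _.
transitivity (mean (fun t => N%:R^-1 * \sum_(k < N) \sum_(l < N)
    (e ^+ l * e^* ^+ k) * (g t * (cis t ^+ k * (cis t)^* ^+ l)))).
  congr mean; apply/funext => t; rewrite /fejer mulrCA; congr (_ * _).
  rewrite mulr_sumr; apply: eq_bigr => k _; rewrite mulr_sumr; apply: eq_bigr => l _.
  by rewrite mulrCA.
rewrite meanM; last by apply: ccont_sum => k _.
congr (_ * _); rewrite mean_sum//; apply: eq_bigr => k _.
by rewrite mean_sum//; apply: eq_bigr => l _; rewrite meanM.
Qed.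

Lemma eJ (e : C) k l : nc e = 1 -> (k <= l)%N -> e ^+ l * e^* ^+ k = e ^+ (l - k).
Proof.
move=> e1 kl; rewrite -{1}(subnK kl) exprD -mulrA -exprMn mulcJ e1 expr1n.
by rewrite expr1n mulr1.
Qed.

Lemma mean_fejer e N : nc e = 1 -> (0 < N)%N -> mean (fejer e N) = 1.
Proof.
move=> e1 N0; transitivity (mean (fun t => 1 * fejer e N t)).
  by congr mean; apply/funext => t; rewrite mul1r.
rewrite (mean_fejerM _ _ (ccont_cst 1)).
transitivity (N%:R^-1 * \sum_(k < N) (1 : C)).
  have h (k l : nat) : mean (fun t => 1 * (cis t ^+ k * (cis t)^* ^+ l)) = (k == l)%:R.
    by rewrite -mean_cisM; congr mean; apply/funext => t; rewrite mul1r.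
  congr (_ * _); apply: eq_bigr => k _; rewrite (bigD1 k)//= big1 ?addr0.
    by rewrite h eqxx mulr1 eJ// subnn.
  by move=> l lk; rewrite h eq_sym (inj_eq val_inj) (negbTE lk) mulr0.
by rewrite sumr_const card_ord mulVf// pnatr_eq0 -lt0n.
Qed.

(** The terms with k > l have mean 0 by [mean_circle_neg]. For fixed l the others, indexed by l - k,
    form a partial sum with [l.+1] terms, so the result is a Cesaro mean. *)
Lemma mean_circle_fejer f a r e N : holomorphic f -> circle_coef f a -> 0 < r < 1 ->
  nc e = 1 ->
  mean (fun t => f (r%:C * cis t) * fejer e N t) =
  N%:R^-1 * \sum_(l < N) psum a (r%:C * e) l.+1.
Proof.
move=> hf fa r01 e1; rewrite mean_fejerM; last by apply: ccont_circle => //; lra.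
congr (_ * _); rewrite exchange_big /=; apply: eq_bigr => l _.
transitivity (\sum_(k < N | (k < l.+1)%N) a (l - k)%N * (r%:C * e) ^+ (l - k)).
  rewrite [RHS]big_mkcond /=; apply: eq_bigr => k _.
  rewrite (mean_circle_cisM _ _ hf fa r01) ltnS; case: leqP => kl; last by rewrite mulr0.
  by rewrite eJ// exprMn; ring.
rewrite -(big_ord_widen N (fun k => a (l - k)%N * (r%:C * e) ^+ (l - k)))//.
rewrite /psum (reindex_inj rev_ord_inj) /=; apply: eq_bigr => k _.
by rewrite subSS subKn// -ltnS.
Qed.

(** The kernel is nonnegative with mean 1. Near e continuity of f bounds the integrand; away from e
    the kernel itself is O(1/N). *)
Lemma fejer_limit f a r e (eps : R) : holomorphic f -> circle_coef f a -> 0 < r < 1 ->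
  nc e = 1 -> 0 < eps ->
  exists N0, forall N, (N0 <= N)%N ->
    nc (N.+1%:R^-1 * \sum_(l < N.+1) psum a (r%:C * e) l.+1 - f (r%:C * e)) < eps.
Proof.
move=> hf fa r01 e1 eps0; set w := r%:C * e.
have r01' : 0 <= r < 1 by lra.
have wd : disk w by apply/diskE; rewrite ncM e1 mulr1 nc_real ger0_norm//; lra.
pose g t := f (r%:C * cis t) - f w.
have cg : ccont g by apply: ccontB; [exact: ccont_circle|exact: ccont_cst].
have [K K0 hK] := ccont_bounded cg.
have eps2 : 0 < eps / 2 by rewrite divr_gt0.
have [d d0 hd] := cderiv_cont (derivable_cderiv (hf w wd)) eps2.
(* Away from e, |cis t - e| >= d. The geometric sum in the kernel times |cis t - e| is at most 2, so
   the kernel is at most 4 / (d^2 N); K bounds the other factor. *)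
pose B := 4 * K / d ^+ 2; have B0 : 0 <= B by rewrite divr_ge0 ?sqr_ge0// mulr_ge0.
exists (Num.bound (B / (eps / 2))) => N hN.
have NB : B < N.+1%:R * (eps / 2).
  rewrite -ltr_pdivrMr//; apply: lt_le_trans (archi_boundP _) _.
    by rewrite divr_ge0// ltW.
  by rewrite ler_nat ltnW.
have N0 : (0 : R) < N.+1%:R by rewrite ltr0n.
have -> : N.+1%:R^-1 * \sum_(l < N.+1) psum a w l.+1 - f w =
    mean (fun t => g t * fejer e N.+1 t).
  have c1 : ccont (fun t => f (r%:C * cis t) * fejer e N.+1 t).
    by apply: ccontM; [exact: ccont_circle|exact: ccont_fejer].
  have c2 : ccont (fun t => f w * fejer e N.+1 t).
    by apply: ccontM; [exact: ccont_cst|exact: ccont_fejer].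
  transitivity (mean (fun t => f (r%:C * cis t) * fejer e N.+1 t - f w * fejer e N.+1 t)).
    rewrite (meanB c1 c2) (mean_circle_fejer _ hf fa r01 e1).
    by rewrite (meanM _ (ccont_fejer _ _)) mean_fejer// mulr1.
  by congr mean; apply/funext => t; rewrite /g mulrBl.
have : nc (mean (fun t => g t * fejer e N.+1 t)) <=
    Re (mean (fun t => (eps / 2)%:C * fejer e N.+1 t + (B / N.+1%:R)%:C)).
  apply: mean_le.
  - by apply: ccontM => //; exact: ccont_fejer.
  - apply: ccontD; last exact: ccont_cst.
    by apply: ccontM; [exact: ccont_cst|exact: ccont_fejer].
  move=> t tT; rewrite fejerE// -rmorphM -rmorphD /= ncM nc_real.
  set S := nc (\sum_(k < N.+1) _).
  have S0 : 0 <= S by exact: nc_ge0.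
  have SN : 0 <= N.+1%:R^-1 * S ^+ 2 by rewrite mulr_ge0 ?sqr_ge0 ?invr_ge0.
  rewrite ger0_norm//.
  have [ce|ce] := ltP (nc (cis t - e) * r) d.
    have : nc (g t) < eps / 2.
      apply: hd; rewrite -mulrBr ncM nc_real ger0_norm; last lra.
      by rewrite mulrC.
    move=> /ltW /(ler_wpM2r SN) hlt.
    have : 0 <= B / N.+1%:R by rewrite divr_ge0.
    move: hlt; move: (nc (g t) * _) (eps / 2 * _) (B / _) => x1 x2 x3; lra.
  have zS : nc (cis t - e) * S <= 2.
    have -> : nc (cis t - e) = nc (cis t * e^* - 1).
      rewrite -[RHS]mulr1 -e1 -ncM mulrBl -mulrA [e^* * e]mulrC mulcJ e1.
      by rewrite expr1n mulr1 mul1r.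
    rewrite -ncM -subrX1 (le_trans (ncB _ _))// ncX ncM nc_conj nc_cis e1 nc1.
    by rewrite mulr1 expr1n.
  have dS : d * S <= 2.
    apply: le_trans zS; rewrite ler_wpM2r//; apply: le_trans ce _.
    by have := nc_ge0 (cis t - e); nra.
  have dS2 : d ^+ 2 * S ^+ 2 <= 4.
    by rewrite -exprMn (_ : 4 = 2 ^+ 2 :> R)?lerXn2r ?nnegrE ?mulr_ge0 ?(ltW d0)//; ring.
  have h1 : nc (g t) * (N.+1%:R^-1 * S ^+ 2) <= K * (N.+1%:R^-1 * S ^+ 2).
    by rewrite ler_wpM2r// hK.
  have h2 : K * (N.+1%:R^-1 * S ^+ 2) <= B / N.+1%:R.
    rewrite mulrCA mulrC ler_wpM2r ?invr_ge0// /B ler_pdivlMr ?exprn_gt0//.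
    by have := ler_wpM2l K0 dS2; lra.
  by apply: le_trans h1 _; apply: le_trans h2 _; rewrite lerDr mulr_ge0// ltW.
move=> h; apply: le_lt_trans h _.
rewrite meanD; last exact: ccont_cst.
  rewrite (meanM _ (ccont_fejer _ _)) mean_fejer// mean_cst mulr1 ReD.
  by rewrite -[Re _]/(eps / 2) -[Re _]/(B / N.+1%:R) [ltRHS]splitr ltrD2l ltr_pdivrMr// mulrC.
by apply: ccontM; [exact: ccont_cst|exact: ccont_fejer].
Qed.

(** Cauchy's estimates make the series converge. Its Cesaro means tend to the same limit, and by
    [fejer_limit] they tend to f. The origin has no direction w / |w| and is treated by small
    circles. *)
Lemma circle_coef_pser f a : holomorphic f -> circle_coef f a -> pser a f.
Proof.
move=> hf fa w w1.
have [w0|w0] := eqVneq w 0.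
  have d0 : disk (0 : C) by apply/diskE; rewrite nc0.
  have -> : f w = a 0%N.
    rewrite w0; apply/eqP; rewrite -subr_eq0 -nc_eq0 eq_le nc_ge0 andbT leNgt.
    apply/negP => c0; have [d d0' hd] := cderiv_cont (derivable_cderiv (hf 0 d0)) c0.
    pose r := Num.min (2^-1) (d / 2); have r0 : 0 < r by rewrite lt_min invr_gt0 divr_gt0// ltr0n.
    have r1 : r < 1.
      by apply: (@le_lt_trans _ _ 2^-1); rewrite ?ge_min ?lexx// invf_lt1// ltr1n.
    have rd : r < d.
      by apply: (@le_lt_trans _ _ (d / 2)); rewrite ?ge_min ?lexx ?orbT//; lra.
    have r01 : 0 < r < 1 by rewrite r0.
    have r01' : 0 <= r < 1 by rewrite r1 ltW.
    have cf := ccont_circle hf r01'.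
    have h0 : mean (fun t => f (r%:C * cis t)) = a 0%N.
      rewrite -[RHS]mulr1 -[X in _ * X](expr0 (r%:C)) -fa//.
      by congr mean; apply/funext => t; rewrite expr0 mulr1.
    have [|t _ ht] := @EVT_max R (fun t => nc (f (r%:C * cis t) - f 0)) 0 (pi *+ 2)
      (ltW (@twopi_gt0 R)) _.
      apply: continuous_subspaceT => t; exact: ccvg_nc (ccontB cf (ccont_cst (f 0)) t).
    have : nc (mean (fun t => f (r%:C * cis t) - f 0)) <= nc (f (r%:C * cis t) - f 0).
      apply: mean_bound; first by apply: ccontB => //; exact: ccont_cst.
      by move=> u uT; apply: ht; rewrite in_itv.
    rewrite meanB ?mean_cst//; last exact: ccont_cst.
    rewrite h0 ncBC leNgt => /negP; apply; apply: hd.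
    by rewrite subr0 nc_rcis ger0_norm// ltW.
  apply/(ccvg_shift _ _ 1); apply: (ccvg_eq (u := fun=> a 0%N)); last exact: ccvg_cst.
  move=> n; rewrite addn1 /psum big_ord_recl /= expr0 mulr1 big1 ?addr0// => i _.
  by rewrite w0 expr0n /= mulr0.
have nw0 : 0 < nc w by rewrite nc_gt0.
pose e := w / (nc w)%:C; have nC0 : (nc w)%:C != 0 by rewrite realC_eq0 gt_eqF.
have e1 : nc e = 1 by rewrite ncM ncV nc_real ger0_norm ?ltW// divff// gt_eqF.
have we : w = (nc w)%:C * e by rewrite /e mulrC divfK.
have nw : 0 < nc w < 1 by rewrite nw0.
have [l hl] : exists l, ccvg \oo (psum a w) l.
  pose s := (1 + nc w) / 2; have s01 : 0 < s < 1 by rewrite /s; lra.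
  have [K K0 hK] := circle_coef_bound hf fa s01.
  have y01 : 0 <= nc w / s < 1.
    by rewrite divr_ge0 ?nc_ge0//=; [rewrite ltr_pdivrMr; rewrite /s; lra|lra].
  apply: (@abs_ccvg _ (fun i => a i * w ^+ i) (K * (1 - nc w / s)^-1)) => n.
  apply: le_trans (ler_wpM2l K0 (geom_sum_le n y01)).
  rewrite mulr_sumr; apply: ler_sum => i _; rewrite ncM ncX expr_div_n.
  have si : 0 < s ^+ i by rewrite exprn_gt0//; lra.
  by rewrite mulrA ler_pdivlMr// mulrAC ler_wpM2r ?exprn_ge0 ?nc_ge0.
suff -> : f w = l by [].
have ces : ccvg \oo (fun n => n.+1%:R^-1 * \sum_(m < n.+1) psum a w m.+1) l.
  have [hr hi] : ccvg \oo (fun n => psum a w n.+1) l.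
    by move/(ccvg_shift (psum a w) l 1) : hl; under eq_fun do rewrite addn1.
  have nR n : (n.+1%:R^-1 : C) = (n.+1%:R^-1)%:C by rewrite fmorphV rmorph_nat.
  split.
    move/cesaro : hr; rewrite (_ : arithmetic_mean _ =
      (fun n => Re (n.+1%:R^-1 * \sum_(m < n.+1) psum a w m.+1)))//.
    apply/funext => n.
    by rewrite /arithmetic_mean /= nR ReM /= mul0r subr0 Re_sum seriesEnat /= big_mkord.
  move/cesaro : hi; rewrite (_ : arithmetic_mean _ =
    (fun n => Im (n.+1%:R^-1 * \sum_(m < n.+1) psum a w m.+1)))//.
  apply/funext => n.
  by rewrite /arithmetic_mean /= nR ImM /= mul0r addr0 Im_sum seriesEnat /= big_mkord.
apply: (@ccvg_unique _ _ \oo _ _ _ _ _ ces); apply/ccvgP => eps eps0.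
have [N0 hN] := fejer_limit hf fa nw e1 eps0; exists N0 => // n; rewrite -we in hN.
exact: hN.
Qed.

Lemma holomorphic_taylor f : holomorphic f -> pser (taylor f) f.
Proof.
move=> hf; have [a fa] := circle_coef_ex hf; have af := circle_coef_pser hf fa.
by rewrite (pser_taylor af).
Qed.

Lemma taylor_circle f : holomorphic f -> circle_coef f (taylor f).
Proof.
move=> hf; have [a fa] := circle_coef_ex hf; have af := circle_coef_pser hf fa.
by rewrite (pser_taylor af).
Qed.

End Fejer.

(** * The Hardy space *)

Section HardySpace.
Variable R : realType.
Local Notation C := R[i].
Local Notation cis := (@cis R).
Implicit Types (f g h p x : C -> C) (a b : nat -> C) (r : R).

Definition trigpoly b N t : C := \sum_(n < N) b n * cis t ^+ n.

Lemma ccont_trigpoly b N : ccont (trigpoly b N).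
Proof.
apply: ccont_sum => n _; apply: ccontM; [exact: ccont_cst|exact: ccont_cisX].
Qed.

Lemma mean_trigpolyJ (g : R -> C) b N : ccont g ->
  mean (fun t => g t * (trigpoly b N t)^*) =
  \sum_(n < N) (b n)^* * mean (fun t => g t * (cis t)^* ^+ n).
Proof.
move=> cg.
have c1 n : ccont (fun t => g t * (cis t)^* ^+ n).
  by apply: ccontM => //; exact: ccont_cisJX.
have c2 n : ccont (fun t => (b n)^* * (g t * (cis t)^* ^+ n)).
  by apply: ccontM => //; exact: ccont_cst.
transitivity (mean (fun t => \sum_(n < N) (b n)^* * (g t * (cis t)^* ^+ n))).
  congr mean; apply/funext => t; rewrite /trigpoly conj_sum mulr_sumr.
  by apply: eq_bigr => n _; rewrite conjM conjX mulrCA.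
by rewrite mean_sum//; apply: eq_bigr => n _; rewrite (meanM _ (c1 n)).
Qed.

Lemma mean_trigpoly b N (k : nat) : mean (fun t => trigpoly b N t * (cis t)^* ^+ k) =
  if (k < N)%N then b k else 0.
Proof.
have c1 n : ccont (fun t => cis t ^+ n * (cis t)^* ^+ k) by exact: ccont_cisM.
have c2 (n : nat) : ccont (fun t => b n * (cis t ^+ n * (cis t)^* ^+ k)).
  by apply: ccontM => //; exact: ccont_cst.
transitivity (mean (fun t => \sum_(n < N) b n * (cis t ^+ n * (cis t)^* ^+ k))).
  congr mean; apply/funext => t; rewrite /trigpoly mulr_suml.
  by apply: eq_bigr => n _; rewrite mulrA.
rewrite mean_sum//.
transitivity (\sum_(n < N) (if (n : nat) == k then b n else 0)).
  apply: eq_bigr => n _; rewrite (meanM _ (c1 n)) mean_cisM.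
  by case: eqP => _; rewrite ?mulr1 ?mulr0.
rewrite -big_mkcond /=; case: ltnP => kN.
  by rewrite (big_pred1 (Ordinal kN)).
by rewrite big1// => n /eqP nk; move: (ltn_ord n); rewrite nk ltnNge kN.
Qed.

Lemma mean_trigpoly_sqr b N :
  mean (fun t => trigpoly b N t * (trigpoly b N t)^*) = (\sum_(n < N) nc (b n) ^+ 2)%:C.
Proof.
rewrite mean_trigpolyJ; last exact: ccont_trigpoly.
rewrite rmorph_sum; apply: eq_bigr => n _.
by rewrite mean_trigpoly ltn_ord mulrC mulcJ.
Qed.

(** Expand the nonnegative mean of |g - q|^2, where q is the trigonometric polynomial with
    coefficients [b]. *)
Lemma bessel (g : R -> C) b N : ccont g ->
  (forall n, (n < N)%N -> mean (fun t => g t * (cis t)^* ^+ n) = b n) ->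
  \sum_(n < N) nc (b n) ^+ 2 <= Re (mean (fun t => g t * (g t)^*)).
Proof.
move=> cg hb; pose q := trigpoly b N; have cq : ccont q by exact: ccont_trigpoly.
set S := \sum_(n < N) _.
have m1 : mean (fun t => g t * (q t)^*) = S%:C.
  rewrite mean_trigpolyJ// rmorph_sum; apply: eq_bigr => n _.
  by rewrite hb// mulrC mulcJ.
have m2 : mean (fun t => q t * (g t)^*) = S%:C.
  transitivity ((mean (fun t => g t * (q t)^*))^*); last by rewrite m1; exact: conjc_real.
  rewrite -meanJ; last by apply: ccontM => //; exact: ccontJ.
  by congr mean; apply/funext => t; rewrite conjM conjK mulrC.
have m3 : mean (fun t => q t * (q t)^*) = S%:C by exact: mean_trigpoly_sqr.
have c1 : ccont (fun t => g t * (q t)^*) by apply: ccontM => //; exact: ccontJ.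
have c2 : ccont (fun t => q t * (g t)^*) by apply: ccontM => //; exact: ccontJ.
have c3 : ccont (fun t => q t * (q t)^*) by apply: ccontM => //; exact: ccontJ.
have c4 : ccont (fun t => g t * (g t)^*) by apply: ccontM => //; exact: ccontJ.
have m4 : mean (fun t => (g t - q t) * (g t - q t)^*) = mean (fun t => g t * (g t)^*) - S%:C.
  transitivity (mean (fun t => (g t * (g t)^* - g t * (q t)^*) -
      (q t * (g t)^* - q t * (q t)^*))).
    by congr mean; apply/funext => t; rewrite conjB; ring.
  rewrite meanB; try exact: ccontB.
  by rewrite !meanB// m1 m2 m3 subrr subr0.
have c5 : ccont (fun t => (g t - q t) * (g t - q t)^*).
  by apply: ccontM; [exact: ccontB|apply/ccontJ/ccontB].
have : nc (mean (fun=> 0 : C)) <= Re (mean (fun t => (g t - q t) * (g t - q t)^*)).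
  apply: mean_le => //; first exact: ccont_cst.
  by move=> t _; rewrite nc0 mulcJ /= sqr_ge0.
by rewrite mean_cst nc0 m4 ReD ReN /= subr_ge0.
Qed.

Definition l2 a := exists K : R, forall n, \sum_(i < n) nc (a i) ^+ 2 <= K.
Definition sqnorm a : R := limn (series (fun n => nc (a n) ^+ 2)).

Lemma sum_sqr_homo a : {homo (fun n => \sum_(i < n) nc (a i) ^+ 2) : m n / (m <= n)%N >-> m <= n}.
Proof.
move=> m n mn; rewrite -(big_mkord xpredT (fun i => nc (a i) ^+ 2)).
rewrite -(big_mkord xpredT (fun i => nc (a i) ^+ 2)) (big_cat_nat (leq0n m) mn)/=.
by rewrite lerDl sumr_ge0// => i _; exact: sqr_ge0.
Qed.

Lemma seriesE a : series (fun n => nc (a n) ^+ 2) = (fun n => \sum_(i < n) nc (a i) ^+ 2).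
Proof. by apply/funext => n; rewrite seriesEnat /= big_mkord. Qed.

Lemma l2_cvg a : l2 a <-> cvgn (series (fun n => nc (a n) ^+ 2)).
Proof.
rewrite seriesE; split=> [[K hK]|h].
  apply: nondecreasing_is_cvgn; first exact: sum_sqr_homo.
  by exists K => _ [n _ <-].
exists (limn (fun n => \sum_(i < n) nc (a i) ^+ 2)) => n.
by apply: nondecreasing_cvgn_le => //; exact: sum_sqr_homo.
Qed.

Lemma sqnorm_ge a n : l2 a -> \sum_(i < n) nc (a i) ^+ 2 <= sqnorm a.
Proof.
move=> /l2_cvg; rewrite /sqnorm seriesE => h.
by apply: nondecreasing_cvgn_le => //; exact: sum_sqr_homo.
Qed.

Lemma sqnorm_ge0 a : l2 a -> 0 <= sqnorm a.
Proof. by move=> /(@sqnorm_ge _ 0); rewrite big_ord0. Qed.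

Lemma sqnorm_le a (K : R) : (forall n, \sum_(i < n) nc (a i) ^+ 2 <= K) -> sqnorm a <= K.
Proof.
move=> hK; have /l2_cvg : l2 a by exists K.
by rewrite /sqnorm seriesE => h; apply: limr_le => //; exact: nearW.
Qed.

Lemma H2E h : H2 h <-> holomorphic h /\ l2 (taylor h).
Proof. by split=> -[? /l2_cvg]. Qed.

Lemma h2normE h : h2norm h = Num.sqrt (sqnorm (taylor h)). Proof. by []. Qed.

Lemma sqr_h2norm h : H2 h -> h2norm h ^+ 2 = sqnorm (taylor h).
Proof. by move=> /H2E[_ /sqnorm_ge0 h0]; rewrite h2normE sqr_sqrtr. Qed.

Lemma h2norm_ge0 h : 0 <= h2norm h. Proof. exact: sqrtr_ge0. Qed.

Lemma h2norm_le h (K : R) : 0 <= K -> H2 h -> sqnorm (taylor h) <= K ^+ 2 -> h2norm h <= K.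
Proof.
by move=> K0 hh; rewrite -sqr_h2norm// ler_pXn2r ?nnegrE// ?h2norm_ge0.
Qed.

Definition dots a b n := \sum_(i < n) a i * (b i)^*.

(** Cauchy-Schwarz in weighted arithmetic-geometric form: it involves squared norms only and passes
    to limits, and the weight is chosen at the point of use. *)
Lemma dots_amgm a b n (s : R) : 0 < s -> 2 * nc (dots a b n) <=
  s * \sum_(i < n) nc (a i) ^+ 2 + s^-1 * \sum_(i < n) nc (b i) ^+ 2.
Proof.
move=> s0; rewrite !mulr_sumr -big_split /=.
apply: (@le_trans _ _ (2 * \sum_(i < n) nc (a i * (b i)^*))).
  by rewrite ler_wpM2l// nc_sum.
rewrite mulr_sumr; apply: ler_sum => i _; rewrite ncM nc_conj.
have := sqr_ge0 (s * nc (a i) - nc (b i)).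
have -> : s * nc (a i) ^+ 2 + s^-1 * nc (b i) ^+ 2 =
   s^-1 * ((s * nc (a i) - nc (b i)) ^+ 2) + 2 * (nc (a i) * nc (b i)).
  by field; rewrite gt_eqF.
by rewrite lerDr => h; rewrite mulr_ge0// invr_ge0 ltW.
Qed.

Lemma dots_cvg a b : l2 a -> l2 b -> exists l, ccvg \oo (dots a b) l.
Proof.
move=> [K hK] [L hL].
apply: (@abs_ccvg _ (fun i => a i * (b i)^*) (K + L)) => n.
apply: (@le_trans _ _ (\sum_(i < n) (nc (a i) ^+ 2 + nc (b i) ^+ 2))).
  apply: ler_sum => i _; rewrite ncM nc_conj.
  by have := sqr_ge0 (nc (a i) - nc (b i)); have := sqr_ge0 (nc (a i)); have := sqr_ge0 (nc (b i)); nra.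
by rewrite big_split /=; apply: lerD; [exact: hK|exact: hL].
Qed.

Lemma h2dot_lim g h l : ccvg \oo (dots (taylor g) (taylor h)) l -> h2dot g h = l.
Proof.
move=> /ccvgE; rewrite /h2dot => H.
apply: (cvg_lim (@norm_hausdorff _ C^o)).
rewrite (_ : series _ = dots (taylor g) (taylor h))//.
by apply/funext => n; rewrite seriesEnat /= big_mkord.
Qed.

Lemma h2dot_cvg g h : H2 g -> H2 h -> ccvg \oo (dots (taylor g) (taylor h)) (h2dot g h).
Proof.
move=> /H2E[_ hg] /H2E[_ hh]; have [l hl] := dots_cvg hg hh.
by rewrite (h2dot_lim hl).
Qed.

Lemma h2dotJ g h : H2 g -> H2 h -> h2dot g h = (h2dot h g)^*.
Proof.
move=> hg hh; apply: h2dot_lim; have := @ccvgJ _ _ \oo eventually_filter _ _ (h2dot_cvg hh hg).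
apply: ccvg_eq => n; rewrite /dots conj_sum; apply: eq_bigr => i _.
by rewrite conjM conjK mulrC.
Qed.

Lemma h2dot_self h : H2 h -> h2dot h h = (h2norm h ^+ 2)%:C.
Proof.
move=> hh; rewrite sqr_h2norm//; apply: h2dot_lim.
have /H2E[_ /l2_cvg] := hh; rewrite seriesE => hc.
have E n : dots (taylor h) (taylor h) n = (\sum_(i < n) nc (taylor h i) ^+ 2)%:C.
  by rewrite rmorph_sum; apply: eq_bigr => i _; rewrite mulcJ.
split=> /=; last first.
  by under eq_fun do rewrite E /=; exact: cvg_cst.
under eq_fun do rewrite E /=.
by rewrite /sqnorm seriesE.
Qed.

Lemma h2dot_amgm g h (s : R) : H2 g -> H2 h -> 0 < s ->
  2 * nc (h2dot g h) <= s * h2norm g ^+ 2 + s^-1 * h2norm h ^+ 2.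
Proof.
move=> hg hh s0; rewrite mulrC -ler_pdivlMr//.
apply: ccvg_le_nc (h2dot_cvg hg hh) _ => n; rewrite ler_pdivlMr// mulrC.
apply: le_trans (dots_amgm _ _ n s0) _.
have /H2E[_ lg] := hg; have /H2E[_ lh] := hh.
by rewrite !sqr_h2norm// lerD// ler_wpM2l ?invr_ge0 ?(ltW s0)// sqnorm_ge.
Qed.

(** One half of Parseval's identity on a smaller circle. There the truncations of x converge
    uniformly, and their mean squares are known exactly. *)
Lemma mean_circle_sqr_le x r : H2 x -> 0 < r < 1 ->
  Re (mean (fun t => x (r%:C * cis t) * (x (r%:C * cis t))^*)) <= sqnorm (taylor x).
Proof.
move=> /H2E[hx lx] r01; have r01' : 0 <= r < 1 by lra.
have cx := ccont_circle hx r01'; set A := (X in X <= _).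
have [[M y] /= [M0 y01] hM] := pser_tail (holomorphic_taylor hx) r01'.
have [X X0 hX] := ccont_bounded cx.
pose g t := x (r%:C * cis t).
pose q N := trigpoly (fun n => taylor x n * r%:C ^+ n) N.
have hq N t : nc (g t - q N t) <= M * y ^+ N.
  have -> : q N t = psum (taylor x) (r%:C * cis t) N.
    by apply: eq_bigr => n _; rewrite exprMn mulrA.
  by apply: hM; rewrite nc_rcis ger0_norm//; lra.
(* With tau = M y^N one has |g| - |q| <= tau and |g| + |q| <= 2 X + tau; the product bounds |g|^2 -
   |q|^2. *)
have main N : A <= sqnorm (taylor x) + M * y ^+ N * (2 * X + M * y ^+ N).
  have tau0 : 0 <= M * y ^+ N by rewrite mulr_ge0 ?exprn_ge0//; lra.
  have cq : ccont (q N) by exact: ccont_trigpoly.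
  have c1 : ccont (fun t => q N t * (q N t)^*) by apply: ccontM => //; exact: ccontJ.
  have c2 : ccont (fun t => g t * (g t)^*) by apply: ccontM => //; exact: ccontJ.
  set d := M * y ^+ N * _.
  have : nc (mean (fun t => g t * (g t)^*)) <= Re (mean (fun t => q N t * (q N t)^* + d%:C)).
    apply: mean_le => //; first by apply: ccontD => //; exact: ccont_cst.
    move=> t tT; rewrite mulcJ nc_real ger0_norm ?sqr_ge0// ReD mulcJ /= /d.
    have h1 := hq N t; have h2 := nc_dist (g t) (q N t); have h3 := hX t tT.
    have h4 := nc_ge0 (g t); have h5 := nc_ge0 (q N t).
    move: h2; rewrite ler_norml => /andP[h6 h7].
    have h8 : nc (g t) - nc (q N t) <= M * y ^+ N by lra.
    have h9 : nc (q N t) - nc (g t) <= M * y ^+ N by lra.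
    rewrite -/(g t) in h3; move: (M * y ^+ N) tau0 h8 h9 => tau; clear -h3 h4 h5; nra.
  rewrite meanD//; last exact: ccont_cst.
  rewrite mean_trigpoly_sqr mean_cst => h.
  rewrite /A; apply: (le_trans (Re_le_nc _)); apply: (le_trans h); rewrite -rmorphD /= lerD2r.
  apply: le_trans (sqnorm_ge N lx); apply: ler_sum => i _.
  rewrite ncM exprMn ncX nc_real ger0_norm ?ler_piMr ?sqr_ge0//; last by lra.
  by rewrite -exprM exprn_ile1//; lra.
rewrite leNgt; apply/negP => lt.
set e := A - sqnorm (taylor x); have e0 : 0 < e by rewrite subr_gt0.
have D0 : 0 < M * (2 * X + M) + 1 by rewrite ltr_wpDl// mulr_ge0// addr_ge0// mulr_ge0.
have y1 : `|y| < 1 by rewrite ger0_norm; lra.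
have /cvgrPdist_lt/(_ _ (divr_gt0 e0 D0))[N _ /(_ N (leqnn N))] := cvg_expr y1.
rewrite sub0r normrN ltr_pdivlMr// => h.
have := main N; have yN : 0 <= y ^+ N by rewrite exprn_ge0//; lra.
have yN1 : y ^+ N <= 1 by rewrite exprn_ile1//; lra.
rewrite ger0_norm// in h; rewrite /e in h.
have : M * y ^+ N * (2 * X + M * y ^+ N) <= y ^+ N * (M * (2 * X + M)).
  rewrite (mulrC M) -!mulrA ler_wpM2l// ler_wpM2l// lerD2l.
  by rewrite ler_piMl.
nra.
Qed.

(** On a circle of radius r < 1 the bound |p x| <= M |x| holds pointwise. [bessel] bounds the
    coefficients of p x by its mean square, [mean_circle_sqr_le] bounds the mean square of x, and r
    tends to 1 with the number of coefficients fixed. *)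
Lemma multiplier p x (M : R) : holomorphic p -> 0 <= M ->
  (forall z, disk z -> nc (p z) <= M) -> H2 x ->
  H2 (fun z => p z * x z) /\ h2norm (fun z => p z * x z) <= M * h2norm x.
Proof.
move=> hp M0 hM H2x; have /H2E[hx lx] := H2x.
pose q z := p z * x z.
have hq : holomorphic q.
  by move=> z zd; apply: (@derivableM _ _ (p : C^o -> C^o)); [exact: hp|exact: hx].
have s0 := sqnorm_ge0 lx.
have key r N : 0 < r < 1 -> \sum_(n < N) nc (taylor q n * r%:C ^+ n) ^+ 2 <= M ^+ 2 * sqnorm (taylor x).
  move=> r01; have r01' : 0 <= r < 1 by lra.
  have cq := ccont_circle hq r01'; have cx := ccont_circle hx r01'.
  have dz t : disk (r%:C * cis t) by apply/diskE; rewrite nc_rcis ger0_norm; lra.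
  apply: le_trans (bessel cq (fun n _ => taylor_circle hq r01 n)) _.
  apply: (@le_trans _ _ (Re (mean (fun t => (M ^+ 2)%:C * (x (r%:C * cis t) * (x (r%:C * cis t))^*))))).
    have cxx : ccont (fun t => x (r%:C * cis t) * (x (r%:C * cis t))^*).
      by apply: ccontM => //; exact: ccontJ.
    apply: le_trans (Re_le_nc _) _; apply: mean_le.
    - by apply: ccontM => //; exact: ccontJ.
    - by apply: ccontM => //; exact: ccont_cst.
    move=> t _; rewrite !mulcJ -rmorphM nc_real ger0_norm ?sqr_ge0//= ncM exprMn.
    by rewrite ler_wpM2r ?sqr_ge0// lerXn2r ?nnegrE ?nc_ge0// hM.
  rewrite meanM; last by apply: ccontM => //; exact: ccontJ.
  by rewrite Re_realM ler_wpM2l ?sqr_ge0// mean_circle_sqr_le.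
have bd N : \sum_(n < N) nc (taylor q n) ^+ 2 <= M ^+ 2 * sqnorm (taylor x).
  set S := \sum_(n < N) _; set B := _ * _.
  have S0 : 0 <= S by apply: sumr_ge0 => i _; exact: sqr_ge0.
  rewrite leNgt; apply/negP => lt.
  have sS : forall r, 0 < r < 1 -> (r ^+ 2) ^+ N * S <= B.
    move=> r r01; apply: le_trans (key r N r01); rewrite mulr_sumr; apply: ler_sum => i _.
    rewrite ncM [X in _ <= X]exprMn [X in X <= _]mulrC ler_wpM2l ?sqr_ge0// ncX nc_real ger0_norm; last lra.
    have -> : (r ^+ i) ^+ 2 = (r ^+ 2) ^+ i by rewrite -!exprM mulnC.
    rewrite ler_wiXn2l ?sqr_ge0 ?(ltnW (ltn_ord i))//.
    by rewrite exprn_ile1//; lra.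
  have Sp : 0 < S by apply: le_lt_trans lt; rewrite mulr_ge0 ?sqr_ge0.
  have D0 : 0 < 2 * N.+1%:R * S by rewrite !mulr_gt0// ltr0n.
  (* For r = 1 - e, Bernoulli's inequality gives (1 - 2 N e) S <= B, while this e satisfies 2 (N +
     1) e S <= S - B; the extra 1 makes the contradiction strict. *)
  pose e := Num.min 2^-1 ((S - B) / (2 * N.+1%:R * S)).
  have e0 : 0 < e by rewrite lt_min invr_gt0 ltr0n divr_gt0 ?subr_gt0.
  have e1 : e <= 2^-1 by rewrite ge_min lexx.
  have e2 : e * (2 * N.+1%:R * S) <= S - B by rewrite -ler_pdivlMr// ge_min lexx orbT.
  have he : (2^-1 : R) = 1 / 2 by rewrite mul1r.
  have := sS (1 - e); rewrite -exprM => /(_ _)h; have {h} : (1 - e) ^+ (2 * N) * S <= B by apply: h; lra.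
  have bern n : 1 - n%:R * e <= (1 - e) ^+ n.
    elim: n => [|n IH]; first by rewrite mul0r subr0 expr0.
    rewrite exprS -[n.+1%:R]/((1 + n)%:R) natrD.
    have : (1 - e) * (1 - n%:R * e) <= (1 - e) * (1 - e) ^+ n by rewrite ler_wpM2l//; lra.
    have : 0 <= n%:R * e * e by rewrite !mulr_ge0// ltW.
    lra.
  have := ler_wpM2r S0 (bern (2 * N)%N); rewrite natrM.
  have : 0 < e * S by rewrite mulr_gt0.
  rewrite -[N.+1%:R]/((1 + N)%:R) natrD in e2; lra.
have Hq : H2 q by apply/H2E; split => //; exists (M ^+ 2 * sqnorm (taylor x)).
split=> //; apply: h2norm_le; rewrite ?mulr_ge0 ?h2norm_ge0//.
by rewrite exprMn sqr_h2norm//; exact: sqnorm_le.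
Qed.

End HardySpace.

(** * The minimax theorem for Hermitian forms *)

Section UltraLimits.
Variable R : realType.
Local Notation C := R[i].
Context {U : set_system nat} {UU : UltraFilter U}.

#[local] Instance U_proper : ProperFilter U := ultra_proper.

(** Along one ultrafilter all bounded sequences converge simultaneously, so the compactness
    arguments below extract no subsequences. *)
Lemma ultra_bounded_cvg (u : nat -> R) (M : R) : (forall n, `|u n| <= M) ->
  exists l : R, u @ U --> l.
Proof.
move=> uM; have PF : ProperFilter (u @ U) by exact: fmap_proper_filter.
have [|x [_ hx]] := @segment_compact R (- M) M (u @ U) PF.
  have : U (u @^-1` `[- M, M]) by apply: filterE => n /=; rewrite in_itv /= -ler_norml uM.
  exact.
exists x => A nA; have [//|hc] := in_ultra_setVsetC (u @^-1` A) UU.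
have [y [Ay nAy]] : (~` A `&` A) !=set0 by exact: (hx (~` A) A hc nA).
by case: Ay.
Qed.

Lemma ultra_bounded_ccvg (u : nat -> C) (M : R) : (forall n, nc (u n) <= M) ->
  exists l, ccvg U u l.
Proof.
move=> uM.
have [x hx] := ultra_bounded_cvg (fun n => le_trans (nc_Re (u n)) (uM n)).
have [y hy] := ultra_bounded_cvg (fun n => le_trans (nc_Im (u n)) (uM n)).
by exists (x +i* y).
Qed.

Lemma ccvg_ge_Re (u : nat -> C) l (a : R) : ccvg U u l -> (forall n, a <= Re (u n)) -> a <= Re l.
Proof. by move=> [h _] ha; apply: (cvgr_to_ge h); exact: nearW. Qed.

Lemma ccvg_le_Re (u : nat -> C) l (a : R) : ccvg U u l -> (forall n, Re (u n) <= a) -> Re l <= a.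
Proof. by move=> [h _] ha; apply: (cvgr_to_le h); exact: nearW. Qed.

Lemma ccvg_inv (hU : \oo `<=` U) : ccvg U (fun n => (n.+1%:R^-1)%:C) (0 : C).
Proof.
apply/ccvgP => e e0; apply: hU; exists (Num.bound e^-1) => // n hn.
rewrite subr0 nc_real ger0_norm ?invr_ge0// invf_plt ?posrE//.
apply: lt_le_trans (archi_boundP _) _; first by rewrite invr_ge0 ltW.
by rewrite ler_nat (leq_trans hn).
Qed.

End UltraLimits.

Section QuadraticForms.
Variables (R : realType) (I : finType).
Local Notation C := R[i].
Implicit Types (M S : I -> I -> C) (v w : I -> C).

Definition qf M v : C := \sum_i \sum_j M i j * v i * (v j)^*.
Definition bf M v w : C := \sum_i \sum_j M i j * v i * (w j)^*.
Definition sq v : R := \sum_i nc (v i) ^+ 2.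

Lemma qfE M v : qf M v = bf M v v. Proof. by []. Qed.

Lemma bfDl M u v w c : bf M (fun i => u i + c * v i) w = bf M u w + c * bf M v w.
Proof.
rewrite /bf mulr_sumr -big_split; apply: eq_bigr => i _ /=.
by rewrite mulr_sumr -big_split; apply: eq_bigr => j _ /=; ring.
Qed.

Lemma bfDr M u v w c : bf M w (fun i => u i + c * v i) = bf M w u + c^* * bf M w v.
Proof.
rewrite /bf mulr_sumr -big_split; apply: eq_bigr => i _ /=.
rewrite mulr_sumr -big_split; apply: eq_bigr => j _ /=; rewrite conjD conjM; ring.
Qed.

Lemma qfD M v w c : qf M (fun i => v i + c * w i) =
  qf M v + c^* * bf M v w + c * bf M w v + c * c^* * qf M w.
Proof. by rewrite !qfE bfDl !bfDr; ring. Qed.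

Lemma qfZ M v c : qf M (fun i => c * v i) = c * c^* * qf M v.
Proof.
rewrite /qf mulr_sumr; apply: eq_bigr => i _; rewrite mulr_sumr.
by apply: eq_bigr => j _; rewrite conjM; ring.
Qed.

Lemma qf_addm M S v c : qf (fun i j => M i j + c * S i j) v = qf M v + c * qf S v.
Proof.
rewrite /qf mulr_sumr -big_split; apply: eq_bigr => i _ /=.
by rewrite mulr_sumr -big_split; apply: eq_bigr => j _ /=; ring.
Qed.

Lemma sqE v : (sq v)%:C = qf (fun i j => (i == j)%:R) v.
Proof.
rewrite rmorph_sum; apply: eq_bigr => i _.
rewrite (bigD1 i)//= big1 ?addr0; first by rewrite eqxx mul1r -mulcJ.
by move=> j ji; rewrite eq_sym (negbTE ji) !mul0r.
Qed.

Lemma sq_ge0 v : 0 <= sq v. Proof. by apply: sumr_ge0 => i _; exact: sqr_ge0. Qed.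

Lemma sqZ v c : sq (fun i => c * v i) = nc c ^+ 2 * sq v.
Proof. by rewrite mulr_sumr; apply: eq_bigr => i _; rewrite ncM exprMn. Qed.

Lemma nc_le_sq v i : nc (v i) ^+ 2 <= sq v.
Proof.
rewrite /sq (bigD1 i)//= lerDl; apply: sumr_ge0 => j _; exact: sqr_ge0.
Qed.

Lemma sq0 v : sq v = 0 -> v = fun=> 0.
Proof.
move=> h; apply/funext => i; apply/eqP; rewrite -nc_eq0 -sqrf_eq0 eq_le sqr_ge0 andbT.
by rewrite -h nc_le_sq.
Qed.

Lemma qf0 M : qf M (fun=> 0) = 0.
Proof. by rewrite /qf big1// => i _; rewrite big1// => j _; rewrite mulr0 mul0r. Qed.

Lemma qf_bounded M : exists2 K : R, 0 <= K & forall v, nc (qf M v) <= K * sq v.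
Proof.
exists (\sum_i \sum_j nc (M i j)).
  by apply: sumr_ge0 => i _; apply: sumr_ge0 => j _; exact: nc_ge0.
move=> v; apply: le_trans (nc_sum _ _ _) _; rewrite mulr_suml; apply: ler_sum => i _.
apply: le_trans (nc_sum _ _ _) _; rewrite mulr_suml; apply: ler_sum => j _.
rewrite !ncM nc_conj -mulrA ler_wpM2l ?nc_ge0//.
have := nc_le_sq v i; have := nc_le_sq v j; have := sqr_ge0 (nc (v i) - nc (v j)); nra.
Qed.

Lemma ccvg_qf (U : set_system nat) (PU : ProperFilter U) M (V : nat -> I -> C) v :
  (forall i, ccvg U (fun n => V n i) (v i)) -> ccvg U (fun n => qf M (V n)) (qf M v).
Proof.
move=> h; apply: ccvg_sum => i _; apply: ccvg_sum => j _.
by apply: ccvgM; [apply: ccvgM => //; exact: ccvg_cst|exact: ccvgJ].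
Qed.

Lemma unit_compact (U : set_system nat) (UU : UltraFilter U) (V : nat -> I -> C) :
  (forall n, sq (V n) = 1) ->
  exists2 v, sq v = 1 & forall i, ccvg U (fun n => V n i) (v i).
Proof.
move=> h.
have H i : exists l, ccvg U (fun n => V n i) l.
  apply: (ultra_bounded_ccvg (M := 1)) => n.
  rewrite -(@ler_pXn2r _ 2)// ?nnegrE ?nc_ge0// expr1n -(h n); exact: nc_le_sq.
have [v hv] : exists v : I -> C, forall i, ccvg U (fun n => V n i) (v i).
  by exists (fun i => sval (cid (H i))) => i; exact: (svalP (cid (H i))).
exists v => //; have PU : ProperFilter U by exact: ultra_proper.
apply: (@complexI R); apply: (@ccvg_unique _ _ U PU (fun n => (sq (V n))%:C)).
  rewrite sqE; have := ccvg_qf PU (fun i j => (i == j)%:R) hv.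
  by apply: ccvg_eq => n; rewrite sqE.
by apply: (ccvg_eq (u := fun=> 1)); [move=> n; rewrite h|exact: ccvg_cst].
Qed.

End QuadraticForms.

(** * The convexity step for values on top eigenvectors *)

Section ToeplitzHausdorff.
Variables (R : realType) (I : finType).
Local Notation C := R[i].
Implicit Types (M L : I -> I -> C) (v w : I -> C).

(** The left side is the squared modulus of a w1 + e^2 n w2 with P = |w1|^2, W = |w2|^2 and q =
    Re(conj(w1) w2), as in [toeplitz_hausdorff_step]. The sign of e makes e s <= 0, so a <= N - t
    with t = e^2 n. This gains 2 P t N, which is of first order in t, against terms of order t^2. *)
Lemma perturbation_size (P W n x s q : R) : 0 < P -> 0 <= W -> 0 < n -> q <= 0 ->
  exists e : R, let N := 1 + 2 * e * x + e ^+ 2 * n in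
    let a := N + e * s - e ^+ 2 * n in
    0 <= N /\ P * a ^+ 2 + 2 * a * (e ^+ 2 * n) * q + (e ^+ 2 * n) ^+ 2 * W < P * N ^+ 2.
Proof.
move=> P0 W0 n0 q0.
wlog s0 : x s / s <= 0.
  move=> H; have [s0|s0] := leP s 0; first exact: H.
  have [|e hb] := H (- x) (- s); first lra.
  by exists (- e); move: hb; cbv zeta; rewrite sqrrN !mulrN !mulNr.
(* With e = 1 / D each of e, e |x|, e |s|, e n and e n W / P is at most 1/4. *)
pose D := 4 + 4 * `|x| + 4 * `|s| + 4 * n + 4 * (n * W / P).
have nWP : 0 <= n * W / P by rewrite divr_ge0 ?mulr_ge0// ltW.
have ax := normr_ge0 x; have as0 := normr_ge0 s.
have D4 : 4 <= D by rewrite /D; lra.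
have D0 : 0 < D by lra.
pose e := D^-1; have e0 : 0 < e by rewrite invr_gt0.
have eD : e * D = 1 by rewrite mulVf// gt_eqF.
have b1 : e <= 4^-1.
  have : e * 4 <= e * D by rewrite ler_wpM2l// ltW.
  lra.
have b2 : e * `|x| <= 4^-1.
  have : e * (4 * `|x|) <= e * D by rewrite ler_wpM2l ?(ltW e0)// /D; lra.
  lra.
have b3 : e * `|s| <= 4^-1.
  have : e * (4 * `|s|) <= e * D by rewrite ler_wpM2l ?(ltW e0)// /D; lra.
  lra.
have b4 : e * n <= 4^-1.
  have : e * (4 * n) <= e * D by rewrite ler_wpM2l ?(ltW e0)// /D; lra.
  lra.
have b5 : e * (n * W) <= 4^-1 * P.
  have : e * (4 * (n * W / P)) <= e * D by rewrite ler_wpM2l ?(ltW e0)// /D; lra.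
  rewrite eD => h; have := ler_wpM2r (ltW P0) h.
  have -> : e * (4 * (n * W / P)) * P = 4 * (e * (n * W)) by field; rewrite gt_eqF.
  lra.
exists e; cbv zeta; set t := e ^+ 2 * n; rewrite -mulrA; set N := 1 + 2 * (e * x) + t.
have t0 : 0 < t by rewrite mulr_gt0 ?exprn_gt0.
have tb : t <= 16^-1.
  rewrite /t expr2 -mulrA; have -> : (16^-1 : R) = 4^-1 * 4^-1 by field.
  by apply: ler_pM => //; rewrite ?mulr_ge0 ?(ltW e0)// ltW.
have tW : t * W <= 16^-1 * P.
  have -> : t * W = e * (e * (n * W)) by rewrite /t; ring.
  have -> : (16^-1 : R) * P = 4^-1 * (4^-1 * P) by field.
  by apply: ler_pM => //; rewrite ?mulr_ge0 ?(ltW e0)// ltW.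
have ex : - 4^-1 <= e * x.
  have : e * (- `|x|) <= e * x by rewrite ler_wpM2l ?(ltW e0)// lerNl -normrN ler_norm.
  lra.
have es : - 4^-1 <= e * s.
  have : e * (- `|s|) <= e * s by rewrite ler_wpM2l ?(ltW e0)// lerNl -normrN ler_norm.
  lra.
have es0 : e * s <= 0 by rewrite pmulr_rle0.
have N2 : 2^-1 <= N by rewrite /N; lra.
move: (e * s) (e * x) es es0 ex @N N2 => es ex h1 h2 h3 N N2.
split; first lra.
set a := N + es - t; have a0 : 0 <= a by rewrite /a; lra.
have aN : a ^+ 2 <= (N - t) ^+ 2.
  by rewrite ler_pXn2r// ?nnegrE /a; lra.
have k1 : P * a ^+ 2 <= P * (N - t) ^+ 2 by rewrite ler_wpM2l// ltW.
have k2 : 2 * a * t * q <= 0 by rewrite mulr_ge0_le0// !mulr_ge0// ltW.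
have k3 : t ^+ 2 * W <= t * (16^-1 * P) by rewrite expr2 -mulrA ler_wpM2l// ltW.
have k4 : P * t * t <= P * t * 16^-1 by rewrite ler_wpM2l// mulr_ge0// ltW.
have k5 : P * t * 2^-1 <= P * t * N by rewrite ler_wpM2l// mulr_ge0// ltW.
have k6 : 0 < P * t by rewrite mulr_gt0.
have : P * (N - t) ^+ 2 = P * N ^+ 2 - 2 * (P * t * N) + P * t * t by ring.
lra.
Qed.

Lemma sqr_ncD (z w : C) : nc (z + w) ^+ 2 = nc z ^+ 2 + nc w ^+ 2 + 2 * Re (z^* * w).
Proof. by rewrite !sqr_nc ReM !ReD !ImD ReJ ImJ; ring. Qed.

(* Otherwise [v1 + e z v2], with [z] chosen so that the first order term is a real
   multiple of [qf L v1], has a smaller value of [nc (qf L v) / sq v]. *)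
Lemma toeplitz_hausdorff_step M L (c : R) v1 v2 :
  (forall v, Re (qf M v) <= c * sq v) ->
  Re (qf M v1) = c * sq v1 -> Re (qf M v2) = c * sq v2 ->
  sq v1 = 1 -> sq v2 = 1 -> qf L v1 != 0 ->
  (forall v, Re (qf M v) = c * sq v -> nc (qf L v1) * sq v <= nc (qf L v)) ->
  0 < Re ((qf L v1)^* * qf L v2).
Proof.
move=> Mc e1 e2 s1 s2 w0 hmin; rewrite ltNge; apply/negP => q0.
set w1 := qf L v1 in w0 hmin q0; set w2 := qf L v2 in q0.
have P0 : 0 < nc w1 ^+ 2 by rewrite exprn_gt0// nc_gt0.
pose X := bf L v1 v2; pose Y := bf L v2 v1.
(* After conjugating the summand with X, the imaginary part of conj(w1) (conj(z) X + z Y) is that of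
   z k; hence z is chosen to make z k real. *)
pose k := w1^* * Y - w1 * X^*.
pose z : C := if k == 0 then 1 else k^*.
have z0 : z != 0.
  rewrite /z; case: ifPn => [_|k0]; first exact: oner_neq0.
  by rewrite -nc_eq0 nc_conj nc_eq0.
have zk : Im (z * k) = 0.
  rewrite /z; case: eqP => [->|_]; first by rewrite mulr0.
  by rewrite mulrC mulcJ.
have [r hr] : exists r : R, z^* * X + z * Y = r%:C * w1.
  have him : Im (w1^* * (z^* * X + z * Y)) = 0.
    by move: zk; rewrite /k !(ReM, ImM, ReD, ImD, ReN, ImN, ReJ, ImJ) => zk; rewrite -[RHS]zk; ring.
  exists (Re (w1^* * (z^* * X + z * Y)) / nc w1 ^+ 2).
  have w1c : w1 * w1^* != 0 by rewrite mulcJ -[0]/(0%:C) (inj_eq (@complexI R)) gt_eqF.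
  apply: (mulfI w1c); rewrite mulcJ.
  have -> : (Re (w1^* * (z^* * X + z * Y)) / nc w1 ^+ 2)%:C =
      (Re (w1^* * (z^* * X + z * Y)))%:C / (nc w1 ^+ 2)%:C.
    by rewrite -fmorphV -rmorphM.
  have -> : (Re (w1^* * (z^* * X + z * Y)))%:C = w1^* * (z^* * X + z * Y).
    by apply: eqC.
  rewrite -mulcJ [RHS]mulrA [X in _ = X * _]mulrC (divfK w1c); ring.
pose d := fun i j : I => ((i == j)%:R : C).
pose x := Re (z^* * bf d v1 v2 + z * bf d v2 v1) / 2.
have n0 : 0 < nc z ^+ 2 by rewrite exprn_gt0// nc_gt0.
have [e] := perturbation_size x (r - 2 * x) P0 (sqr_ge0 (nc w2)) n0 q0.
cbv zeta; set N := 1 + 2 * e * x + e ^+ 2 * nc z ^+ 2.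
set a := N + e * (r - 2 * x) - e ^+ 2 * nc z ^+ 2 => -[N0 hN].
pose ce := e%:C * z; pose v := fun i => v1 i + ce * v2 i.
have cJ : ce^* = e%:C * z^* by rewrite conjM [(e%:C)^*]conjc_real.
have cc : ce * ce^* = (e ^+ 2 * nc z ^+ 2)%:C by rewrite mulcJ ncM nc_real exprMn real_normK ?num_real.
have sv : sq v = N.
  have : Re (qf d v) = N.
    have -> : qf d v = 1%:C + e%:C * (z^* * bf d v1 v2 + z * bf d v2 v1) +
        (e ^+ 2 * nc z ^+ 2)%:C * 1%:C.
      by rewrite qfD cc cJ -!sqE s1 s2 /ce; ring.
    by rewrite !ReD !Re_realM ReD /N /x /=; field.
  by rewrite -sqE.
(* By the parallelogram law the values at v and at its mirror image v' add up to c times the sum of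
   the two square norms. Neither exceeds its share, so both are extremal. *)
have vV : Re (qf M v) = c * sq v.
  pose v' := fun i => v1 i + (- ce) * v2 i.
  have h1 := Mc v; have h2 := Mc v'.
  have par K : qf K v + qf K v' = qf K v1 + qf K v1 +
      (e ^+ 2 * nc z ^+ 2)%:C * (qf K v2 + qf K v2).
    by rewrite !qfD conjN mulrNN cc; ring.
  have p1 := congr1 Re (par M); rewrite !ReD Re_realM ReD in p1.
  have p2 := congr1 Re (par d); rewrite !ReD Re_realM ReD -!sqE /= in p2.
  nra.
have qv : qf L v = a%:C * w1 + (e ^+ 2 * nc z ^+ 2)%:C * w2.
  rewrite qfD cc -/w1 -/w2 cJ -/X -/Y.
  have -> : a%:C = 1 + e%:C * r%:C.
    by rewrite -rmorphM -[1]/(1%:C) -rmorphD /a /N; congr (_%:C); ring.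
  rewrite [(1 + _) * _]mulrDl mul1r -[e%:C * r%:C * _]mulrA -hr /ce; ring.
have := hmin v vV; rewrite sv => hm.
have : (nc w1 * N) ^+ 2 <= nc (qf L v) ^+ 2.
  by rewrite ler_pXn2r ?nnegrE ?nc_ge0// mulr_ge0 ?nc_ge0.
rewrite qv sqr_ncD !ncM !nc_real !exprMn !real_normK ?num_real//.
rewrite conjM [(a%:C)^*]conjc_real.
have -> : a%:C * w1^* * ((e ^+ 2 * nc z ^+ 2)%:C * w2) =
   (a * (e ^+ 2 * nc z ^+ 2))%:C * (w1^* * w2) by rewrite rmorphM; ring.
rewrite Re_realM => h.
move: hN; rewrite ltNge => /negP; apply.
move: h; rewrite !exprMn; lra.
Qed.

End ToeplitzHausdorff.

(** * Minimizing the largest eigenvalue over l *)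

Section Minimax.
Variables (R : realType) (I : finType).
Local Notation C := R[i].
Variables (A B S : I -> I -> C).
Implicit Types (v w : I -> C) (l m : C).

(* The form [|A v + l B v|^2 - |v|^2] as a function of [l]; its derivative in the
   direction [m] is [2 Re (m * qf (grad l) v)]. *)
Definition quad l i j := A i j + (2 * l) * B i j + (l * l^*) * S i j.
Definition grad l i j := B i j + l^* * S i j.

Lemma qf_quad l v : qf (quad l) v = qf A v + 2 * l * qf B v + l * l^* * qf S v.
Proof. by rewrite /quad !qf_addm. Qed.

Lemma qf_grad l v : qf (grad l) v = qf B v + l^* * qf S v.
Proof. exact: qf_addm. Qed.

Hypothesis S_real : forall v, Im (qf S v) = 0.

Lemma Re_quadD l m v : Re (qf (quad (l + m)) v) =
  Re (qf (quad l) v + 2 * m * qf (grad l) v + m * m^* * qf S v).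
Proof.
rewrite !qf_quad qf_grad.
have -> : qf A v + 2 * (l + m) * qf B v + (l + m) * (l + m)^* * qf S v =
  (qf A v + 2 * l * qf B v + l * l^* * qf S v + 2 * m * (qf B v + l^* * qf S v) +
   m * m^* * qf S v) + (l * m^* - m * l^*) * qf S v by rewrite conjD; ring.
have gen (X Y : C) : Re Y = 0 -> Re (X + Y) = Re X by move=> h; rewrite ReD h addr0.
by apply: gen; rewrite ReM S_real ReD ReN !ReM !ReJ !ImJ; ring.
Qed.

Variable v0 : I -> C.
Hypothesis S_pos : 0 < Re (qf S v0).
Hypothesis critical : forall l v, qf (grad l) v = 0 -> Re (qf (quad l) v) <= 0.

(** These c bound the largest eigenvalue of [quad l] from above for some l; their infimum is the
    minimax value. *)
Definition feasible (c : R) := exists l, forall v, Re (qf (quad l) v) <= c * sq v.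

Lemma sq_v0 : 0 < sq v0.
Proof.
rewrite lt0r sq_ge0 andbT; apply/eqP => /sq0 v0E.
by move: S_pos; rewrite v0E qf0 ltxx.
Qed.

(** Quadratic growth in |l|, from positivity of S at v0. It bounds [feasible] from below and keeps
    the nearly optimal l in a bounded set. *)
Lemma Re_quad_ge l : Re (qf A v0) - 2 * nc l * nc (qf B v0) + nc l ^+ 2 * Re (qf S v0) <=
  Re (qf (quad l) v0).
Proof.
have -> : Re (qf (quad l) v0) = Re (qf A v0) + 2 * Re (l * qf B v0) + nc l ^+ 2 * Re (qf S v0).
  rewrite qf_quad mulcJ !ReD Re_realM -mulrA; congr (_ + _ + _).
  by rewrite mulr_natl mulr2n ReD; ring.
have := nc_Re (l * qf B v0); rewrite ler_norml ncM => /andP[h _]; lra.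
Qed.

Lemma feasible_has_inf : has_inf feasible.
Proof.
split.
  have [K K0 hK] := qf_bounded (quad 0); exists K; exists 0 => v.
  exact: le_trans (Re_le_nc _) (hK v).
have s0 := sq_v0.
exists ((Re (qf A v0) - nc (qf B v0) ^+ 2 / Re (qf S v0)) / sq v0) => c [l hl].
rewrite ler_pdivrMr//; apply: le_trans (hl v0); apply: le_trans (Re_quad_ge l).
rewrite -addrA lerD2l lerNl opprD opprK -subr_ge0.
have -> : nc (qf B v0) ^+ 2 / Re (qf S v0) - (2 * nc l * nc (qf B v0) - nc l ^+ 2 * Re (qf S v0)) =
  (nc (qf B v0) - nc l * Re (qf S v0)) ^+ 2 / Re (qf S v0) by field; rewrite gt_eqF.
by rewrite divr_ge0 ?sqr_ge0// ltW.
Qed.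

Lemma feasible_bounded l (c : R) : (forall v, Re (qf (quad l) v) <= c * sq v) ->
  nc l <= 1 + (2 * nc (qf B v0) + `|c| * sq v0 + `|Re (qf A v0)|) / Re (qf S v0).
Proof.
move=> hl; have := le_trans (Re_quad_ge l) (hl v0); have s0 := sq_v0.
have b0 := nc_ge0 (qf B v0); have l0 := nc_ge0 l.
have h1 : c * sq v0 <= `|c| * sq v0 by rewrite ler_wpM2r ?(ltW s0)// ler_norm.
have h2 : - Re (qf A v0) <= `|Re (qf A v0)| by rewrite -normrN ler_norm.
have h3 : 0 <= `|c| * sq v0 + `|Re (qf A v0)| by rewrite addr_ge0// mulr_ge0// ltW.
set K := `|c| * _ in h1 h3 *; set L := `|Re _| in h2 h3 *; have Sp := S_pos; set s := Re (qf S v0) in Sp *.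
move=> h; have [l1|l1] := leP (nc l) 1.
  by apply: le_trans l1 _; rewrite lerDl divr_ge0 ?(ltW Sp)//; lra.
apply: (@le_trans _ _ ((2 * nc (qf B v0) + K + L) / s)); last by rewrite lerDr.
rewrite ler_pdivlMr//.
have k1 : nc l ^+ 2 * s <= nc l * (2 * nc (qf B v0)) + (K + L) by nra.
have k2 : K + L <= nc l * (K + L) by rewrite ler_peMl// ltW.
have k3 : nc l * (nc l * s) <= nc l * (2 * nc (qf B v0) + K + L) by lra.
by rewrite -(@ler_pM2l _ (nc l))//; lra.
Qed.

Section WithUltrafilter.
Context {U : set_system nat} {UU : UltraFilter U} (hU : \oo `<=` U).

#[local] Instance U_pf : ProperFilter U := ultra_proper.

Let eps n : C := (n.+1%:R^-1)%:C.
Let eps0 : ccvg U eps 0. Proof. exact: ccvg_inv. Qed.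

Lemma ccvg_quad (l : nat -> C) l0 v : ccvg U l l0 ->
  ccvg U (fun n => qf (quad (l n)) v) (qf (quad l0) v).
Proof.
move=> hl; rewrite qf_quad; apply: (ccvg_eq (u := fun n => qf A v + 2 * l n * qf B v + l n * (l n)^* * qf S v)).
  by move=> n; rewrite qf_quad.
apply: ccvgD; [apply: ccvgD|]; [exact: ccvg_cst| |].
  by apply: ccvgM; [apply: ccvgM => //|]; exact: ccvg_cst.
by apply: ccvgM; [apply: ccvgM => //; exact: ccvgJ|exact: ccvg_cst].
Qed.

(** The limit along U of parameters that are optimal up to 1 / (n + 1) is an optimal parameter. *)
Lemma feasible_inf : feasible (inf feasible).
Proof.
set c := inf feasible.
have adh n : exists l, forall v, Re (qf (quad l) v) <= (c + n.+1%:R^-1) * sq v.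
  have [|d [l hl] dc] := @inf_adherent R feasible n.+1%:R^-1 _ feasible_has_inf.
    by rewrite invr_gt0 ltr0n.
  by exists l => v; apply: le_trans (hl v) _; rewrite ler_wpM2r ?sq_ge0// ltW.
have [l hl] := choice adh.
have [l0 hl0] : exists l0, ccvg U l l0.
  apply: (ultra_bounded_ccvg (M := 1 + (2 * nc (qf B v0) + (`|c| + 1) * sq v0 + `|Re (qf A v0)|) / Re (qf S v0))).
  move=> n; apply: le_trans (feasible_bounded (hl n)) _.
  rewrite lerD2l ler_wpM2r ?invr_ge0 ?(ltW S_pos)// lerD2r lerD2l ler_wpM2r ?sq_ge0//.
  apply: le_trans (ler_normD _ _) _; rewrite lerD2l ger0_norm ?invr_ge0//.
  by rewrite invf_le1// ler1n.
exists l0 => v.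
have : ccvg U (fun n => qf (quad (l n)) v - eps n * (sq v)%:C) (qf (quad l0) v - 0 * (sq v)%:C).
  by apply: ccvgB; [exact: ccvg_quad|apply: ccvgM => //; exact: ccvg_cst].
rewrite mul0r subr0 => h; apply: (ccvg_le_Re h) => n.
by have := hl n v; rewrite ReD ReN Re_realM /= lerBlDr -mulrDl.
Qed.

Let c := inf feasible.

Lemma normalize v : 0 < sq v -> exists a : R, 0 < a /\ sq (fun i => (a%:C) * v i) = 1 /\
  forall M, qf M (fun i => (a%:C) * v i) = (a ^+ 2)%:C * qf M v.
Proof.
move=> s0; pose a := (Num.sqrt (sq v))^-1.
have a0 : 0 < a by rewrite invr_gt0 sqrtr_gt0.
exists a; split => //; split.
  by rewrite sqZ nc_real real_normK ?num_real// exprVn sqr_sqrtr ?mulVf// ?gt_eqF// ltW.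
by move=> M; rewrite qfZ mulcJ nc_real real_normK ?num_real.
Qed.

(** Envelope argument: optimality of c provides nearly maximal unit vectors at l0 + eps m, and their
    limit is a top eigenvector along which moving in the direction m does not decrease the form to
    first order. *)
Lemma direction l0 m : (forall v, Re (qf (quad l0) v) <= c * sq v) ->
  exists v, [/\ sq v = 1, Re (qf (quad l0) v) = c & 0 <= Re (m * qf (grad l0) v)].
Proof.
move=> h0.
have ex n : exists v, sq v = 1 /\
    c <= Re (qf (quad (l0 + eps n * m)) v + eps n * eps n).
  apply: contrapT => hn.
  have en0 : 0 < n.+1%:R^-1 :> R by rewrite invr_gt0 ltr0n.
  (* The slack eps^2 goes strictly below the infimum, and it still tends to 0 after division by
     eps. *)
  have : feasible (c - n.+1%:R^-1 * n.+1%:R^-1).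
    exists (l0 + eps n * m) => v; rewrite leNgt; apply/negP => lt.
    have sv : 0 < sq v.
      rewrite lt0r sq_ge0 andbT; apply/eqP => /sq0 ve.
      move: lt; rewrite ve qf0 (_ : sq _ = 0) ?mulr0 ?ltxx//.
      by rewrite /sq big1// => i _; rewrite nc0 expr0n.
    have [a [a0 [sa qa]]] := normalize sv; apply: hn.
    exists (fun i => a%:C * v i); split=> //.
    have a2 : a ^+ 2 * sq v = 1.
      by move: sa; rewrite sqZ nc_real real_normK ?num_real.
    rewrite qa ReD !Re_realM /=.
    have := ler_wpM2l (sqr_ge0 a) (ltW lt); rewrite mulrCA a2 mulr1.
    by move: (n.+1%:R^-1 : R) (a ^+ 2 * _) => x y; lra.
  move=> /(ge_inf feasible_has_inf.2); rewrite -/c leNgt => /negP; apply.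
  by rewrite ltrBlDr ltrDl mulr_gt0.
have [V hV] := choice ex.
have [v sv cv] := unit_compact UU (fun n => (hV n).1); exists v.
have cq M : ccvg U (fun n => qf M (V n)) (qf M v) by exact: ccvg_qf.
(* The difference quotient in l along m, with the slack included; its real part is nonnegative
   because the form at l0 is at most c. *)
pose D n := 2 * m * qf (grad l0) (V n) + eps n * (m * m^* * qf S (V n) + 1).
have hD n : c <= Re (qf (quad l0) (V n) + eps n * D n).
  apply: le_trans (hV n).2 _; rewrite ReD Re_quadD -ReD le_eqVlt; apply/orP; left.
  apply/eqP; congr (Re _); rewrite /D conjM [(eps n)^*]conjc_real; ring.
have D0 n : 0 <= Re (D n).
  have := hD n; have := h0 (V n); rewrite (hV n).1 mulr1 ReD Re_realM => h1 h2.
  have en0 : 0 < n.+1%:R^-1 :> R by rewrite invr_gt0 ltr0n.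
  rewrite -(pmulr_rge0 _ en0).
  by move: h1 h2; move: (_ * Re (D n)) => y; lra.
have cD : ccvg U D (2 * m * qf (grad l0) v + 0 * (m * m^* * qf S v + 1)).
  apply: ccvgD; first by apply: ccvgM => //; exact: ccvg_cst.
  apply: ccvgM => //; apply: ccvgD; last exact: ccvg_cst.
  by apply: ccvgM => //; exact: ccvg_cst.
split=> //.
  apply/eqP; rewrite eq_le; apply/andP; split.
    by have := h0 v; rewrite sv mulr1.
  have : ccvg U (fun n => qf (quad l0) (V n) + eps n * D n)
     (qf (quad l0) v + 0 * (2 * m * qf (grad l0) v + 0 * (m * m^* * qf S v + 1))).
    by apply: ccvgD => //; apply: ccvgM.
  by rewrite mul0r addr0 => h; exact: (ccvg_ge_Re h).
have := @ccvg_ge_Re _ U UU _ _ _ cD D0; rewrite mul0r addr0 -mulrA mulr_natl mulr2n ReD; lra.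
Qed.

(** If c > 0, take the top eigenvector v1 whose derivative value w has least modulus; w is not 0 by
    [critical]. Then [toeplitz_hausdorff_step] puts the values at all top eigenvectors in the open
    half-plane of w, while [direction] along -conj(w) yields one outside it. *)
Lemma minimax_aux : exists l, forall v, Re (qf (quad l) v) <= 0.
Proof.
have [l0 hl0] := feasible_inf; rewrite -/c in hl0.
have [c0|c0] := leP c 0.
  by exists l0 => v; apply: le_trans (hl0 v) _; rewrite mulr_le0_ge0// sq_ge0.
exfalso.
pose Q (x : R) := exists v, [/\ sq v = 1, Re (qf (quad l0) v) = c & nc (qf (grad l0) v) = x].
have Qinf : has_inf Q.
  split; last by exists 0 => x [v [_ _ <-]]; exact: nc_ge0.
  have [v [sv ev _]] := direction 0 hl0; exists (nc (qf (grad l0) v)); by exists v.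
have adh n : exists v, [/\ sq v = 1, Re (qf (quad l0) v) = c &
    nc (qf (grad l0) v) <= inf Q + n.+1%:R^-1].
  have [|x [v [sv ev <-]] xQ] := @inf_adherent R Q n.+1%:R^-1 _ Qinf.
    by rewrite invr_gt0 ltr0n.
  by exists v; split => //; exact: ltW.
have [V hV] := choice adh.
have sV n : sq (V n) = 1 by have [] := hV n.
have [v1 s1 cv] := unit_compact UU sV.
have cq M : ccvg U (fun n => qf M (V n)) (qf M v1) by exact: ccvg_qf.
have e1 : Re (qf (quad l0) v1) = c.
  apply/eqP; rewrite eq_le; apply/andP; split.
    by apply: (ccvg_le_Re (cq _)) => n; have [_ -> _] := hV n.
  by apply: (ccvg_ge_Re (cq _)) => n; have [_ -> _] := hV n.
have m1 : nc (qf (grad l0) v1) <= inf Q.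
  have h1 : ccvg U (fun n => (nc (qf (grad l0) (V n)))%:C) (nc (qf (grad l0) v1))%:C.
    by split => /=; [exact: ccvg_nc (cq (grad l0))|exact: cvg_cst].
  have : ccvg U (fun n => (nc (qf (grad l0) (V n)))%:C - eps n)
    ((nc (qf (grad l0) v1))%:C - 0) by exact: ccvgB.
  rewrite subr0 => h; apply: (ccvg_le_Re h) => n.
  by have [_ _] := hV n; rewrite ReD ReN /= lerBlDr.
have hmin v : sq v = 1 -> Re (qf (quad l0) v) = c -> nc (qf (grad l0) v1) <= nc (qf (grad l0) v).
  by move=> sv ev; apply: le_trans m1 _; apply: (ge_inf Qinf.2); exists v.
have [w0|w0] := eqVneq (qf (grad l0) v1) 0.
  by have := critical w0; rewrite e1 leNgt c0.
have [v2 [s2 e2 h2]] := direction (- (qf (grad l0) v1)^*) hl0.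
have := @toeplitz_hausdorff_step R I (quad l0) (grad l0) c v1 v2 hl0.
rewrite s1 s2 !mulr1 => /(_ e1 e2 erefl erefl w0) H.
have : 0 < Re ((qf (grad l0) v1)^* * qf (grad l0) v2).
  apply: H => v ev; have [sv|sv] := eqVneq (sq v) 0; first by rewrite sv mulr0 nc_ge0.
  have sv0 : 0 < sq v by rewrite lt0r sv sq_ge0.
  have [a [a0 [sa qa]]] := normalize sv0.
  have a2 : a ^+ 2 * sq v = 1 by move: sa; rewrite sqZ nc_real real_normK ?num_real.
  have := hmin _ sa; rewrite !qa Re_realM ev mulrCA a2 mulr1 => /(_ erefl).
  rewrite ncM nc_real ger0_norm ?sqr_ge0// => h.
  have := ler_wpM2r (ltW sv0) h; rewrite mulrAC a2 mul1r.
  by [].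
by move: h2; rewrite mulNr ReN; lra.
Qed.

End WithUltrafilter.

Theorem minimax : exists l, forall v, Re (qf (quad l) v) <= 0.
Proof.
have [U [UU hU]] := ultraFilterLemma eventually_filter.
exact: (@minimax_aux U UU hU).
Qed.

End Minimax.

(** * Nevanlinna-Pick interpolation *)

Section Schur.
Variable R : realType.
Local Notation C := R[i].

Lemma ext_inj (r s : R) : r%:C = s%:C -> r = s. Proof. exact: complexI. Qed.

Definition hermitian (I : finType) (M : I -> I -> C) := forall i j, M j i = (M i j)^*.
Definition psd (I : finType) (M : I -> I -> C) := forall v, 0 <= Re (qf M v).

Lemma bfJ (I : finType) (M : I -> I -> C) u v : hermitian M -> (bf M u v)^* = bf M v u.
Proof.
move=> hM; rewrite /bf conj_sum exchange_big /=; apply: eq_bigr => i _.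
rewrite conj_sum; apply: eq_bigr => j _; rewrite !conjM conjK -hM; ring.
Qed.

(** Cauchy-Schwarz for a form that may be degenerate: test v + t conj(X) u with t real. *)
Lemma psd_cauchy (I : finType) (M : I -> I -> C) u v : hermitian M -> psd M ->
  nc (bf M u v) ^+ 2 <= Re (qf M u) * Re (qf M v).
Proof.
move=> hM pM; set X := bf M u v; set a := Re (qf M u); set b := Re (qf M v).
have key (t : R) : 0 <= b + 2 * t * nc X ^+ 2 + t ^+ 2 * nc X ^+ 2 * a.
  have := pM (fun i => v i + (t%:C * X^*) * u i).
  have -> : qf M (fun i => v i + (t%:C * X^*) * u i) =
      qf M v + (t * nc X ^+ 2)%:C + (t * nc X ^+ 2)%:C + (t ^+ 2 * nc X ^+ 2)%:C * qf M u.
    rewrite qfD conjM conj_rc conjK.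
    have -> : bf M v u = X^* by rewrite bfJ.
    rewrite -/X (rcM t) (rcM (t ^+ 2)) (rcX t) -mulcJ; ring.
  by rewrite !ReD Re_realM -/a -/b /= => h; lra.
have a0 : 0 <= a by exact: pM.
have b0 : 0 <= b by exact: pM.
have X0 : 0 <= nc X ^+ 2 by exact: sqr_ge0.
have [az|az] := eqVneq a 0.
  rewrite az mul0r leNgt; apply/negP => Xp.
  (* With a = 0 the expression is affine in t, and this t gives it the value -1. *)
  have := key (- (b + 1) / (2 * nc X ^+ 2)); rewrite az mulr0 addr0.
  move: (nc X ^+ 2) Xp => y yp.
  have -> : 2 * (- (b + 1) / (2 * y)) * y = - (b + 1) by field; rewrite gt_eqF.
  lra.
have ap : 0 < a by rewrite lt0r az.
(* The minimizing t. *)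
have := key (- a^-1).
have -> : b + 2 * - a^-1 * nc X ^+ 2 + (- a^-1) ^+ 2 * nc X ^+ 2 * a = b - nc X ^+ 2 / a.
  by field.
by rewrite subr_ge0 ler_pdivrMr// mulrC.
Qed.

(** Bessel's inequality for two orthogonal vectors of equal square norm mu, multiplied by mu to
    allow mu = 0; it is [psd_cauchy] for conj(X) u0 + conj(Y) u1. It serves to eliminate the
    functions 1 and z together. *)
Lemma psd_cauchy2 (I : finType) (M : I -> I -> C) u0 u1 v (mu : R) : hermitian M -> psd M ->
  bf M u0 u1 = 0 -> qf M u0 = mu%:C -> qf M u1 = mu%:C ->
  nc (bf M u0 v) ^+ 2 + nc (bf M u1 v) ^+ 2 <= mu * Re (qf M v).
Proof.
move=> hM pM u01 q0 q1; set X := bf M u0 v; set Y := bf M u1 v.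
have mu0 : 0 <= mu by have := pM u0; rewrite q0.
set s := _ + _; have s0 : 0 <= s by rewrite addr_ge0// sqr_ge0.
pose u i := X^* * u0 i + Y^* * u1 i.
have bu : bf M u v = s%:C.
  have -> : u = (fun i => 0 + X^* * u0 i + Y^* * u1 i) by apply/funext => i; rewrite /u add0r.
  rewrite bfDl (bfDl _ (fun=> 0)) -/X -/Y.
  have -> : bf M (fun=> 0) v = 0.
    by rewrite /bf big1// => i _; rewrite big1// => j _; rewrite mulr0 mul0r.
  by rewrite add0r rcD -!mulcJ; ring.
have u10 : bf M u1 u0 = 0 by rewrite -(bfJ _ _ hM) u01 conj0.
have qu : qf M u = (mu * s)%:C.
  rewrite /u qfD qfZ q0 q1 rcM rcD -!mulcJ !conjK.
  have -> : bf M (fun i => X^* * u0 i) u1 = 0.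
    have -> : (fun i => X^* * u0 i) = (fun i => 0 * u0 i + X^* * u0 i) by apply/funext => i; rewrite mul0r add0r.
    rewrite bfDl u01 mulr0 addr0 /bf big1// => i _; rewrite big1// => j _; ring.
  have -> : bf M u1 (fun i => X^* * u0 i) = 0.
    have -> : (fun i => X^* * u0 i) = (fun i => 0 * u0 i + X^* * u0 i) by apply/funext => i; rewrite mul0r add0r.
    rewrite bfDr u10 mulr0 addr0 /bf big1// => i _; rewrite big1// => j _.
    by rewrite mul0r conj0 mulr0.
  ring.
have := psd_cauchy u v hM pM; rewrite bu qu nc_real ger0_norm//= => h.
have [sz|sz] := eqVneq s 0; first by rewrite sz mulr_ge0//; exact: pM.
have sp : 0 < s by rewrite lt0r sz.
by rewrite -(ler_pM2l sp) -expr2 mulrCA mulrA.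
Qed.

Lemma moebius_id (a z : C) :
  nc (1 + a^* * z) ^+ 2 - nc (a + z) ^+ 2 = (1 - nc a ^+ 2) * (1 - nc z ^+ 2).
Proof. by rewrite !sqr_nc !ReD !ImD ReM ImM ReJ ImJ /=; ring. Qed.

Lemma moebius_le1 (a z : C) : nc a <= 1 -> nc z <= 1 -> nc (a + z) <= nc (1 + a^* * z).
Proof.
move=> a1 z1; rewrite -(@ler_pXn2r _ 2)// ?nnegrE ?nc_ge0// -subr_ge0 moebius_id.
by rewrite mulr_ge0// subr_ge0 -[leRHS](expr1n _ 2) lerXn2r ?nnegrE ?nc_ge0.
Qed.

Lemma one_sub_neq0 (a z : C) : nc a < 1 -> nc z <= 1 -> 1 - a^* * z != 0.
Proof.
move=> a1 z1; apply/eqP => /eqP; rewrite subr_eq0 => /eqP h.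
have := nc1 R; rewrite h ncM nc_conj => h1.
have := nc_ge0 a; have := nc_ge0 z; nra.
Qed.

Lemma one_add_neq0 (a z : C) : nc a < 1 -> nc z <= 1 -> 1 + a^* * z != 0.
Proof.
move=> a1 z1; have := @one_sub_neq0 a (- z) a1; rewrite ncN mulrN opprK; exact.
Qed.

Definition schur_class (g : C -> C) := holomorphic g /\ forall z, disk z -> nc (g z) <= 1.

Lemma schur_moebius (a : C) (h : C -> C) : nc a < 1 -> schur_class h ->
  schur_class (fun z => (a + h z) / (1 + a^* * h z)).
Proof.
move=> a1 [hh h1]; split=> z zd; have hz := h1 z zd; have n0 := one_add_neq0 a1 hz.
  have dh := hh z zd.
  have d1 : derivable ((fun z => a + h z) : C^o -> C^o) z 1.
    apply: (@derivableD _ C^o C^o (cst a) h z 1); [exact: derivable_cst|exact: dh].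
  have d2 : derivable ((fun z => a^* * h z) : C^o -> C^o) z 1.
    apply: (@derivableM _ C^o (cst a^* : C^o -> C^o) (h : C^o -> C^o) z 1).
      exact: derivable_cst.
    exact: dh.
  have d3 : derivable ((fun z => 1 + a^* * h z) : C^o -> C^o) z 1.
    apply: (@derivableD _ C^o C^o (cst 1) (fun z => a^* * h z) z 1).
      exact: derivable_cst.
    exact: d2.
  apply: (@derivableM _ C^o (fun z : C^o => a + h z : C^o)); first exact: d1.
  by apply: (@derivableV _ C^o (fun z : C^o => 1 + a^* * h z : C^o)).
rewrite ncM ncV ler_pdivrMr ?nc_gt0// mul1r.
by apply: moebius_le1 => //; exact: ltW.
Qed.

Lemma schurM (g h : C -> C) : schur_class g -> schur_class h ->
  schur_class (fun z => g z * h z).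
Proof.
move=> [hg g1] [hh h1]; split=> z zd.
  by apply: (@derivableM _ _ (g : C^o -> C^o)); [exact: hg|exact: hh].
rewrite ncM; have := g1 z zd; have := h1 z zd; have := nc_ge0 (g z); have := nc_ge0 (h z).
nra.
Qed.

Lemma schur_id : schur_class id.
Proof.
by split=> z zd; [exact: derivable_id|apply: ltW; apply/diskE].
Qed.

Lemma schur_cst c : nc c <= 1 -> schur_class (fun=> c).
Proof. by move=> c1; split=> // z _; exact: derivable_cst. Qed.

Lemma schur_blaschke (a : C) : nc a < 1 -> schur_class (fun z => (z - a) / (1 - a^* * z)).
Proof.
move=> a1; have na1 : nc (- a) < 1 by rewrite ncN.
have := schur_moebius na1 schur_id.
congr schur_class; apply/funext => z; rewrite conjN mulNr addrC; by [].
Qed.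

Definition pick (I : finType) (z w : I -> C) i j : C :=
  (1 - (w i)^* * w j) / (1 - (z i)^* * z j).

Lemma pick_hermitian (I : finType) (z w : I -> C) : hermitian (pick z w).
Proof.
by move=> i j; rewrite /pick conjM conjV !conjB !conjM !conjK conj1 [w i * _]mulrC [z i * _]mulrC.
Qed.

Definition delta (I : finType) (i j : I) : C := (j == i)%:R.

Lemma bf_delta (I : finType) (M : I -> I -> C) i v : bf M (delta i) v = \sum_j M i j * (v j)^*.
Proof.
rewrite /bf (bigD1 i)//= [X in _ + X]big1 ?addr0.
  by apply: eq_bigr => j _; rewrite /delta eqxx mulr1.
by move=> k ki; rewrite big1// => j _; rewrite /delta (negbTE ki) mulr0 mul0r.
Qed.

Lemma bf_delta2 (I : finType) (M : I -> I -> C) i j : bf M (delta i) (delta j) = M i j.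
Proof.
rewrite bf_delta (bigD1 j)//= big1 ?addr0 /delta; first by rewrite eqxx conj1 mulr1.
by move=> k kj; rewrite (negbTE kj) conj0 mulr0.
Qed.

Lemma pick_diag_le1 (I : finType) (z w : I -> C) i : nc (z i) < 1 -> psd (pick z w) -> nc (w i) <= 1.
Proof.
move=> zi pM; have := pM (delta i); rewrite qfE bf_delta2 /pick.
have -> : (1 - (w i)^* * w i) / (1 - (z i)^* * z i) =
    ((1 - nc (w i) ^+ 2) / (1 - nc (z i) ^+ 2))%:C.
  by rewrite rcM rcV !rcB rc1 -!mulcJ [(w i)^* * _]mulrC [(z i)^* * _]mulrC.
have z2 : nc (z i) ^+ 2 < 1 by rewrite expr_lt1// nc_ge0.
rewrite /= pmulr_lge0 ?invr_gt0 ?subr_gt0// subr_ge0 => h.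
by rewrite -(@ler_pXn2r _ 2)// ?nnegrE ?nc_ge0// expr1n.
Qed.

End Schur.

Arguments delta {R I} i j.
Arguments delta : simpl never.

(** * The Schur algorithm and a double node at 0 *)

Section NevanlinnaPick.
Variable R : realType.
Local Notation C := R[i].

Lemma rcN (r : R) : (- r)%:C = - r%:C :> C. Proof. exact: rmorphN. Qed.

(** The push-forward of a coordinate vector along f, dual to pulling a form back ([qf_spread]). *)
Definition spread (I J : finType) (f : J -> I) (c : J -> C) (i : I) : C :=
  \sum_j c j * (i == f j)%:R.

Lemma sum_spread (I J : finType) (f : J -> I) (c : J -> C) (m : I -> C) :
  \sum_i m i * spread f c i = \sum_j m (f j) * c j.
Proof.
under eq_bigr do rewrite mulr_sumr; rewrite exchange_big; apply: eq_bigr => j _ /=.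
rewrite (bigD1 (f j))//= eqxx mulr1 big1 ?addr0// => i ij.
by rewrite (negbTE ij) !mulr0.
Qed.

Lemma sum_spreadJ (I J : finType) (f : J -> I) (c : J -> C) (m : I -> C) :
  \sum_i m i * (spread f c i)^* = \sum_j m (f j) * (c j)^*.
Proof.
have e i : m i * (spread f c i)^* = ((m i)^* * spread f c i)^* by rewrite conjM conjK.
under eq_bigr do rewrite e; rewrite -conj_sum sum_spread conj_sum.
by apply: eq_bigr => j _; rewrite conjM conjK.
Qed.

Lemma qf_spread (I J : finType) (M : I -> I -> C) (f : J -> I) (c : J -> C) :
  qf M (spread f c) = qf (fun j k => M (f j) (f k)) c.
Proof.
rewrite /qf; under eq_bigr do rewrite sum_spreadJ.
have e i : \sum_j M i (f j) * spread f c i * (c j)^* =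
    (\sum_j M i (f j) * (c j)^*) * spread f c i.
  by rewrite mulr_suml; apply: eq_bigr => j _; rewrite mulrAC.
under eq_bigr do rewrite e; rewrite sum_spread; apply: eq_bigr => j _.
by rewrite mulr_suml; apply: eq_bigr => k _; rewrite mulrAC.
Qed.

Lemma psd_pullback (I J : finType) (M : I -> I -> C) (f : J -> I) :
  psd M -> psd (fun j k => M (f j) (f k)).
Proof. by move=> pM c; rewrite -qf_spread. Qed.

Lemma psd_scale (I : finType) (M N : I -> I -> C) (d : I -> C) :
  (forall i, d i != 0) -> (forall i j, N i j = d i * (d j)^* * M i j) -> psd N -> psd M.
Proof.
move=> d0 e pN c; have := pN (fun i => c i / d i).
congr (0 <= Re _); apply: eq_bigr => i _; apply: eq_bigr => j _.
rewrite e conjM conjV; have di := d0 i.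
have dj : (d j)^* != 0 by rewrite -nc_eq0 nc_conj nc_eq0.
move: (d i) (d j)^* di dj => x y x0 y0; field; by rewrite x0 y0.
Qed.

Lemma psd_real_scale (I : finType) (M N : I -> I -> C) (r : R) :
  0 < r -> (forall i j, N i j = r%:C * M i j) -> psd N -> psd M.
Proof.
move=> r0 e pN c; have := pN c.
have -> : qf N c = r%:C * qf M c.
  rewrite /qf mulr_sumr; apply: eq_bigr => i _; rewrite mulr_sumr.
  by apply: eq_bigr => j _; rewrite e !mulrA.
by rewrite Re_realM pmulr_rge0.
Qed.

Lemma eq_unimodular (a b : C) : nc a = 1 -> 1 - a^* * b = 0 -> b = a.
Proof.
move=> a1 /eqP; rewrite subr_eq0 => /eqP h.
by rewrite -[LHS]mul1r -[1](expr1n _ 2) -[1 in LHS]/(1%:C) -a1 -rcX -mulcJ -mulrA -h mulr1.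
Qed.

Lemma moebiusK (a b : C) : nc a < 1 -> nc b <= 1 ->
  let m := (b - a) / (1 - a^* * b) in (a + m) / (1 + a^* * m) = b.
Proof.
move=> a1 b1 m; have h := one_sub_neq0 a1 b1.
have h2 : 1 - a * a^* != 0.
  by have := one_sub_neq0 a1 (ltW a1); rewrite mulrC.
rewrite /m; field; rewrite h /=.
have -> : 1 - a^* * b + a^* * (b - a) = 1 - a * a^* by ring.
by [].
Qed.

Lemma sqr_nc_sum (I : finType) (al c : I -> C) :
  (nc (\sum_j al j * (c j)^*) ^+ 2)%:C = qf (fun i j => (al i)^* * al j) c.
Proof.
rewrite -mulcJ mulrC conj_sum mulr_suml; apply: eq_bigr => i _.
by rewrite mulr_sumr; apply: eq_bigr => j _; rewrite conjM conjK; ring.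
Qed.

(* Schur's algorithm: compose with the Moebius map of the value at the first node
   and divide by the Blaschke factor of that node. *)
Theorem nevanlinna_pick n (z w : 'I_n -> C) : (forall i, nc (z i) < 1) -> injective z ->
  psd (pick z w) -> exists2 g, schur_class g & forall i, g (z i) = w i.
Proof.
elim: n z w => [|n IH] z w z1 zi pM.
  by exists (fun=> 0); [apply: schur_cst; rewrite nc0|case].
have w1 i : nc (w i) <= 1 by exact: pick_diag_le1 (z1 i) pM.
have hM := pick_hermitian z w.
have cs v := psd_cauchy (delta ord0) v hM pM.
have q0 : qf (pick z w) (delta ord0) = ((1 - nc (w ord0) ^+ 2) / (1 - nc (z ord0) ^+ 2))%:C.
  by rewrite qfE bf_delta2 /pick rcM rcV !rcB rc1 -!mulcJ [(w _)^* * _]mulrC [(z _)^* * _]mulrC.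
have z2 : 0 < 1 - nc (z ord0) ^+ 2 by rewrite subr_gt0 expr_lt1// nc_ge0.
(* A unimodular first value makes that diagonal entry 0, so [psd_cauchy] annihilates its row and all
   values coincide. *)
have [w01|w01] := eqVneq (nc (w ord0)) 1.
  exists (fun=> w ord0); first by apply: schur_cst; rewrite w01.
  move=> i; apply/esym/eq_unimodular => //.
  have := cs (delta i); rewrite q0 bf_delta2 w01 expr1n subrr mul0r mul0r => h.
  have : pick z w ord0 i == 0 by rewrite -nc_eq0 -sqrf_eq0 eq_le sqr_ge0 andbT.
  rewrite /pick mulf_eq0 invr_eq0 (negbTE (one_sub_neq0 (z1 ord0) (ltW (z1 i)))) orbF.
  by move=> /eqP.
have w0lt : nc (w ord0) < 1 by rewrite lt_neqAle w01 w1.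
have w2 : 0 < 1 - nc (w ord0) ^+ 2 by rewrite subr_gt0 expr_lt1// nc_ge0.
set mu := (1 - nc (w ord0) ^+ 2) / _ in q0.
have mu0 : 0 < mu by rewrite divr_gt0.
pose s := lift (ord0 : 'I_n.+1).
pose b (x : C) := (x - z ord0) / (1 - (z ord0)^* * x).
pose m i := (w (s i) - w ord0) / (1 - (w ord0)^* * w (s i)).
have b0 i : b (z (s i)) != 0.
  rewrite mulf_neq0 ?invr_eq0 ?one_sub_neq0 ?(ltW (z1 _))// subr_eq0 (inj_eq zi).
  by rewrite eq_sym neq_lift.
pose v i := m i / b (z (s i)).
have [|g1 [hg1 g11] gv] := IH (z \o s) v (fun i => z1 _) (inj_comp zi lift_inj).
  pose d i := (1 - (w (s i))^* * w ord0) * (b (z (s i)))^*.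
  pose al j := pick z w ord0 (s j).
  (* The Schur complement of the first diagonal entry. Up to the positive constant 1 - |w_0|^2 and
     the diagonal scaling [d] it is the Pick matrix of the reduced data. *)
  pose N i j := pick z w (s i) (s j) + (- mu^-1)%:C * ((al i)^* * al j).
  have pN : psd N.
    move=> c; have := cs (spread s c); rewrite q0 qf_spread -[Re mu%:C]/mu => h.
    rewrite /N qf_addm -sqr_nc_sum ReD Re_realM /= mulNr subr_ge0 ler_pdivrMl//.
    by move: h; rewrite bf_delta sum_spreadJ.
  have d0 i : d i != 0.
    apply: mulf_neq0; last by rewrite -nc_eq0 nc_conj nc_eq0 b0.
    by rewrite -nc_eq0 -nc_conj nc_eq0 conjB conjM conjK conj1 mulrC one_sub_neq0.
  have pN' : psd (fun i j => (1 - nc (w ord0) ^+ 2)%:C * N i j).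
    apply: (psd_real_scale (r := (1 - nc (w ord0) ^+ 2)^-1)) pN; first by rewrite invr_gt0.
    by move=> i j; rewrite mulrA -rcM mulVf ?rc1 ?mul1r// gt_eqF.
  apply: (psd_scale d0) pN' => i j.
  have muE : (- mu^-1)%:C =
      - ((1 - (w ord0)^* * w ord0) / (1 - (z ord0)^* * z ord0))^-1.
    by rewrite rcN rcV /mu rcM rcV !rcB rc1 -!mulcJ [w _ * _]mulrC [z _ * _]mulrC.
  have w2E : (1 - nc (w ord0) ^+ 2)%:C = 1 - (w ord0)^* * w ord0.
    by rewrite rcB rc1 -mulcJ mulrC.
  rewrite /N muE w2E /d /al /pick /v /m /b /=.
  rewrite !(conjM, conjB, conjV, conj1, conjK).
  have k (a b' : C) : nc a < 1 -> nc b' <= 1 -> 1 - a * b'^* != 0.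
    by move=> a1 b1; have := one_sub_neq0 (a := a^*) (z := b'^*); rewrite !nc_conj conjK; apply.
  have z1l x := ltW (z1 x).
  have c1 := one_sub_neq0 (z1 (s i)) (z1l (s j)).
  have c3 := one_sub_neq0 (z1 ord0) (z1l (s j)).
  have c4 := one_sub_neq0 w0lt (w1 ord0).
  have c5 := one_sub_neq0 (z1 ord0) (z1l ord0).
  have c6 := k _ _ w0lt (w1 (s i)).
  have c7 := one_sub_neq0 w0lt (w1 (s j)).
  have zs x : z (s x) - z ord0 != 0 by rewrite subr_eq0 (inj_eq zi) eq_sym neq_lift.
  have c8 : (z (s i))^* - (z ord0)^* != 0 by rewrite -conjB -nc_eq0 nc_conj nc_eq0.
  have c9 := zs j.
  have c10 := k _ _ (z1 ord0) (z1l (s i)).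
  move: (w (s i))^* (w (s j)) (w ord0) (w ord0)^* (z (s i))^* (z (s j)) (z ord0) (z ord0)^*
    c1 c3 c4 c5 c6 c7 c8 c9 c10 => a bb e e' x y t t' c1 c3 c4 c5 c6 c7 c8 c9 c10.
  by field; rewrite c1 c3 c9 c7 c10 c8 c6 c5 c4.
pose h x := b x * g1 x.
exists (fun x => (w ord0 + h x) / (1 + (w ord0)^* * h x)).
  exact: (schur_moebius w0lt (schurM (schur_blaschke (z1 ord0)) (conj hg1 g11))).
move=> i; have [j ->|->] := unliftP ord0 i; last first.
  by rewrite /h /b subrr !mul0r mulr0 !addr0 divr1.
have hm : h (z (s j)) = m j by rewrite /h (gv j) /v mulrC divfK.
by rewrite -/(s j) hm /m moebiusK.
Qed.

Lemma nevanlinna_pick_fin (I : finType) (z w : I -> C) : (forall i, nc (z i) < 1) ->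
  injective z -> psd (pick z w) -> exists2 g, schur_class g & forall i, g (z i) = w i.
Proof.
move=> z1 zi pM.
have [|g hg gv] := @nevanlinna_pick #|I| (z \o enum_val) (w \o enum_val)
  (fun i => z1 _) (inj_comp zi enum_val_inj).
  exact: (psd_pullback (M := pick z w) enum_val pM).
by exists g => // i; have := gv (enum_rank i); rewrite /= enum_rankK.
Qed.

Section DoubleNode.
Variables (I : finType) (z w : I -> C) (l : C).
Hypotheses (z1 : forall i, nc (z i) < 1) (zi : injective z).

(* The Gram matrix of [1], [z] and the kernels at the nodes; [inl b] stands for
   [z ^+ b]. A node may be 0, in which case the Gram matrix is singular. *)
Definition node_gram (i j : bool + I) : C :=
  match i, j with
  | inl b, inl b' => (b == b')%:R
  | inl b, inr j => z j ^+ b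
  | inr i, inl b => (z i)^* ^+ b
  | inr i, inr j => (1 - (z i)^* * z j)^-1
  end.

Definition node_val (i : bool + I) : C :=
  match i with inl _ => l^* | inr i => (w i)^* end.

(** The form |v|^2 - |T v|^2 for the operator T with diagonal [node_val]. On the [inr] part it is
    the Pick matrix; the [inl] part encodes the value l with vanishing derivative at 0. *)
Definition double_pick i j := (1 - node_val i * (node_val j)^*) * node_gram i j.

Lemma node_gram_hermitian : hermitian node_gram.
Proof.
move=> i j; case: i => [b|i]; case: j => [b'|j] /=.
- by rewrite eq_sym; case: (_ == _); rewrite ?conj1 ?conj0.
- by rewrite conjX.
- by rewrite conjX conjK.
- by rewrite conjV conjB conjM conjK conj1 mulrC.
Qed.

Lemma double_pick_hermitian : hermitian double_pick.
Proof.
move=> i j; rewrite /double_pick (node_gram_hermitian i j) conjM conjB conjM conjK conj1.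
by rewrite [node_val j * _]mulrC.
Qed.

Hypothesis pQ : psd double_pick.

Let hQ := double_pick_hermitian.

Lemma double_value_le1 : nc l <= 1.
Proof.
have := pQ (delta (inl false)); rewrite qfE bf_delta2 /double_pick /= mulr1 conjK.
have -> : 1 - l^* * l = (1 - nc l ^+ 2)%:C by rewrite rcB rc1 -mulcJ mulrC.
by rewrite /= subr_ge0 expr_le1// nc_ge0.
Qed.

Lemma double_value_unimodular : nc l = 1 -> forall i, w i = l.
Proof.
move=> l1 i; apply: eq_unimodular => //.
have := psd_cauchy (delta (inl false)) (delta (inr i)) hQ pQ.
rewrite qfE !bf_delta2 /double_pick /= !conjK expr0 !mulr1.
have -> : 1 - l^* * l = 0 by rewrite mulrC mulcJ l1 expr1n subrr.
rewrite mul0r => h; apply/eqP.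
by rewrite -nc_eq0 -sqrf_eq0 eq_le sqr_ge0 andbT.
Qed.

(** The kernel at 0 is the function 1, so their difference is a null vector of the Gram matrix, on
    which the form is -|w_i - l|^2. *)
Lemma double_value0 i : z i = 0 -> w i = l.
Proof.
move=> z0; pose v j : C := delta (inl false) j + (-1) * delta (inr i) j.
have := pQ v; rewrite /v qfD !qfE !bf_delta2 /double_pick /= z0 mulr0 subr0 invr1.
rewrite !conjK expr0 !mulr1.
have -> : 1 - l^* * l + (-1)^* * (1 - l^* * w i) + -1 * (1 - (w i)^* * l) +
    -1 * (-1)^* * (1 - (w i)^* * w i) = - ((w i - l) * (w i - l)^*).
  by rewrite conjN conj1 conjB; ring.
rewrite mulcJ ReN /= oppr_ge0 => h.
by apply/eqP; rewrite -subr_eq0 -nc_eq0 -sqrf_eq0 eq_le h sqr_ge0.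
Qed.

Lemma value_le1 i : nc (w i) <= 1.
Proof.
apply: (pick_diag_le1 (z1 i)); have := psd_pullback (fun i : I => inr bool i) pQ.
congr psd; apply/funext => j; apply/funext => k.
by rewrite /double_pick /pick /= conjK.
Qed.

(* [g] is sought in the form [(l + z^2 g1) / (1 + conj(l) z^2 g1)]. *)
Lemma pick_square_psd : nc l < 1 ->
  psd (pick (fun i : {i | z i != 0} => z (val i))
    (fun i => (w (val i) - l) / (1 - l^* * w (val i)) / z (val i) ^+ 2)).
Proof.
move=> l1; have w1 := value_le1.
set J := ({i | z i != 0} : finType); pose s (i : J) := inr bool (val i) : bool + I.
pose mu := 1 - nc l ^+ 2; have mu0 : 0 < mu by rewrite subr_gt0 expr_lt1// nc_ge0.
have muE : mu%:C = 1 - l^* * l by rewrite rcB rc1 -mulcJ mulrC.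
pose a b (j : J) := double_pick (inl b) (s j).
(* The Schur complement, multiplied by mu, of the block of 1 and z, which is mu times the identity.
   Restricting to nonzero nodes makes the division by z_i^2 legitimate. *)
pose N i j := mu%:C * double_pick (s i) (s j) +
  (-1) * ((a false i)^* * a false j + (a true i)^* * a true j).
have pN : psd N.
  move=> c; have d0 : bf double_pick (delta (inl false)) (delta (inl true)) = 0.
    by rewrite bf_delta2 /double_pick /= mulr0.
  have db b : qf double_pick (delta (inl b)) = mu%:C.
    by rewrite qfE bf_delta2 /double_pick /= eqxx mulr1 conjK muE.
  have := psd_cauchy2 (spread s c) hQ pQ d0 (db false) (db true).
  rewrite !bf_delta !sum_spreadJ qf_spread => h.
  have -> : qf N c = mu%:C * qf (fun i j => double_pick (s i) (s j)) c -
    ((nc (\sum_j a false j * (c j)^*) ^+ 2)%:C + (nc (\sum_j a true j * (c j)^*) ^+ 2)%:C).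
    rewrite !sqr_nc_sum; rewrite /qf mulr_sumr -big_split -sumrB; apply: eq_bigr => i _.
    rewrite mulr_sumr -big_split -sumrB; apply: eq_bigr => j _; rewrite /N /=; ring.
  by rewrite ReD ReN ReD Re_realM /= subr_ge0.
pose d (i : J) := (1 - (w (val i))^* * l) * ((z (val i))^*) ^+ 2.
have k (x y : C) : nc x < 1 -> nc y <= 1 -> 1 - y^* * x != 0.
  move=> x1 y1; have := one_sub_neq0 (a := x^*) (z := y^*).
  by rewrite !nc_conj conjK mulrC; apply.
have d0 i : d i != 0.
  apply: mulf_neq0; first exact: k.
  by rewrite expf_neq0// -nc_eq0 nc_conj nc_eq0; exact: valP i.
apply: (psd_scale d0) pN => i j.
have zi0 : (z (val i))^* != 0 by rewrite -nc_eq0 nc_conj nc_eq0; exact: valP i.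
have zj0 : z (val j) != 0 by exact: valP j.
have c1 := one_sub_neq0 (z1 (val i)) (ltW (z1 (val j))).
have c2 := one_sub_neq0 l1 (w1 (val j)).
have c3 := k _ _ l1 (w1 (val i)).
rewrite /N muE /d /a /double_pick /pick /= !expr1 !expr0 !mulr1.
rewrite !(conjM, conjB, conjV, conjX, conj1, conjK).
move: (w (val i))^* (w (val j)) l l^* (z (val i))^* (z (val j)) zi0 zj0 c1 c2 c3 =>
  x y e e' t t' zi0 zj0 c1 c2 c3.
by field; rewrite c1 zj0 c2 zi0 [e * x]mulrC c3.
Qed.

Theorem pick_double : exists2 g, schur_class g &
  derive1 (g : C^o -> C^o) 0 = 0 /\ forall i, g (z i) = w i.
Proof.
have [l1|l1] := eqVneq (nc l) 1.
  exists (fun=> l); first by apply: schur_cst; rewrite l1.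
  by split=> [|i]; [exact: derive1_cst|rewrite double_value_unimodular].
have {}l1 : nc l < 1 by rewrite lt_neqAle l1 double_value_le1.
have [||g1 hg1 gv] := nevanlinna_pick_fin _ _ (pick_square_psd l1).
- by move=> i; exact: z1.
- by move=> i j /zi /val_inj.
pose h x := x ^+ 2 * g1 x.
have hh : schur_class h.
  have -> : h = (fun x => x * (x * g1 x)) by apply/funext => x; rewrite /h expr2 mulrA.
  exact: (schurM (schur_id R) (schurM (schur_id R) hg1)).
exists (fun x => (l + h x) / (1 + l^* * h x)); first exact: schur_moebius.
split.
  suff : cderiv (fun x => (l + h x) / (1 + l^* * h x)) 0 0 by move=> /cderiv_derivable[].
  move=> e e0; have l2 : 0 < 1 - nc l by rewrite subr_gt0.
  (* The difference from l has modulus at most |x|^2 / (1 - |l|). *)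
  exists (Num.min 1 (e * (1 - nc l))); first by rewrite lt_min ltr01 mulr_gt0.
  move=> x; rewrite subr0 mul0r subr0 lt_min => /andP[x1 xe].
  have xd : disk x by exact/diskE.
  have hx : nc (h x) <= nc x ^+ 2.
    by rewrite ncM ncX ler_piMr ?sqr_ge0//; have [_ ->] := hg1.
  have hx1 : nc (h x) <= 1 by have [_ ->] := hh.
  have n0 := one_add_neq0 l1 hx1.
  have h0 : h 0 = 0 by rewrite /h expr0n mul0r.
  rewrite h0 mulr0 !addr0 divr1.
  have -> : (l + h x) / (1 + l^* * h x) - l = (1 - l * l^*) * h x / (1 + l^* * h x).
    by field.
  rewrite ncM [nc ((1 - _) * _)]ncM ncV ler_pdivrMr ?nc_gt0//.
  have b1 : 1 - nc l <= nc (1 + l^* * h x).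
    have := ncB (1 + l^* * h x) (l^* * h x); rewrite addrK nc1 ncM nc_conj.
    have := nc_ge0 l; nra.
  have b2 : nc (1 - l * l^*) <= 1.
    have -> : 1 - l * l^* = (1 - nc l ^+ 2)%:C by rewrite rcB rc1 mulcJ.
    have := nc_ge0 l; rewrite nc_real => l0; rewrite ger0_norm; nra.
  have x0 := nc_ge0 x; have hx0 := nc_ge0 (h x); have b3 := nc_ge0 (1 - l * l^*).
  apply: (@le_trans _ _ (nc x * nc x)).
    apply: (@le_trans _ _ (1 * nc x ^+ 2)); last by rewrite mul1r expr2.
    by apply: ler_pM.
  apply: (@le_trans _ _ (e * nc x * (1 - nc l))).
    by rewrite mulrAC ler_wpM2r// ltW.
  by rewrite ler_wpM2l// mulr_ge0// ltW.
move=> i; have [zi0|zi0] := eqVneq (z i) 0.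
  by rewrite zi0 /h expr0n mul0r mulr0 !addr0 divr1 double_value0.
have hm : h (z i) = (w i - l) / (1 - l^* * w i).
  by rewrite /h (gv (exist _ i zi0)) /= mulrC divfK// expf_neq0.
by rewrite hm moebiusK// value_le1.
Qed.

End DoubleNode.

End NevanlinnaPick.

(** * The two inequalities *)

Section AnalyticCoefficients.
Variable R : realType.
Local Notation C := R[i].
Implicit Types (f g h x : C -> C) (al be : C).

Lemma taylor0E h : taylor h 0 = h 0.
Proof. by rewrite /taylor /= fact0 divr1. Qed.

Lemma taylor1E h : taylor h 1 = derive1 (h : C^o -> C^o) 0.
Proof. by rewrite /taylor derive1n1 divr1. Qed.

Lemma holomorphicZ c f : holomorphic f -> holomorphic (fun z => c * f z).
Proof. by move=> hf; exact: pser_holomorphic (pserZ c (holomorphic_taylor hf)). Qed.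

Lemma taylorD f g : holomorphic f -> holomorphic g ->
  taylor (fun z => f z + g z) = (fun n => taylor f n + taylor g n).
Proof.
by move=> hf hg; exact: pser_taylor (pserD (holomorphic_taylor hf) (holomorphic_taylor hg)).
Qed.

Lemma taylorZ c f : holomorphic f -> taylor (fun z => c * f z) = (fun n => c * taylor f n).
Proof. by move=> hf; exact: pser_taylor (pserZ c (holomorphic_taylor hf)). Qed.

Lemma disk0 : disk (0 : C).
Proof. by apply/diskE; rewrite nc0. Qed.

Lemma taylorM1 f g : holomorphic f -> holomorphic g ->
  taylor (fun z => f z * g z) 1 = f 0 * taylor g 1 + taylor f 1 * g 0.
Proof.
move=> hf hg; rewrite !taylor1E !derive1E.
rewrite (@deriveM _ C^o (f : C^o -> C^o) g 0 1 (hf _ disk0) (hg _ disk0)).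
by congr (_ + _); exact: mulrC.
Qed.

Lemma l2D (a b : nat -> C) : l2 a -> l2 b -> l2 (fun n => a n + b n).
Proof.
move=> [K hK] [L hL]; exists (2 * (K + L)) => n.
apply: (@le_trans _ _ (2 * (\sum_(i < n) nc (a i) ^+ 2 + \sum_(i < n) nc (b i) ^+ 2))).
  rewrite -big_split mulr_sumr; apply: ler_sum => i _ /=.
  have := ncD (a i) (b i); have := nc_ge0 (a i); have := nc_ge0 (b i).
  have := nc_ge0 (a i + b i); have := sqr_ge0 (nc (a i) - nc (b i)); nra.
by rewrite ler_wpM2l// lerD.
Qed.

Lemma l2Z c (a : nat -> C) : l2 a -> l2 (fun n => c * a n).
Proof.
move=> [K hK]; exists (nc c ^+ 2 * K) => n.
apply: (@le_trans _ _ (nc c ^+ 2 * \sum_(i < n) nc (a i) ^+ 2)).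
  by rewrite mulr_sumr; apply: ler_sum => i _; rewrite ncM exprMn.
by rewrite ler_wpM2l ?sqr_ge0.
Qed.

Lemma l2_sum J (r : seq J) (a : J -> nat -> C) : (forall j, l2 (a j)) ->
  l2 (fun n => \sum_(j <- r) a j n).
Proof.
move=> ha; elim: r => [|j r IH].
  by exists 0 => n; rewrite big1// => i _; rewrite big_nil nc0 expr0n.
have [K hK] := l2D (ha j) IH; exists K => n; apply: le_trans (hK n).
by apply: ler_sum => i _; rewrite big_cons.
Qed.

Lemma l2_indicator (k : nat) : l2 (fun n => (n == k)%:R : C).
Proof.
exists 1 => n; have [kn|nk] := ltnP k n.
  rewrite (bigD1 (Ordinal kn))//= eqxx nc1 expr1n big1 ?addr0// => i.
  by rewrite -val_eqE /= => /negbTE ->; rewrite nc0 expr0n.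
rewrite big1// => i _; case: eqP => [e|]; last by rewrite nc0 expr0n.
by move: (ltn_ord i); rewrite e ltnNge nk.
Qed.

Lemma l2_geometric (w : C) : nc w < 1 -> l2 (fun n => w ^+ n).
Proof.
move=> w1; have w01 : 0 <= nc w < 1 by rewrite nc_ge0.
exists (1 - nc w)^-1 => n; apply: le_trans (geom_sum_le n w01).
apply: ler_sum => i _; rewrite ncX expr2 ler_piMl ?exprn_ge0 ?nc_ge0//.
by rewrite exprn_ile1 ?nc_ge0// ltW.
Qed.

Lemma pser_shift b g : pser b g ->
  pser (fun n => if n is m.+1 then b m else 0) (fun z => z * g z).
Proof.
move=> bg z z1; apply/(ccvg_shift _ _ 1).
apply: (ccvg_eq (u := fun n => z * psum b z n)); last first.
  by apply: ccvgM; [exact: ccvg_cst|exact: bg].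
move=> n; rewrite addn1 /psum big_ord_recl mul0r add0r mulr_sumr.
by apply: eq_bigr => i _; rewrite exprS mulrCA.
Qed.

Lemma l2_shift (b : nat -> C) : l2 b -> l2 (fun n => if n is m.+1 then b m else 0).
Proof.
move=> [K hK]; exists K => n; apply: le_trans (hK n).
case: n => [|n]; first by rewrite !big_ord0.
rewrite big_ord_recl nc0 expr0n add0r; exact: (@sum_sqr_homo R b n n.+1 (leqnSn n)).
Qed.

Lemma h2dotDl g h k : H2 g -> H2 h -> H2 k ->
  h2dot (fun z => g z + h z) k = h2dot g k + h2dot h k.
Proof.
move=> Hg Hh Hk; have /H2E[hg _] := Hg; have /H2E[hh _] := Hh; apply: h2dot_lim.
apply: (ccvg_eq (u := fun n => dots (taylor g) (taylor k) n + dots (taylor h) (taylor k) n)).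
  by move=> n; rewrite taylorD// /dots -big_split; apply: eq_bigr => i _; rewrite mulrDl.
by apply: ccvgD; exact: h2dot_cvg.
Qed.

Lemma pser_H2 a f : pser a f -> l2 a -> H2 f.
Proof. by move=> af la; apply/H2E; rewrite (pser_taylor af); split=> //; exact: pser_holomorphic af. Qed.

(** The first two coefficients are proportional to (al, be); from here on the space is handled
    through this one linear equation, to which [H2_H2ab] is the converse. *)
Lemma H2ab_H2 al be h : H2ab al be h -> H2 h /\
  be * taylor h 0 = al * taylor h 1.
Proof.
move=> [c [g [/H2E[hg lg] hE]]]; have gp := holomorphic_taylor hg.
have p := pserD (pserD (pserZ (c * al) (@pserXn R 0)) (pserZ (c * be) (@pserXn R 1)))
   (pser_shift (pser_shift gp)).
have lp := l2D (l2D (l2Z (c * al) (l2_indicator 0)) (l2Z (c * be) (l2_indicator 1)))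
   (l2_shift (l2_shift lg)).
have {}p := pser_ext (g := h) _ p.
have ph' : pser (fun n => c * al * (n == 0)%N%:R + c * be * (n == 1)%N%:R +
    (if n is m.+1 then if m is k.+1 then taylor g k else 0 else 0)) h.
  by apply: p => z zd; rewrite hE// expr0 expr1; ring.
split; first exact: pser_H2 ph' lp.
by rewrite (pser_taylor ph') /=; ring.
Qed.

Lemma H2_H2ab al be h : nc al ^+ 2 + nc be ^+ 2 = 1 -> H2 h ->
  be * taylor h 0 = al * taylor h 1 -> H2ab al be h.
Proof.
move=> ab1 /H2E[hh lh] e; set a := taylor h in lh e.
have hp : pser a h by exact: holomorphic_taylor.
have ab : al * al^* + be * be^* = 1 by rewrite !mulcJ -rcD ab1.
(* At 0 the quotient takes its limit, the coefficient of z^2. *)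
pose g z := if z == 0 then a 2%N else (h z - a 0%N - a 1%N * z) / z ^+ 2.
have gp : pser (fun n => a n.+2) g.
  move=> z z1; rewrite /g; case: eqP => [->|/eqP z0].
    apply/(ccvg_shift _ _ 1); apply: (ccvg_eq (u := fun=> a 2%N)); last exact: ccvg_cst.
    move=> n; rewrite addn1 /psum big_ord_recl /= expr0 mulr1 big1 ?addr0// => i _.
    by rewrite expr0n /= mulr0.
  apply: (ccvg_eq (u := fun n => (psum a z (n + 2) - a 0%N - a 1%N * z) / z ^+ 2)).
    move=> n; apply: (canLR (mulfK _)); first by rewrite expf_neq0.
    rewrite addn2 /psum 2!big_ord_recl /= expr0 mulr1 expr1 mulr_suml.
    rewrite [X in X - _ - _]addrC addrK [X in X - _]addrC addrK; apply: eq_bigr => i _.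
    by rewrite /bump /= !add1n -[in RHS]mulrA -[in RHS]exprD addn2.
  apply: ccvgM; last exact: ccvg_cst.
  apply: ccvgB; last exact: ccvg_cst.
  apply: ccvgB; last exact: ccvg_cst.
  exact/(ccvg_shift (psum a z))/hp.
(* The scalar is the inner product of the coefficient pair with the unit vector (al, be), to which
   the pair is proportional. *)
exists (a 0%N * al^* + a 1%N * be^*), g; split.
  apply: pser_H2 gp _; have [K hK] := lh; exists K => n; apply: le_trans (hK n.+2).
  rewrite 2!big_ord_recl /=; apply: (@le_trans _ _ (\sum_(i < n) nc (a (bump 0 (bump 0 i))) ^+ 2)).
    by apply: ler_sum => i _; rewrite /bump /= !add1n.
  have := sqr_ge0 (nc (a 0%N)); have := sqr_ge0 (nc (a (bump 0 0))); lra.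
move=> z zd.
have h0 : h z = a 0%N + a 1%N * z + z ^+ 2 * g z.
  rewrite /g; case: eqP => [->|/eqP z0].
    by rewrite mulr0 addr0 expr0n mul0r addr0 /a taylor0E.
  by rewrite [z ^+ 2 * _]mulrC divfK ?expf_neq0//; ring.
rewrite h0; congr (_ + _).
have -> : (a 0%N * al^* + a 1%N * be^*) * (al + be * z) =
   (a 0%N * (al * al^*) + be^* * (al * a 1%N)) + (al^* * (be * a 0%N) + a 1%N * (be * be^*)) * z by ring.
have k1 : be^* * (al * a 1%N) = be^* * (be * a 0%N) by rewrite e.
have k2 : al^* * (be * a 0%N) = al^* * (al * a 1%N) by rewrite e.
rewrite k1 k2.
have -> : a 0%N * (al * al^*) + be^* * (be * a 0%N) = a 0%N * (al * al^* + be * be^*) by ring.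
have -> : al^* * (al * a 1%N) + a 1%N * (be * be^*) = a 1%N * (al * al^* + be * be^*) by ring.
by rewrite ab !mulr1.
Qed.

(** As f'(0) = 0, the first two coefficients are both multiplied by f(0). *)
Lemma Hinf1_mul_H2ab al be f h : nc al ^+ 2 + nc be ^+ 2 = 1 -> Hinf1 f -> H2ab al be h ->
  H2ab al be (fun z => f z * h z).
Proof.
move=> ab1 [hf [M hM] f1] /H2ab_H2[Hh e]; have /H2E[hh _] := Hh.
have M0 : 0 <= M by apply: le_trans (hM 0 disk0); exact: nc_ge0.
apply: (H2_H2ab ab1); first exact: (multiplier hf M0 hM Hh).1.
rewrite (taylorM1 hf hh) taylor0E [taylor f 1]taylor1E f1 mul0r addr0.
by rewrite -[h 0]taylor0E mulrCA e mulrCA.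
Qed.

End AnalyticCoefficients.

(** * The norms are at most the distance *)

Section EasyInequality.
Variable R : realType.
Local Notation C := R[i].
Implicit Types (f g h p x : C -> C) (al be : C).

Lemma Hinf1B f g : Hinf1 f -> Hinf1 g -> Hinf1 (fun z => f z - g z).
Proof.
move=> [hf [M hM] f1] [hg [N hN] g1]; split.
- by move=> z zd; apply: (@derivableB _ C^o C^o f g); [exact: hf|exact: hg].
- exists (M + N) => z zd; apply: le_trans (ncB _ _) _.
  by apply: lerD; [exact: hM|exact: hN].
rewrite derive1E (@deriveB _ C^o C^o f g 0 1 (hf _ (disk0 R)) (hg _ (disk0 R))).
by rewrite -!derive1E f1 g1 subrr.
Qed.

Lemma pser_zero : pser (fun=> 0) (fun=> 0 : C).
Proof.
move=> z _; apply: (ccvg_eq (u := fun=> 0)); last exact: ccvg_cst.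
by move=> n; rewrite /psum big1// => i _; rewrite mul0r.
Qed.

Lemma sum_sqr_zero n : \sum_(i < n) nc ((fun=> 0 : C) (i : nat)) ^+ 2 = 0.
Proof. by rewrite big1// => i _; rewrite nc0 expr0n. Qed.

Lemma H2_zero : H2 (fun=> 0 : C).
Proof. by apply: (pser_H2 pser_zero); exists 0 => n; rewrite sum_sqr_zero. Qed.

Lemma h2norm0 : h2norm (fun=> 0 : C) = 0.
Proof.
apply/eqP; rewrite eq_le h2norm_ge0 andbT.
apply: h2norm_le => //; first exact: H2_zero.
by rewrite (pser_taylor pser_zero) expr0n; apply: sqnorm_le => n; rewrite sum_sqr_zero.
Qed.

Lemma MF_zero (F : set C) al be : nc al ^+ 2 + nc be ^+ 2 = 1 -> MF F al be (fun=> 0).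
Proof.
move=> ab1; split; first by apply: (H2_H2ab ab1 H2_zero); rewrite (pser_taylor pser_zero) !mulr0.
move=> g _; apply: h2dot_lim; apply: (ccvg_eq (u := fun=> 0)); last exact: ccvg_cst.
by move=> n; rewrite (pser_taylor pser_zero) /dots big1// => i _; rewrite mul0r.
Qed.

(** For the adjoint vector k, |k|^2 = <f k, h> = <(f - g) k, h>, because g k vanishes on F and h is
    orthogonal to such functions; then [multiplier] applies. *)
Lemma adjoint_MF_le (F : set C) al be f g h (M : R) :
  nc al ^+ 2 + nc be ^+ 2 = 1 -> Hinf1 f -> idealF F g ->
  (forall z, disk z -> nc (f z - g z) <= M) -> MF F al be h -> h2norm h <= 1 ->
  h2norm (adjoint (H2ab al be) (mult_op f) h) <= M.
Proof.
move=> ab1 Hf [Hg gF] hM [Kh hN] h1.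
have M0 : 0 <= M by apply: le_trans (hM 0 (disk0 R)); exact: nc_ge0.
(* The default value of [xget] has norm 0, which is at most M. *)
rewrite /adjoint; case: xgetP => [k _ [Kk hk]|_]; last by rewrite h2norm0.
have [Hh _] := H2ab_H2 Kh; have [Hk _] := H2ab_H2 Kk.
have [Hfk _] := H2ab_H2 (Hinf1_mul_H2ab ab1 Hf Kk).
have Kgk := Hinf1_mul_H2ab ab1 Hg Kk; have [Hgk _] := H2ab_H2 Kgk.
pose p z := f z - g z.
have hp : holomorphic p by have [] := Hinf1B Hf Hg.
have [Hpk pk] := multiplier hp M0 hM Hk.
have gk0 : h2dot (fun z => g z * k z) h = 0.
  rewrite h2dotJ// hN ?conj0//; split=> // z zF.
  by rewrite gF// mul0r.
have E : (h2norm k ^+ 2)%:C = h2dot (fun z => p z * k z) h.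
  rewrite -h2dot_self// -(hk k Kk).
  have -> : mult_op f k = (fun z => p z * k z + g z * k z).
    by apply/funext => z; rewrite /mult_op /p -mulrDl subrK.
  by rewrite h2dotDl// gk0 addr0.
have K0 := h2norm_ge0 k; set K := h2norm k in K0 E pk *.
rewrite leNgt; apply/negP => MK.
(* A number strictly between M and K, positive even if M = 0. With the weight M'^(-2), [h2dot_amgm]
   gives 2 K^2 <= K^2 + M'^2, contradicting M' < K. *)
pose M' := (M + K) / 2; have M'0 : 0 < M' by rewrite /M'; lra.
have M'2 : 0 < (M' ^+ 2)^-1 by rewrite invr_gt0 exprn_gt0.
have := h2dot_amgm Hpk Hh M'2; rewrite -E nc_real ger0_norm ?sqr_ge0// invrK.
set n1 := h2norm _ in pk *; set n2 := h2norm h in h1 * => le.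
have n10 : 0 <= n1 by exact: h2norm_ge0.
have n20 : 0 <= n2 by exact: h2norm_ge0.
have l1 : n1 ^+ 2 <= (M' * K) ^+ 2.
  have MK0 : 0 <= M' * K by rewrite mulr_ge0// ltW.
  by rewrite ler_pXn2r ?nnegrE//; apply: le_trans pk _; rewrite ler_wpM2r// /M'; lra.
have M'p : 0 < M' ^+ 2 by rewrite exprn_gt0.
have l2' : (M' ^+ 2)^-1 * n1 ^+ 2 <= K ^+ 2.
  by rewrite (ler_pdivrMl _ _ M'p) -exprMn.
have l3 : M' ^+ 2 * n2 ^+ 2 <= M' ^+ 2.
  by rewrite ler_piMr ?sqr_ge0// expr_le1.
have : K ^+ 2 <= M' ^+ 2 by lra.
rewrite ler_pXn2r// ?nnegrE//; last exact: ltW.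
rewrite /M'; lra.
Qed.

Lemma op_norm_le_dist (F : set C) al be f :
  nc al ^+ 2 + nc be ^+ 2 = 1 -> Hinf1 f ->
  (op_norm_on (MF F al be) (adjoint (H2ab al be) (mult_op f)) <= sup_dist f (idealF F))%E.
Proof.
move=> ab1 Hf; apply: le_ereal_inf_tmp => _ [g gI <-].
apply: ge_ereal_sup => _ [h [Mh h1] <-].
have ub z : disk z -> ((nc (f z - g z))%:E <= sup_norm (fun z => (f z - g z)%R))%E.
  by move=> zd; apply: ereal_sup_ubound; exists z.
case E : (sup_norm _) => [M| |].
- rewrite lee_fin; apply: adjoint_MF_le gI _ Mh h1 => // z zd.
  by have := ub z zd; rewrite E lee_fin.
- by rewrite leey.
- by have := ub 0 (disk0 R); rewrite E.
Qed.

End EasyInequality.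

(** * The span of 1, z and the Szego kernels *)

Section KernelSpace.
Variables (R : realType) (I : finType) (z : I -> R[i]).
Local Notation C := R[i].
Hypothesis z1 : forall i, nc (z i) < 1.
Local Notation J := (bool + I)%type.
Local Notation G := (node_gram z).
Implicit Types (v w : J -> C) (x g : C -> C) (al be : C).

Definition node_coef (j : J) (n : nat) : C :=
  match j with inl b => (n == b)%:R | inr i => (z i)^* ^+ n end.

Definition node_fun v (y : C) : C :=
  \sum_j v j * match j with inl b => y ^+ b | inr i => (1 - (z i)^* * y)^-1 end.

Definition node_eval x (j : J) : C :=
  match j with inl b => taylor x b | inr i => x (z i) end.

Lemma pser_node_fun v : pser (fun n => \sum_j v j * node_coef j n) (node_fun v).
Proof.
apply: pser_sum => -[b|i]; apply: (@pserZ R); first exact: (@pserXn R b).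
exact: pser_szego.
Qed.

Lemma taylor_node_fun v : taylor (node_fun v) = (fun n => \sum_j v j * node_coef j n).
Proof. exact: pser_taylor (pser_node_fun v). Qed.

Lemma H2_node_fun v : H2 (node_fun v).
Proof.
apply: (pser_H2 (pser_node_fun v)); apply: l2_sum => j; apply: l2Z.
by case: j => [b|i] /=; [exact: l2_indicator|apply: l2_geometric; rewrite nc_conj].
Qed.

(** The reproducing property: monomials represent Taylor coefficients, and Szego kernels represent
    point values. *)
Lemma h2dot_node_fun x w : H2 x -> h2dot x (node_fun w) = \sum_j (w j)^* * node_eval x j.
Proof.
move=> /H2E[hx _]; apply: h2dot_lim; rewrite taylor_node_fun.
apply: (ccvg_eq (u := fun n => \sum_j (w j)^* * \sum_(k < n) taylor x k * (node_coef j k)^*)).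
  move=> n; under eq_bigr do rewrite mulr_sumr.
  rewrite exchange_big; apply: eq_bigr => k _; rewrite conj_sum mulr_sumr.
  by apply: eq_bigr => j _; rewrite conjM mulrCA.
apply: ccvg_sum => -[b|i] _; apply: ccvgM; try exact: ccvg_cst.
  apply/(ccvg_shift _ _ b.+1); apply: (ccvg_eq (u := fun=> taylor x b)); last exact: ccvg_cst.
  move=> n; have bn : (b < n + b.+1)%N by rewrite ltn_addl.
  rewrite (bigD1 (Ordinal bn))//= eqxx conj1 mulr1 big1 ?addr0// => k.
  by rewrite -val_eqE /= => /negbTE ->; rewrite conj0 mulr0.
apply: (ccvg_eq (u := psum (taylor x) (z i))); last exact: (holomorphic_taylor hx).
by move=> n; apply: eq_bigr => k _; rewrite /= conjX conjK.
Qed.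

Lemma node_eval_fun v j : node_eval (node_fun v) j = \sum_i v i * G i j.
Proof.
case: j => [b|j] /=.
  by rewrite taylor_node_fun; apply: eq_bigr => -[b'|i] _ //=; case: b b' => -[].
by apply: eq_bigr => -[b'|i] _.
Qed.

Lemma h2dot_node v w : h2dot (node_fun v) (node_fun w) = bf G v w.
Proof.
rewrite h2dot_node_fun; last exact: H2_node_fun.
rewrite /bf exchange_big; apply: eq_bigr => j _; rewrite node_eval_fun mulr_sumr.
by apply: eq_bigr => i _ /=; ring.
Qed.

Lemma qf_node v : qf G v = (h2norm (node_fun v) ^+ 2)%:C.
Proof. by rewrite qfE -h2dot_node; exact: h2dot_self (H2_node_fun v). Qed.

End KernelSpace.

Section UnitVectors.
Variable R : realType.
Local Notation C := R[i].

Lemma normalize_pair (a b : C) : (a != 0) || (b != 0) -> exists2 n : C,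
  n != 0 & nc (n^-1 * a) ^+ 2 + nc (n^-1 * b) ^+ 2 = 1.
Proof.
move=> ab; have N : 0 < nc a ^+ 2 + nc b ^+ 2.
  case/orP: ab => h.
    by apply: ltr_wpDr; rewrite ?sqr_ge0// exprn_gt0// nc_gt0.
  by apply: ltr_wpDl; rewrite ?sqr_ge0// exprn_gt0// nc_gt0.
exists (Num.sqrt (nc a ^+ 2 + nc b ^+ 2))%:C.
  by rewrite -nc_gt0 nc_real normr_gt0 gt_eqF// sqrtr_gt0.
rewrite !ncM !ncV nc_real !exprMn -mulrDr ger0_norm ?sqrtr_ge0//.
by rewrite exprVn sqr_sqrtr ?ltW// mulVf// gt_eqF.
Qed.

(** Normalize (a, b) if it is not 0; otherwise take k = 0 and a unit vector orthogonal to (c, d),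
    any one if that is 0 as well. *)
Lemma unit_direction (a b c d : C) : a * c^* + b * d^* = 0 -> exists u v k : C,
  [/\ nc u ^+ 2 + nc v ^+ 2 = 1, u * c^* + v * d^* = 0, a = k * u & b = k * v].
Proof.
move=> abcd; have [ab|] := boolP ((a != 0) || (b != 0)).
  have [n n0 e] := normalize_pair ab; exists (n^-1 * a), (n^-1 * b), n.
  by rewrite -!mulrA -mulrDr abcd mulr0 !mulVKf.
rewrite negb_or !negbK => /andP[/eqP -> /eqP ->].
have [cd|] := boolP ((d != 0) || (c != 0)).
  have [n n0 e] := normalize_pair cd; exists (n^-1 * d)^*, (- (n^-1 * c)^*), 0.
  rewrite ncN !nc_conj !mul0r; split=> //; rewrite !conjM; ring.
rewrite negb_or !negbK => /andP[/eqP -> /eqP ->]; exists 1, 0, 0.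
by rewrite nc1 nc0 conj0 !mul0r !mulr0 addr0 expr1n expr0n addr0.
Qed.

End UnitVectors.

(** * The distance is at most the supremum *)

Section CriticalPoints.
Variables (R : realType) (I : finType) (z : I -> R[i]).
Local Notation C := R[i].
Hypothesis z1 : forall i, nc (z i) < 1.
Local Notation J := (bool + I)%type.
Local Notation G := (node_gram z).
Implicit Types (v : J -> C) (x k g : C -> C) (al be l : C).

(** Testing the two adjoint identities on k and on the chosen vector k' gives <k', k'> = <k', k> and
    <k, k> = <k, k'>. So exhibiting one adjoint vector determines the norm. *)
Lemma h2norm_adjoint al be (T : (C -> C) -> C -> C) x k : H2ab al be k ->
  (forall g, H2ab al be g -> h2dot (T g) x = h2dot g k) ->
  h2norm (adjoint (H2ab al be) T x) = h2norm k.
Proof.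
move=> Kk hk; rewrite /adjoint; case: xgetP => [k' _ [Kk' hk']|/(_ k)]; last by case.
have [Hk _] := H2ab_H2 Kk; have [Hk' _] := H2ab_H2 Kk'.
apply/eqP; rewrite -(@eqrXn2 _ 2) ?h2norm_ge0//; apply/eqP/ext_inj.
rewrite -!h2dot_self// -(hk' _ Kk') (hk _ Kk') h2dotJ// -(hk' _ Kk) (hk _ Kk).
by rewrite h2dot_self// conj_rc.
Qed.

Variables (F : set C) (f : C -> C) (t : R).
Hypotheses (FE : forall y, F y <-> exists i, y = z i) (Hf : Hinf1 f) (t0 : 0 < t).
Hypothesis adjoint_lt : forall al be x, nc al ^+ 2 + nc be ^+ 2 = 1 -> MF F al be x ->
  h2norm x <= 1 -> h2norm (adjoint (H2ab al be) (mult_op f) x) < t.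

(* The diagonal of [T_l]. *)
Definition symbol l (j : J) : C :=
  match j with inl _ => l | inr i => (f (z i) / t%:C)^* end.
Definition low_part (j : J) : C := match j with inl _ => 1 | inr _ => 0 end.
Local Notation scale p v := (fun j : J => p j * v j).

Let tC : t%:C != 0 :> C.
Proof. by rewrite -nc_gt0 nc_real normr_gt0 gt_eqF. Qed.

(** The normalization makes the adjoint image of norm exactly t, although x has norm at most 1 and
    its image must have norm below t. *)
Lemma critical_unit l v : bf G (scale low_part v) (scale (symbol l) v) = 0 ->
  Re (qf G (scale (symbol l) v)) = 1 -> Re (qf G v) <= 1 -> False.
Proof.
move=> crit X1 v1.
pose X := node_fun z (scale (symbol l) v); have HX : H2 X by exact: H2_node_fun.
pose a := v (inl false); pose b := v (inl true).
have /unit_direction[u0 [u1 [k [u_unit uX ak bk]]]] : a * (taylor X 0)^* + b * (taylor X 1)^* = 0.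
  have := crit; rewrite -(h2dot_node z1) h2dotJ; [|exact: H2_node_fun|exact: HX].
  rewrite h2dot_node_fun// conj_sum big_sumType big_bool /= [X in _ + X]big1 => [|i _].
    by rewrite !conjM !conjK !mul1r addr0 addrC.
  by rewrite mul0r conj0 mul0r conj0.
have uXJ : u0^* * taylor X 0 + u1^* * taylor X 1 = 0.
  have := congr1 (fun q => q^*) uX; rewrite conj0.
  by move: (taylor X 0) (taylor X 1) => p q; rewrite conjD !conjM !conjK.
pose u (j : J) : C := match j with inl false => u0 | inl true => u1 | inr _ => 0 end.
(* Orthogonality to u_0 + u_1 z reads conj(u_0) h_0 + conj(u_1) h_1 = 0, which is the equation be
   h_0 = al h_1 of [H2ab al be]. *)
pose al := - u1^*; pose be := u0^*.
have ab1 : nc al ^+ 2 + nc be ^+ 2 = 1 by rewrite /al /be ncN !nc_conj addrC.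
have dot_u g : H2 g -> h2dot g (node_fun z u) = be * taylor g 0 - al * taylor g 1.
  move=> Hg; rewrite h2dot_node_fun// big_sumType big_bool /= [X in _ + X]big1 => [|i _].
    by rewrite addr0 addrC /al mulNr opprK.
  by rewrite conj0 mul0r.
have K_u g : H2ab al be g -> be * taylor g 0 - al * taylor g 1 = 0.
  by move=> /H2ab_H2[_ ->]; rewrite subrr.
have uu : bf G u u = 1.
  rewrite -(h2dot_node z1) dot_u; last exact: H2_node_fun.
  have te (c : bool) : taylor (node_fun z u) c = u (inl c).
    have := node_eval_fun z1 u (inl c) => /= ->.
    rewrite big_sumType big_bool /= [X in _ + X]big1 => [|i _]; last by rewrite mul0r.
    by case: c; rewrite /= ?mulr1 ?mulr0 ?addr0 ?add0r.
  rewrite (te false) (te true) /= /al /be mulNr opprK [_ * u0]mulrC [_ * u1]mulrC !mulcJ.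
  by rewrite -rcD u_unit.
(* The orthogonal projection onto the complement of u; it changes only the coordinates of 1 and
   z. *)
pose s := bf G v u; pose v' j := v j + (- s) * u j.
pose x := node_fun z v'; have Hx : H2 x by exact: H2_node_fun.
have hG := node_gram_hermitian z.
have xu : h2dot x (node_fun z u) = 0 by rewrite h2dot_node// bfDl uu mulr1 subrr.
have Kx : H2ab al be x.
  by apply: H2_H2ab => //; apply/eqP; rewrite -subr_eq0 -dot_u// xu.
have x1 : h2norm x <= 1.
  rewrite -(@ler_pXn2r _ 2)// ?nnegrE ?h2norm_ge0// expr1n.
  have : (h2norm x ^+ 2)%:C = qf G v - s * s^*.
    rewrite -qf_node// qfD -/s -(bfJ v u hG) -/s (qfE G u) uu conjN; ring.
  rewrite mulcJ => /(congr1 Re); rewrite ReD ReN /= => ->.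
  by have := sqr_ge0 (nc s); lra.
pose y (j : J) : C := t%:C * (symbol l j * v j).
pose k' := node_fun z y; have Hk : H2 k' by exact: H2_node_fun.
have v'r i : v' (inr i) = v (inr i) by rewrite /v' /= mulr0 addr0.
(* In v' and in y the coordinates of 1 and z are multiples of u, so against [H2ab al be] only the
   values at the nodes count. There y is v multiplied by conj(f(z_i)), which is the adjoint
   identity. *)
have dot_low g c : H2ab al be g ->
    \sum_(b : bool) (c * u (inl b))^* * taylor g b = 0.
  move=> /K_u e; rewrite big_bool /= !conjM.
  have -> : c^* * u1^* * taylor g 1 + c^* * u0^* * taylor g 0 =
      c^* * (be * taylor g 0 - al * taylor g 1) by rewrite /al /be; ring.
  by rewrite e mulr0.
have v'l c : v' (inl c) = (k - s) * u (inl c).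
  by rewrite /v'; case: c; rewrite /= -?/a -?/b ?ak ?bk; ring.
have yl c : y (inl c) = (t%:C * l * k) * u (inl c).
  by rewrite /y; case: c; rewrite /= -?/a -?/b ?ak ?bk; ring.
have yr i : y (inr i) = (f (z i))^* * v (inr i).
  by rewrite /y /= conjM conjV conj_rc; field.
have dot_x g : H2ab al be g -> h2dot g x = \sum_i (v (inr i))^* * g (z i).
  move=> Kg; rewrite h2dot_node_fun//; last exact: (H2ab_H2 Kg).1.
  rewrite big_sumType /= [X in X + _](_ : _ = 0) ?add0r.
    by apply: eq_bigr => i _; rewrite v'r.
  by apply: etrans (dot_low g (k - s) Kg); apply: eq_bigr => c _; rewrite v'l.
have Mx : MF F al be x.
  split=> // g [Kg gF]; rewrite h2dotJ//; last exact: (H2ab_H2 Kg).1.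
  rewrite dot_x// big1 ?conj0// => i _; rewrite gF ?mulr0//.
  by apply/FE; exists i.
have Kk : H2ab al be k'.
  have kE : k' = (fun p => t%:C * X p).
    by apply/funext => p; rewrite /X /node_fun mulr_sumr; apply: eq_bigr => j _; rewrite mulrA.
  apply: H2_H2ab => //; apply/eqP; rewrite -subr_eq0 kE taylorZ; last by case: HX.
  apply/eqP; rewrite /al /be mulNr opprK.
  transitivity (t%:C * (u0^* * taylor X 0 + u1^* * taylor X 1)); first by ring.
  by rewrite uXJ mulr0.
have := adjoint_lt ab1 Mx x1; rewrite (h2norm_adjoint Kk) => [|g Kg]; last first.
  rewrite /mult_op dot_x; last exact: Hinf1_mul_H2ab.
  rewrite h2dot_node_fun//; last exact: (H2ab_H2 Kg).1.
  rewrite big_sumType /= [X in _ = X + _](_ : _ = 0) ?add0r.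
    by apply: eq_bigr => i _; rewrite yr conjM conjK; ring.
  by apply: etrans (dot_low g (t%:C * l * k) Kg); apply: eq_bigr => c _; rewrite yl.
have : h2norm k' ^+ 2 = t ^+ 2.
  have := qfZ G (scale (symbol l) v) t%:C; rewrite -/y (qf_node z1 y) mulcJ nc_real => /(congr1 Re).
  by rewrite Re_realM X1 mulr1 /= => ->; rewrite real_normK// num_real.
move=> /eqP; rewrite eqrXn2 ?h2norm_ge0 ?(ltW t0)// => /eqP ->; rewrite ltxx.
by [].
Qed.

Lemma bf_scale (p q v w : J -> C) :
  bf (fun i j => p i * (q j)^* * G i j) v w = bf G (scale p v) (scale q w).
Proof. by apply: eq_bigr => i _; apply: eq_bigr => j _; rewrite conjM; ring. Qed.

Lemma symbol_contraction : exists l, forall v,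
  Re (qf G (scale (symbol l) v)) <= Re (qf G v).
Proof.
(* Writing T_l = T_0 + l P, with P the truncation to the coordinates of 1 and z, |T_l v|^2 - |v|^2
   expands into A, B and S; the derivative in l becomes <P v, T_l v>, the quantity in
   [critical_unit]. *)
pose A i j := symbol 0 i * (symbol 0 j)^* * G i j + (-1) * G i j.
pose B i j := low_part i * (symbol 0 j)^* * G i j.
pose S i j := low_part i * (low_part j)^* * G i j.
have symE l v : scale (symbol l) v = (fun j => symbol 0 j * v j + l * (low_part j * v j)).
  by apply/funext => -[b|i] /=; ring.
have BE v : qf B v = bf G (scale low_part v) (scale (symbol 0) v) by exact: bf_scale.
have SE v : qf S v = qf G (scale low_part v) by exact: bf_scale.
have gradE l v : qf (grad B S l) v = bf G (scale low_part v) (scale (symbol l) v).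
  by rewrite symE bfDr qf_grad BE SE.
have quadE l v : Re (qf (quad A B S l) v) = Re (qf G (scale (symbol l) v)) - Re (qf G v).
  rewrite symE qfD qf_quad BE SE qf_addm.
  have -> : qf (fun i j => symbol 0 i * (symbol 0 j)^* * G i j) v = qf G (scale (symbol 0) v).
    exact: bf_scale.
  rewrite -(bfJ _ (scale (symbol 0) v) (node_gram_hermitian z)).
  move: (bf G _ _) => b; move: (qf G _) (qf G _) (qf G v) => Q P X.
  have -> : P + -1 * X + 2 * l * b + l * l^* * Q = P + l * b + l * b + l * l^* * Q - X by ring.
  by rewrite -conjM !(ReD, ReN) ReJ.
have [|||l hl] := @minimax R _ A B S _ (delta (inl false)).
- by move=> v; rewrite SE (qf_node z1).
- have S1 : S (inl false) (inl false) = 1 by rewrite /S /low_part conj1 !mul1r.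
  by rewrite qfE bf_delta2 S1 ltr01.
- move=> l v; rewrite gradE quadE subr_le0 leNgt => crit; apply/negP => lt1.
  set N := Re (qf G (scale (symbol l) v)) in lt1.
  have N0 : 0 < N.
    by apply: le_lt_trans lt1; rewrite (qf_node z1) /= sqr_ge0.
  (* Rescaling v gives |T_l v| = 1; then |v| <= 1, and criticality is homogeneous. *)
  pose c := (Num.sqrt N)^-1; have c2 : c ^+ 2 * N = 1.
    by rewrite /c exprVn sqr_sqrtr ?ltW// mulVf// gt_eqF.
  have sc p : scale p (fun j => c%:C * v j) = (fun j => c%:C * (p j * v j)).
    by apply/funext => j; rewrite mulrCA.
  have cc : c%:C * (c%:C)^* = (c ^+ 2)%:C by rewrite mulcJ nc_real real_normK ?num_real.
  apply: (@critical_unit l (fun j => c%:C * v j)).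
  + by rewrite -gradE qfZ gradE crit mulr0.
  + by rewrite sc qfZ cc Re_realM.
  + rewrite qfZ cc Re_realM -c2 ler_wpM2l ?sqr_ge0//; exact: ltW.
by exists l => v; have := hl v; rewrite quadE subr_le0.
Qed.

Lemma ideal_approximant : injective z ->
  exists2 g, idealF F g & forall y, disk y -> nc (f y - g y) <= t.
Proof.
move=> zi; have [l hl] := symbol_contraction.
pose w i := f (z i) / t%:C.
(* The value prescribed at 0 is conj(l), since [node_val] conjugates values while [symbol] carries l
   itself. *)
have E : double_pick z w l^* = (fun i j => G i j + (-1) * (symbol l i * (symbol l j)^* * G i j)).
  have nv i : node_val w l^* i = symbol l i by case: i => [b|i] //=; rewrite conjK.
  by apply/funext => i; apply/funext => j; rewrite /double_pick !nv; ring.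
have pQ : psd (double_pick z w l^*).
  move=> v; rewrite E qf_addm.
  have -> : qf (fun i j => symbol l i * (symbol l j)^* * G i j) v = qf G (scale (symbol l) v).
    exact: bf_scale.
  by rewrite mulN1r ReD ReN subr_ge0; exact: hl.
have [g [hg g1] [g0 gw]] := pick_double z1 zi pQ.
have Hg : Hinf1 (fun y => t%:C * g y).
  split; first exact: holomorphicZ.
    exists t => y yd; rewrite ncM nc_real gtr0_norm// ler_piMr ?(ltW t0)//; exact: g1.
  by rewrite -taylor1E taylorZ// taylor1E g0 mulr0.
exists (fun y => f y - t%:C * g y).
  split; first exact: Hinf1B.
  by move=> y /FE[i ->]; rewrite gw mulrC divfK// subrr.
move=> y yd; rewrite opprB addrC subrK ncM nc_real gtr0_norm// ler_piMr ?(ltW t0)//.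
exact: g1.
Qed.

End CriticalPoints.

Theorem theorem4p1 (R : realType) (F : set R[i])
    (finF : finite_set F) (F_disk : F `<=` @disk R)
    (f : R[i] -> R[i]) (fH : Hinf1 f) :
  sup_dist f (idealF F) =
  ereal_sup
    [set op_norm_on (MF F ab.1 ab.2)
           (adjoint (H2ab ab.1 ab.2) (mult_op f))
    | ab in [set ab : R[i] * R[i] |
              Normc.normc ab.1 ^+ 2 + Normc.normc ab.2 ^+ 2 = 1]].
Proof.
apply/eqP; rewrite eq_le; apply/andP; split; last first.
  apply: ge_ereal_sup => _ [ab ab1 <-]; exact: op_norm_le_dist.
set S := ereal_sup _.
have S_ge al be x : nc al ^+ 2 + nc be ^+ 2 = 1 -> MF F al be x -> h2norm x <= 1 ->
    ((h2norm (adjoint (H2ab al be) (mult_op f) x))%:E <= S)%E.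
  move=> ab1 Mx x1; apply: (@le_trans _ _ (op_norm_on (MF F al be)
      (adjoint (H2ab al be) (mult_op f)))).
    by apply: ereal_sup_ubound; exists x.
  by apply: ereal_sup_ubound; exists (al, be).
(* The zero vector for the pair (1, 0) is admissible; S >= 0 makes t = r + e positive. *)
have S0 : (0 <= S)%E.
  have ab1 : nc (1 : R[i]) ^+ 2 + nc (0 : R[i]) ^+ 2 = 1.
    by rewrite nc1 nc0 expr1n expr0n addr0.
  apply: le_trans (S_ge 1 0 (fun=> 0) ab1 (MF_zero F ab1) _); last by rewrite h2norm0.
  by rewrite lee_fin h2norm_ge0.
(* Removing repetitions makes the enumeration of nodes injective, as interpolation requires. *)
have /finite_seqP[s0 Fs0] := finF; pose s := undup s0.
pose z (i : 'I_(size s)) := s`_i.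
have FE y : F y <-> exists i, y = z i.
  rewrite Fs0 /= -mem_undup; split=> [/(nthP 0)[i is_ <-]|[i ->]]; last exact: mem_nth.
  by exists (Ordinal is_).
have zi : injective z.
  by move=> i j /eqP; rewrite nth_uniq ?undup_uniq// => /eqP/val_inj.
have z1 i : nc (z i) < 1 by apply/diskE/F_disk/FE; exists i.
apply/lee_addgt0Pr => e e0; case SE : S S0 => [r| |]; rewrite ?leey// lee_fin => r0.
have t0 : 0 < r + e by rewrite ltr_wpDl.
have [|g gI fg] := ideal_approximant z1 FE fH t0 _ zi.
  move=> al be x ab1 Mx x1; apply: (@le_lt_trans _ _ r); last by rewrite ltrDl.
  by rewrite -lee_fin -SE; exact: S_ge.
apply: (@le_trans _ _ (sup_norm (fun y => f y - g y))).
  by apply: ereal_inf_lbound; exists g.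
by apply: ge_ereal_sup => _ [y yd <-]; rewrite lee_fin; exact: fg.
Qed.
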